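(* Let $\mathcal{C}$ be the class of nonempty open, bounded, convex subsets of $\mathbb{R}^2$, and for $\Omega\in\mathcal{C}$ let $$G(\Omega)=\frac{T(\Omega)\,\Lambda(\Omega)}{P(\Omega)^{2}}.$$ If $\tilde\Omega\in\mathcal{C}$ satisfies $$G(\tilde\Omega)=\max_{\Omega\in\mathcal{C}}G(\Omega),$$ then $\tilde\Omega$ is of class $C^1$ (that is, its boundary is of class $C^1$).
   Context: $P(\Omega)$ is the (De Giorgi) perimeter of $\Omega$. The torsional rigidity is $T(\Omega)=\max_{\varphi\in H_0^1(\Omega)\setminus\{0\}}\frac{(\int_\Omega\varphi\,dx)^2}{\int_\Omega|\nabla\varphi|^2dx}$, equivalently $T(\Omega)=\int_\Omega w\,dx$, where $w\in H^1_0(\Omega)$ solves $-\Delta w=1$ in $\Omega$. The first Dirichlet eigenvalue is $\Lambda(\Omega)=\min_{\varphi\in H_0^1(\Omega)\setminus\{0\}}\frac{\int_\Omega|\nabla\varphi|^2dx}{\int_\Omega\varphi^2dx}$. *)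

(* Defs.v *)
From HB Require Import structures.
From mathcomp Require Import all_boot all_order all_algebra.
From mathcomp Require Import all_classical all_reals all_analysis.

Set Implicit Arguments.
Unset Strict Implicit.
Unset Printing Implicit Defensive.

Import Order.TTheory GRing.Theory Num.Theory.
Import numFieldNormedType.Exports.

Local Open Scope classical_set_scope.
Local Open Scope ring_scope.

Section Definitions.
Variable R : realType.

(* The norm carried by the product type R * R is the sup norm. It is used only
   for the topology and for boundedness; wherever the Euclidean norm matters it
   is spelled out in coordinates. *)
Local Notation plane := (R * R)%type.

Implicit Types (Om : set plane) (u g f psi : plane -> R).

(* The same type with its Borel sigma-algebra. Since every Lebesgue-measurable
   function agrees almost everywhere with a Borel one, working with Borel
   functions yields the same spaces L^2 and H^1 of classes of functions. *)
Local Notation mplane := (measurableTypeR R * measurableTypeR R)%type.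

Definition leb2 : {measure set mplane -> \bar R} :=
  (@lebesgue_measure R \x @lebesgue_measure R)%E.

Definition e1 : plane := (1, 0).
Definition e2 : plane := (0, 1).

Fixpoint Ck (k : nat) f : Prop :=
  continuous f /\
  if k is k'.+1 then
    forall v, v = e1 \/ v = e2 ->
      (forall p, derivable f p v) /\ Ck k' (fun p => 'D_v f p)
  else True.

Definition compactly_supported Om f : Prop :=
  let supp := closure [set p | f p != 0] in compact supp /\ supp `<=` Om.

Definition test_function Om psi : Prop :=
  (forall k, Ck k psi) /\ compactly_supported Om psi.

Definition L2 (Om : set mplane) (u : mplane -> R) : Prop :=
  measurable_fun Om u /\ leb2.-integrable Om (fun p => (u p ^+ 2)%:E).

Definition weak_partial Om (v : plane) u g : Prop :=
  forall psi, test_function Om psi ->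
    \int[leb2]_(p in Om) (u p * 'D_v psi p) =
    - \int[leb2]_(p in Om) (g p * psi p).

(* u belongs to H^1(Om) and has weak gradient (g1, g2); only the values of
   these functions on Om, up to null sets, are relevant. *)
Definition H1 Om u g1 g2 : Prop :=
  [/\ L2 Om u, L2 Om g1, L2 Om g2, weak_partial Om e1 u g1
    & weak_partial Om e2 u g2].

(* H^1_0(Om) is the closure of the test functions in H^1(Om). *)
Definition H10 Om u g1 g2 : Prop :=
  H1 Om u g1 g2 /\
  forall eps : R, 0 < eps -> exists2 psi, test_function Om psi &
    \int[leb2]_(p in Om) ((psi p - u p) ^+ 2)
    + \int[leb2]_(p in Om) (('D_e1 psi p - g1 p) ^+ 2)
    + \int[leb2]_(p in Om) (('D_e2 psi p - g2 p) ^+ 2) < eps.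

Definition dirichlet Om g1 g2 : R :=
  \int[leb2]_(p in Om) (g1 p ^+ 2 + g2 p ^+ 2).

(* torsion and eigenvalue1 are the max and the min over H^1_0(Om) minus 0 of the
   usual quotients, written as a supremum and an infimum so that they are
   defined for every Om. *)
Definition torsion Om : \bar R :=
  ereal_sup [set t | exists u g1 g2,
    [/\ H10 Om u g1 g2, ~ ae_eq leb2 Om u (cst 0)
      & t = ((\int[leb2]_(p in Om) u p) ^+ 2 / dirichlet Om g1 g2)%:E]].

Definition eigenvalue1 Om : \bar R :=
  ereal_inf [set t | exists u g1 g2,
    [/\ H10 Om u g1 g2, ~ ae_eq leb2 Om u (cst 0)
      & t = (dirichlet Om g1 g2 / \int[leb2]_(p in Om) (u p ^+ 2))%:E]].

(* De Giorgi perimeter: the total variation of the indicator function of Om *)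
Definition perimeter Om : \bar R :=
  ereal_sup [set t | exists F1 F2 : plane -> R,
    [/\ Ck 1 F1 /\ compactly_supported setT F1,
        Ck 1 F2 /\ compactly_supported setT F2,
        forall p, F1 p ^+ 2 + F2 p ^+ 2 <= 1
      & t = (\int[leb2]_(p in Om) ('D_e1 F1 p + 'D_e2 F2 p))%:E]].

Definition G Om : \bar R :=
  (torsion Om * eigenvalue1 Om / perimeter Om ^+ 2)%E.

Definition convex_domain Om : Prop :=
  [/\ Om !=set0, open Om, bounded_set Om
    & convex_set (Om : set (convex_lmodType plane))].

Definition C1_fun (gamma : R -> R) : Prop :=
  (forall t, derivable gamma t 1) /\ continuous (derive1 gamma).

(* Near each boundary point, in the coordinates given by a rotated orthonormal
   frame ((c, s), (- s, c)), Om is the strict epigraph of a C^1 function. *)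
Definition C1_domain Om : Prop :=
  forall p, (closure Om `\` interior Om) p ->
    exists c s : R, exists gamma : R -> R,
      [/\ c ^+ 2 + s ^+ 2 = 1, C1_fun gamma
        & \forall q \near p,
            Om q <-> gamma (c * q.1 + s * q.2) < - s * q.1 + c * q.2].

End Definitions.

(* Main.v *)
(* Suppose that Om maximises G and has a corner at a boundary point: there is an
   affine function l vanishing at the corner with l >= k |. - corner| on Om. Cut
   off the tip {l <= e}, where e is small. The eigenvalue does not decrease.

   The torsion drops by at most O(e^2). Indeed v = l (d - l) / 2 satisfies
   - Laplace v = 1, and the Dirichlet integral of v phi equals the integral of
   v^2 |grad phi|^2 + v phi^2. Hence a competitor for Om may be truncated so that
   |phi| <= 2 and then multiplied by a cutoff in l at scale e, at a cost bounded
   by the area of the tip.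

   The perimeter drops by at least c e. A field competing for the perimeter of
   the cut domain is continued inside the tip by a field of length <= 1 which is
   nearly - grad l along the cut and has divergence tau / e, while the tip has
   area >= c e^2.

   Hence G increases strictly, a contradiction. So every boundary point has a
   unique supporting slope, and a convex function whose subdifferentials are
   singletons is of class C^1. *)

Require Import Defs.
From mathcomp Require Import all_boot all_order all_algebra.
From mathcomp Require Import all_classical all_reals all_analysis.
From mathcomp Require Import measurable_realfun.
From mathcomp Require Import ring lra.

Set Implicit Arguments.
Unset Strict Implicit.
Unset Printing Implicit Defensive.

Import Order.TTheory GRing.Theory Num.Theory.
Import numFieldNormedType.Exports.

Local Open Scope classical_set_scope.
Local Open Scope ring_scope.

(** * Smooth functions *)

(** No torsion function, eigenfunction or boundary trace is used. Each of the three quantities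
    enters only as the best constant of an inequality over test functions or fields, so two domains
    are compared by modifying one arbitrary competitor, about whose behaviour near the boundary
    nothing is known. This shapes both estimates. For the torsion, writing a competitor as v phi
    gives the cutoff a weight: v <= d l is of order e near the tip and offsets the gradient 1/e of
    the cutoff, so the loss has bounded density there. Truncating phi is free since 2 v f - v f^2 =
    v (1 - (1 - f)^2) is largest at f = 1; the bound is 2 because the truncation is smooth. For the
    perimeter, the corner inequality confines the tip to diameter O(e). The inner field gains tau /
    e times an area of order e^2, while tilting it away from the normal by O(tau) costs tau^2 times
    a cut of length O(e); a small fixed tau keeps a gain linear in e. The divergence theorem on
    convex sets is replaced by the fundamental theorem of calculus on coordinate slices. *)

Section SmoothCalculus.
Context {R : realType} {V : normedModType R}.
Implicit Types (D : set V) (f u : V -> R) (g : R -> R).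

(** The set [D] of directions is a parameter so that one induction serves both the plane with its
    two axes ([Ck]) and the line with direction 1 ([Cn1]). *)
Fixpoint Cn D (k : nat) f : Prop :=
  continuous f /\
  if k is k'.+1 then
    forall v, D v -> (forall p, derivable f p v) /\ Cn D k' (fun p => 'D_v f p)
  else True.

Lemma Cn_continuous D k f : Cn D k f -> continuous f.
Proof. by case: k => [|k] []. Qed.

Lemma CnS D k f : Cn D k.+1 f -> Cn D k f.
Proof.
elim: k f => [|k IH] f; first by case.
move=> [cf H]; split=> // v Dv; have [df Cf] := H v Dv.
by split=> //; exact: IH.
Qed.

Lemma Cn_deriv D k f v : D v -> Cn D k.+1 f ->
  (forall p, derivable f p v) /\ Cn D k (fun p => 'D_v f p).
Proof. by move=> Dv [_ /(_ v Dv)]. Qed.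

Lemma Cn_cst D k (a : R) : Cn D k (fun _ => a).
Proof.
elim: k a => [|k IH] a; first by split=> //; exact: cst_continuous.
split; first exact: cst_continuous.
move=> v Dv; split; first by move=> p; exact: derivable_cst.
have -> : (fun p => 'D_v (fun _ => a) p) = (fun _ : V => 0 : R).
  by apply/funext => p; exact: derive_cst.
exact: IH.
Qed.

Lemma CnD D k f u : Cn D k f -> Cn D k u -> Cn D k (fun p => f p + u p).
Proof.
elim: k f u => [|k IH] f u.
  by move=> [cf _] [cu _]; split=> // p; apply: cvgD; [exact: cf|exact: cu].
move=> [cf Hf] [cu Hu]; split.
  by move=> p; apply: cvgD; [exact: cf|exact: cu].
move=> v Dv; have [df Cf] := Hf v Dv; have [du Cu] := Hu v Dv.
split; first by move=> p; exact: (derivableD (df p) (du p)).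
have -> : (fun p => 'D_v (fun p => f p + u p) p)
   = (fun p => 'D_v f p + 'D_v u p).
  by apply/funext => p; exact: (deriveD (df p) (du p)).
exact: IH.
Qed.

Lemma CnM D k f u : Cn D k f -> Cn D k u -> Cn D k (fun p => f p * u p).
Proof.
elim: k f u => [|k IH] f u.
  by move=> [cf _] [cu _]; split=> // p; apply: cvgM; [exact: cf|exact: cu].
move=> Cf0 Cu0; have [cf Hf] := Cf0; have [cu Hu] := Cu0; split.
  by move=> p; apply: cvgM; [exact: cf|exact: cu].
move=> v Dv; have [df Cf] := Hf v Dv; have [du Cu] := Hu v Dv.
split; first by move=> p; exact: (derivableM (df p) (du p)).
have -> : (fun p => 'D_v (fun p => f p * u p) p)
   = (fun p => f p * 'D_v u p + u p * 'D_v f p).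
  by apply/funext => p; exact: (deriveM (df p) (du p)).
by apply: CnD; apply: IH => //; exact: CnS.
Qed.

Lemma CnZ D k (a : R) f : Cn D k f -> Cn D k (fun p => a * f p).
Proof. by move=> Cf; apply: CnM => //; exact: Cn_cst. Qed.

Lemma CnN D k f : Cn D k f -> Cn D k (fun p => - f p).
Proof.
move=> /(CnZ (-1)); congr (Cn _ _ _).
by apply/funext => p; rewrite mulN1r.
Qed.

Lemma CnB D k f u : Cn D k f -> Cn D k u -> Cn D k (fun p => f p - u p).
Proof. by move=> Cf /CnN; exact: CnD. Qed.

Lemma CnV D k f : (forall p, f p != 0) -> Cn D k f -> Cn D k (fun p => (f p)^-1).
Proof.
move=> f0; elim: k => [|k IH].
  by move=> [cf _]; split=> // p; apply: cvgV; [exact: f0|exact: cf].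
move=> Cf0; have [cf Hf] := Cf0; split.
  by move=> p; apply: cvgV; [exact: f0|exact: cf].
move=> v Dv; have [df Cf] := Hf v Dv.
split; first by move=> p; exact: (derivableV (f0 p) (df p)).
have -> : (fun p => 'D_v (fun p => (f p)^-1) p)
   = (fun p => - ((f p)^-1 * (f p)^-1) * 'D_v f p).
  by apply/funext => p; rewrite (deriveV (f0 p) (df p)) -invfM -expr2.
have CV := IH (CnS Cf0).
by apply: CnM => //; apply: CnN; exact: CnM.
Qed.

(** Only a directional derivative of [u] is given. Along the line [h *: v + p] everything becomes a
    function of one real variable, where derivability and differentiability agree. *)
Lemma is_derive_compV g u (p v : V) (dg du : R) :
  is_derive p v u du -> is_derive (u p) 1 g dg ->
  is_derive p v (fun q => g (u q)) (dg * du).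
Proof.
move=> Hu Hg.
have du0 : derivable (fun h : R => u (h *: v + p)) 0 1.
  by case: Hu => /derivable1P.
have dg0 : derivable g ((fun h : R => u (h *: v + p)) 0) 1.
  by rewrite /= scale0r add0r; case: Hg.
have lineE (w : V -> R) : 'D_v w p = (fun h : R => w (h *: v + p))^`()%classic 0.
  rewrite derive1E /derive; set g1 := fun h => h^-1 *: _; set g2 := fun h => h^-1 *: _.
  suff -> : g1 = g2 by [].
  by rewrite funeqE /g1 /g2 => h /=; rewrite addr0 scale0r add0r [_%:A]mulr1.
apply: DeriveDef.
  apply: (derivable1P (fun q => g (u q)) p v).2; apply/derivable1_diffP.
  by apply: (@differentiable_comp _ _ _ _ (fun h : R => u (h *: v + p)) g);
    apply/derivable1_diffP.
rewrite lineE (derive1_comp du0 dg0) /= -lineE scale0r add0r derive1E.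
by rewrite (@derive_val _ _ _ _ _ _ _ Hg) (@derive_val _ _ _ _ _ _ _ Hu).
Qed.

End SmoothCalculus.

Definition Cn1 (R : realType) (k : nat) (g : R -> R) : Prop :=
  @Cn R R [set 1] k g.

Section Comp.
Context {R : realType} {V : normedModType R}.
Implicit Types (D : set V) (u : V -> R) (g : R -> R).

Lemma Cn_comp D k g u :
  Cn1 k g -> Cn D k u -> Cn D k (fun p => g (u p)).
Proof.
elim: k g u => [|k IH] g u.
  move=> [cg _] [cu _]; split=> // p.
  by apply: (@continuous_comp _ _ _ u g); [exact: cu|exact: cg].
move=> Cg Cu; split.
  move=> p; apply: (@continuous_comp _ _ _ u g).
    exact: (Cn_continuous Cu).
  exact: (Cn_continuous Cg).
move=> v Dv; have [du Cdu] := Cn_deriv Dv Cu.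
have [dg Cdg] := @Cn_deriv R R [set 1] k g 1 erefl Cg.
have H p : is_derive p v (fun q => g (u q)) ('D_1 g (u p) * 'D_v u p).
  by apply: is_derive_compV; exact: derivableP.
split; first by move=> p; case: (H p).
have -> : (fun p => 'D_v (fun q => g (u q)) p)
    = (fun p => 'D_1 g (u p) * 'D_v u p).
  by apply/funext => p; case: (H p).
by apply: CnM => //; apply: (IH (fun t => 'D_1 g t) u) => //; exact: CnS.
Qed.

Lemma Cn_id k : Cn1 k (id : R -> R).
Proof.
have cid : continuous (id : R -> R) by move=> x; exact: (@cvg_id _ (nbhs x)).
case: k => [|k]; first by split.
split=> //.
move=> v Dv; split; first by move=> p; exact: derivable_id.
have -> : (fun p => 'D_v (id : R -> R) p) = (fun _ => v).
  by apply/funext => p; rewrite derive_id.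
exact: Cn_cst.
Qed.

End Comp.

(** * Smooth functions vanishing to infinite order at 0 *)

Section Flat.
Context {R : realType}.
Local Notation smooth := (fun g : R -> R => forall k, Cn1 k g).

(* The family is stable under differentiation, cf. is_derive_flat. *)
Definition flat (n : nat) (t : R) : R :=
  if 0 < t then t^-1 ^+ n * expR (- t^-1) else 0.

Lemma flat_ge0 n t : 0 <= flat n t.
Proof.
rewrite /flat; case: ifPn => // t0.
by rewrite mulr_ge0 ?expR_ge0// exprn_ge0// invr_ge0 ltW.
Qed.

(** This is s^(n+1) <= (n+1)! exp s at s = 1/t. The difference quotient of [flat n] at 0 is
    [flat n.+1], so the bound makes it tend to 0. *)
Lemma flat_le n t : flat n t <= n.+1`!%:R * `|t|.
Proof.
rewrite /flat; case: ifPn => [t0|_]; last by rewrite mulr_ge0.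
have it0 : 0 < t^-1 by rewrite invr_gt0.
have := expR_ge1Dxn n (ltW it0) => H.
have {}H : t^-1 ^+ n.+1 <= n.+1`!%:R * expR t^-1.
  rewrite mulrC -ler_pdivrMr ?ltr0n ?fact_gt0//; apply: le_trans H.
  by rewrite lerDr.
rewrite (gtr0_norm t0) expRN ler_pdivrMr ?expR_gt0//.
rewrite mulrAC -ler_pdivrMr// -exprSr//.
Qed.

Lemma flat_gt0 n t : 0 < t -> 0 < flat n t.
Proof. by move=> t0; rewrite /flat t0 mulr_gt0 ?expR_gt0// exprn_gt0// invr_gt0. Qed.

Lemma flat_le0 n t : t <= 0 -> flat n t = 0.
Proof. by move=> t0; rewrite /flat ltNge t0. Qed.

Lemma is_derive_flat n (t : R) :
  is_derive t 1 (flat n) (flat n.+2 t - n%:R * flat n.+1 t).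
Proof.
have [t0|t0|->] := ltgtP t 0.
- have H : \forall x \near t, (cst 0 : R -> R) x = flat n x.
    near=> x; rewrite flat_le0 ?ltW//; near: x; exact: lt_nbhsl.
  have Hd := @near_eq_is_derive R R R (cst 0) (flat n) t 1 0 H (is_derive_cst _ _ _).
  by apply: is_derive_eq Hd _; rewrite !flat_le0 ?ltW// mulr0 subr0.
- have H : \forall x \near t, (fun x : R => x^-1 ^+ n * expR (- x^-1)) x = flat n x.
    near=> x; rewrite /flat ifT//; near: x; exact: lt_nbhsr.
  have Hi : is_derive t 1 (fun x : R => x^-1) (- t ^- 2 *: 1).
    have did := @derivable_id R R t 1.
    have tn0 := lt0r_neq0 t0.
    apply: DeriveDef; first exact: (@derivableV R R id t 1 tn0 did).
    by rewrite (@deriveV R R id t 1 tn0 did) derive_id.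
  have Hn := is_deriveN Hi.
  have He := is_derive_compV Hn (is_derive_expR (- t^-1)).
  have Hm := is_deriveM (is_deriveX n Hi) He.
  have E : ((fun x : R => x^-1) ^+ n * (fun x : R => expR ((- (fun x : R => x^-1)) x)) : R -> R)
      = (fun x : R => x^-1 ^+ n * expR (- x^-1)).
    by apply/funext => x; rewrite exprfctE.
  rewrite {}E in Hm; have Hd := near_eq_is_derive H Hm.
  apply: is_derive_eq Hd _.
  rewrite /flat t0 exprfctE -exprVn /GRing.scale /=.
  have -> : (- (fun x : R => x^-1)) t = - t^-1 by [].
  case: n {H Hm} => [|n] /=; first by ring.
  by rewrite !exprS -natr1; ring.
- rewrite !flat_le0// mulr0 subr0.
  have Hc : (fun h : R => h^-1 *: ((flat n \o shift 0) (h *: 1) - flat n 0))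
     @ 0^' --> (0 : R).
    have -> : (fun h : R => h^-1 *: ((flat n \o shift 0) (h *: 1) - flat n 0))
       = flat n.+1.
      apply/funext => h /=; rewrite addr0 [_%:A]mulr1 [flat n 0]flat_le0// subr0.
      rewrite /flat; case: ifPn => h0; last by rewrite scaler0.
      by rewrite /GRing.scale /= exprS mulrA.
    apply: cvg_within_filter.
    apply: (@squeeze_cvgr _ _ _ _ (fun _ => 0) (fun t : R => n.+2`!%:R * `|t|)).
    - by near=> x; rewrite flat_ge0 flat_le.
    - exact: cvg_cst.
    - rewrite -[X in _ --> X](mulr0 (n.+2`!%:R : R)).
      apply: cvgM; first exact: cvg_cst.
      by rewrite -[X in _ --> X](@normr0 _ R); apply: cvg_norm; exact: cvg_id.
  by apply: DeriveDef; [apply/cvg_ex; exists 0|exact: cvg_lim Hc].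
Unshelve. all: by end_near. Qed.

Lemma Cn_flat n : smooth (flat n).
Proof.
move=> k; elim: k n => [|k IH] n.
  split=> // x; apply: differentiable_continuous; apply/derivable1_diffP.
  by have := is_derive_flat n x; case.
split.
  move=> x; apply: differentiable_continuous; apply/derivable1_diffP.
  by have := is_derive_flat n x; case.
move=> v ->; split; first by move=> p; have := is_derive_flat n p; case.
have -> : (fun p => 'D_1 (flat n) p)
    = (fun p => flat n.+2 p - n%:R * flat n.+1 p).
  by apply/funext => p; case: (is_derive_flat n p).
exact: (CnB (IH n.+2) (CnZ n%:R (IH n.+1))).
Qed.

Lemma flat0_le1 t : flat 0 t <= 1.
Proof.
rewrite /flat; case: ifPn => // t0; rewrite expr0 mul1r -expR0 ler_expR.
by rewrite oppr_le0 invr_ge0 ltW.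
Qed.

End Flat.

(** * One-variable profiles: step, truncation, plateau *)

Section Profiles.
Context {R : realType}.
Implicit Types t : R.

Lemma Cn1_continuous k (g : R -> R) : Cn1 k g -> continuous g.
Proof. exact: Cn_continuous. Qed.

Lemma Cn1_derive k (g : R -> R) : Cn1 k.+1 g ->
  (forall t, is_derive t 1 g ('D_1 g t)) /\ Cn1 k (fun t => 'D_1 g t).
Proof.
by move=> /(@Cn_deriv R R [set 1] k g 1 erefl)[dg Cg]; split.
Qed.

Definition step t : R := flat 0 t / (flat 0 t + flat 0 (1 - t)).

Lemma step_den_gt0 t : 0 < flat 0 t + flat 0 (1 - t).
Proof.
have [t0|t0] := ltP 0 t; first by rewrite ltr_pwDl ?flat_gt0 ?flat_ge0.
by rewrite ltr_wpDl ?flat_ge0// flat_gt0//; lra.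
Qed.

Lemma Cn_flat_onem n k : Cn1 k (fun t : R => flat n (1 - t)).
Proof.
apply: (@Cn_comp R R [set 1] k (flat n) (fun t : R => 1 - t)); first exact: Cn_flat.
by apply: CnB; [exact: Cn_cst|exact: Cn_id].
Qed.

Lemma Cn_step k : Cn1 k step.
Proof.
apply: CnM; first exact: Cn_flat.
apply: (@CnV R R [set 1] k (fun t => flat 0 t + flat 0 (1 - t))).
  by move=> t; exact: lt0r_neq0 (step_den_gt0 t).
by apply: CnD; [exact: Cn_flat|exact: Cn_flat_onem].
Qed.

Lemma step_le0 t : t <= 0 -> step t = 0.
Proof. by move=> t0; rewrite /step flat_le0 ?mul0r. Qed.

Lemma step_ge1 t : 1 <= t -> step t = 1.
Proof.
move=> t1; rewrite /step [flat 0 (1 - t)]flat_le0 ?addr0 ?divff//; last by lra.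
by rewrite lt0r_neq0// flat_gt0//; lra.
Qed.

Lemma step_ge0 t : 0 <= step t.
Proof. by rewrite divr_ge0 ?flat_ge0 ?addr_ge0 ?flat_ge0. Qed.

Lemma step_le1 t : step t <= 1.
Proof. by rewrite ler_pdivrMr ?step_den_gt0// mul1r lerDl flat_ge0. Qed.

Lemma is_derive_step t : is_derive t 1 step
  ((flat 2 t * flat 0 (1 - t) + flat 0 t * flat 2 (1 - t))
   / (flat 0 t + flat 0 (1 - t)) ^+ 2).
Proof.
have d1 := is_derive_flat 0 t.
have d2 : is_derive t 1 (fun t : R => flat 0 (1 - t)) (- flat 2 (1 - t)).
  have dm : is_derive t 1 (fun t : R => 1 - t) (-1).
    apply: is_derive_eq (is_deriveB (is_derive_cst (1 : R) t 1) (is_derive_id t 1)) _.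
    by rewrite sub0r.
  apply: is_derive_eq (is_derive_compV dm (is_derive_flat 0 (1 - t))) _.
  by rewrite mul0r subr0 mulrN1.
have d3 := is_deriveD d1 d2.
have n0 := lt0r_neq0 (step_den_gt0 t).
have d4 : is_derive t 1 (fun t : R => (flat 0 t + flat 0 (1 - t))^-1)
    ('D_1 (fun t : R => (flat 0 t + flat 0 (1 - t))^-1) t).
  apply: derivableP.
  by apply: (@derivableV R R (fun t => flat 0 t + flat 0 (1 - t))) => //; case: d3.
have E := @deriveV R R (fun t => flat 0 t + flat 0 (1 - t)) t 1 n0.
apply: is_derive_eq (is_deriveM d1 d4) _.
rewrite E; last by case: d3.
have -> : 'D_1 (fun t => flat 0 t + flat 0 (1 - t)) t
   = (flat 2 t - 0%:R * flat 1 t + - flat 2 (1 - t)) by case: d3.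
by rewrite /GRing.scale /= -exprVn; field.
Qed.

Lemma dstep_ge0 t : 0 <= 'D_1 step t.
Proof.
have [_ ->] := is_derive_step t.
by rewrite divr_ge0 ?sqr_ge0// addr_ge0// mulr_ge0// flat_ge0.
Qed.

Lemma dstep_ge1 t : 1 <= t -> 'D_1 step t = 0.
Proof.
have [_ ->] := is_derive_step t => t1.
by rewrite ![flat _ (1 - t)]flat_le0 ?mulr0 ?addr0 ?mul0r//; lra.
Qed.

Lemma dstep_le0 t : t <= 0 -> 'D_1 step t = 0.
Proof.
have [_ ->] := is_derive_step t => t0.
by rewrite ![flat _ t]flat_le0 ?mul0r ?addr0 ?mul0r//; lra.
Qed.

Lemma ddstep_gt1 t : 1 < t -> 'D_1 (fun t => 'D_1 step t) t = 0.
Proof.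
move=> t1; rewrite (@near_eq_derive R R R (fun t => 'D_1 step t) (cst 0)).
  by rewrite derive_cst.
by near=> x; rewrite dstep_ge1//; near: x; exact: lt_le_nbhsr.
Unshelve. all: by end_near. Qed.

Lemma ddstep_lt0 t : t < 0 -> 'D_1 (fun t => 'D_1 step t) t = 0.
Proof.
move=> t1; rewrite (@near_eq_derive R R R (fun t => 'D_1 step t) (cst 0)).
  by rewrite derive_cst.
by near=> x; rewrite dstep_le0//; near: x; exact: lt_le_nbhsl.
Unshelve. all: by end_near. Qed.

Lemma bounded_on_itv (g : R -> R) (a b : R) : a <= b -> continuous g ->
  exists2 K, 0 < K & forall t, a <= t <= b -> `|g t| <= K.
Proof.
move=> ab cg.
have c1 : {within `[a, b], continuous (fun t => `|g t|)}.
  apply: continuous_subspaceT => t; apply: cvg_norm; exact: cg.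
have [c _ Hc] := EVT_max ab c1.
exists (`|g c| + 1); first by rewrite ltr_wpDl.
move=> t tab; have := Hc t; rewrite in_itv /= => /(_ tab) H.
by apply: le_trans H _; rewrite lerDl.
Qed.

(** Off [0, 1] both derivatives vanish, and [0, 1] is compact. The constant does not depend on the
    height of the cut, and it enters the torsion loss. *)
Lemma step_bounds : exists2 K : R, 0 < K & forall t,
  `|'D_1 step t| <= K /\ `|'D_1 (fun t => 'D_1 step t) t| <= K.
Proof.
have [_ C1] := Cn1_derive (Cn_step 3).
have [_ C2] := Cn1_derive C1.
have [K1 K10 H1] := bounded_on_itv ler01 (Cn1_continuous C1).
have [K2 K20 H2] := bounded_on_itv ler01 (Cn1_continuous C2).
exists (K1 + K2); first exact: addr_gt0.
move=> t; split.
- have [t0|t0] := leP t 0; first by rewrite dstep_le0// normr0 ltW// addr_gt0.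
  have [t1|t1] := leP 1 t; first by rewrite dstep_ge1// normr0 ltW// addr_gt0.
  by apply: le_trans (H1 t _) _; [lra|rewrite lerDl ltW].
- have [t0|t0] := ltP t 0; first by rewrite ddstep_lt0// normr0 ltW// addr_gt0.
  have [t1|t1] := ltP 1 t; first by rewrite ddstep_gt1// normr0 ltW// addr_gt0.
  by apply: le_trans (H2 t _) _; [rewrite t0 t1|rewrite lerDr ltW].
Qed.

(* The identity on ]-oo, 1], with values below 2. *)
Definition cap t : R := t - (t - 1) * flat 0 (t - 1).

Lemma Cn_cap k : Cn1 k cap.
Proof.
have Cs : Cn1 k (fun t : R => t - 1) by apply: CnB; [exact: Cn_id|exact: Cn_cst].
apply: CnB; first exact: Cn_id.
apply: CnM => //.
by apply: (@Cn_comp R R [set 1] k (flat 0) (fun t : R => t - 1)) => //; exact: Cn_flat.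
Qed.

Lemma cap_le1 t : t <= 1 -> cap t = t.
Proof. by move=> t1; rewrite /cap flat_le0 ?mulr0 ?subr0//; lra. Qed.

Lemma cap_le t : cap t <= t.
Proof.
have [t1|t1] := leP t 1; first by rewrite cap_le1.
rewrite /cap gerDl oppr_le0 mulr_ge0 ?flat_ge0//; lra.
Qed.

Lemma cap_ge1 t : 1 <= t -> 1 <= cap t.
Proof.
move=> t1; rewrite /cap; have := @flat0_le1 R (t - 1); have := flat_ge0 0 (t - 1).
have : 0 <= t - 1 by lra.
nra.
Qed.

(** With s = t - 1 > 0, [cap t] is 1 + s (1 - exp (-1/s)), and 1 - exp (-1/s) < 1/s. *)
Lemma cap_lt2 t : cap t < 2.
Proof.
have [t1|t1] := leP t 1; first by rewrite cap_le1//; lra.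
rewrite /cap /flat ifT ?expr0 ?mul1r; last by lra.
set s := t - 1; have s0 : 0 < s by rewrite /s; lra.
have -> : t = 1 + s by rewrite /s; lra.
have H : 1 + - s^-1 < expR (- s^-1).
  by apply: expR_gt1Dx; rewrite oppr_eq0 invr_eq0 lt0r_neq0.
have : s * (1 + - s^-1) < s * expR (- s^-1) by rewrite ltr_pM2l.
by rewrite mulrDr mulrN divff ?lt0r_neq0//; lra.
Qed.

Lemma is_derive_cap t : is_derive t 1 cap (1 - flat 0 (t - 1) - flat 1 (t - 1)).
Proof.
have dm : is_derive t 1 (fun t : R => t - 1) 1.
  apply: is_derive_eq (is_deriveB (is_derive_id t 1) (is_derive_cst (1 : R) t 1)) _.
  by rewrite subr0.
have d0 := is_derive_compV dm (is_derive_flat 0 (t - 1)).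
apply: is_derive_eq (is_deriveB (is_derive_id t 1) (is_deriveM dm d0)) _.
rewrite /GRing.scale /= mul0r subr0 !mulr1 opprD addrA addrAC; congr (_ - _ - _).
rewrite /flat; case: ifPn => h; last by rewrite mulr0.
by rewrite mulrA expr2 mulrA divff ?mul1r ?expr1// lt0r_neq0.
Qed.

(** For s = t - 1 > 0 the lower bound reads (1 + 1/s) exp (-1/s) <= 1, that is 1 + x <= exp x. By
    [is_derive_cap], [cap] is thus nondecreasing and 1-Lipschitz. *)
Lemma dcap01 t : 0 <= 1 - flat 0 (t - 1) - flat 1 (t - 1) <= 1.
Proof.
have a0 := flat_ge0 0 (t - 1); have b0 := flat_ge0 1 (t - 1).
apply/andP; split; last by lra.
rewrite -addrA -opprD subr_ge0.
rewrite /flat; case: ifPn => // h.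
rewrite expr0 expr1 -mulrDl expRN ler_pdivrMr ?expR_gt0// mul1r.
exact: expR_ge1Dx.
Qed.

(** [cap] applied from above and then, after a change of sign, from below: smooth, odd in effect,
    the identity on [-1, 1]. *)
Definition trunc t : R := - cap (- cap t).

Lemma Cn_trunc k : Cn1 k trunc.
Proof.
apply: CnN; apply: (@Cn_comp R R [set 1] k cap (fun t => - cap t)); first exact: Cn_cap.
by apply: CnN; exact: Cn_cap.
Qed.

Lemma trunc_id t : -1 <= t <= 1 -> trunc t = t.
Proof. by move=> /andP[t1 t2]; rewrite /trunc (cap_le1 t2) cap_le1 ?opprK//; lra. Qed.

Lemma trunc_ge1 t : 1 <= t -> trunc t = cap t.
Proof. by move=> t1; rewrite /trunc cap_le1 ?opprK//; have := cap_ge1 t1; lra. Qed.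

Lemma trunc_leN1 t : t <= -1 -> trunc t = - cap (- t).
Proof. by move=> t1; rewrite /trunc (@cap_le1 t)//; lra. Qed.

Lemma trunc_sqr t : trunc t ^+ 2 <= 4.
Proof.
have H : -2 <= trunc t <= 2.
  have [t1|t1] := leP 1 t.
    by rewrite trunc_ge1//; have := cap_ge1 t1; have := cap_lt2 t; lra.
  have [t2|t2] := leP t (-1).
    have t3 : 1 <= - t by lra.
    by rewrite trunc_leN1//; have := cap_ge1 t3; have := cap_lt2 (- t); lra.
  by rewrite trunc_id//; lra.
have : 0 <= (2 - trunc t) * (2 + trunc t) by apply: mulr_ge0; lra.
nra.
Qed.

(** Distance to 1 is the relevant measure: divided by v, the zero order part of the torsion density
    is 2 f - f^2 = 1 - (1 - f)^2. *)
Lemma trunc_dist1 t : (1 - trunc t) ^+ 2 <= (1 - t) ^+ 2.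
Proof.
have [t1|t1] := leP 1 t.
  rewrite trunc_ge1//; have := cap_ge1 t1; have := cap_le t; nra.
have [t2|t2] := leP t (-1); last by rewrite trunc_id//; lra.
have t3 : 1 <= - t by lra.
rewrite trunc_leN1//; have := cap_ge1 t3; have := cap_le (- t); nra.
Qed.

Lemma dtrunc_sqr t : ('D_1 trunc t) ^+ 2 <= 1.
Proof.
have d1 := is_derive_cap t.
have d2 := is_deriveN (is_derive_compV (is_deriveN d1) (is_derive_cap (- cap t))).
have [_ ->] := d2.
have := dcap01 t; have := dcap01 (- cap t).
set a := _ - flat 1 (- cap t - 1); set b := _ - flat 1 (t - 1).
move=> /andP[a0 a1] /andP[b0 b1]; rewrite mulrN opprK exprMn.
have : a ^+ 2 <= 1 by rewrite expr_le1.
have : b ^+ 2 <= 1 by rewrite expr_le1.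
have := sqr_ge0 a; have := sqr_ge0 b.
set x := b ^+ 2; set y := a ^+ 2; nra.
Qed.

(* A smooth positive function that is the identity on [d, +oo[. *)
Definition posid (d t : R) : R := d * (2 - cap (2 - d^-1 * t)).

Lemma posid_gt0 d t : 0 < d -> 0 < posid d t.
Proof. by move=> d0; rewrite mulr_gt0// subr_gt0 cap_lt2. Qed.

Lemma posid_id d t : 0 < d -> d <= t -> posid d t = t.
Proof.
move=> d0 dt; rewrite /posid cap_le1.
  by rewrite opprB addrCA subrr addr0 mulrA divff ?mul1r// lt0r_neq0.
have : 1 <= d^-1 * t by rewrite mulrC ler_pdivlMr// mul1r.
lra.
Qed.

Lemma Cn_posid d k : Cn1 k (posid d).
Proof.
apply: CnZ; apply: CnB; first exact: Cn_cst.
apply: (@Cn_comp R R [set 1] k cap (fun t => 2 - d^-1 * t)); first exact: Cn_cap.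
by apply: CnB; [exact: Cn_cst|apply: CnZ; exact: Cn_id].
Qed.

(* Equals 1 on [-1, 1] and vanishes outside ]-2, 2[. *)
Definition plateau t : R := step (2 - t) * step (2 + t).

Lemma Cn_plateau k : Cn1 k plateau.
Proof.
apply: CnM.
  apply: (@Cn_comp R R [set 1] k step (fun t => 2 - t)); first exact: Cn_step.
  by apply: CnB; [exact: Cn_cst|exact: Cn_id].
apply: (@Cn_comp R R [set 1] k step (fun t => 2 + t)); first exact: Cn_step.
by apply: CnD; [exact: Cn_cst|exact: Cn_id].
Qed.

Lemma plateau_eq1 t : -1 <= t <= 1 -> plateau t = 1.
Proof. by move=> /andP[a b]; rewrite /plateau !step_ge1 ?mulr1//; lra. Qed.

Lemma plateau_eq0 t : 2 <= `|t| -> plateau t = 0.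
Proof.
rewrite /plateau real_ler_normr ?num_real// => /orP[h|h].
  by rewrite step_le0 ?mul0r//; lra.
by rewrite [X in _ * X]step_le0 ?mulr0//; lra.
Qed.

Lemma plateau01 t : 0 <= plateau t <= 1.
Proof.
by rewrite mulr_ge0 ?step_ge0//= mulr_ile1 ?step_ge0 ?step_le1.
Qed.

End Profiles.

(** * Differential calculus in the plane *)

Section PlaneCalculus.
Context {R : realType}.
Local Notation plane := (R * R)%type.
Implicit Types (Om : set plane) (u f psi : plane -> R).

Definition axes : set plane := [set v | v = e1 R \/ v = e2 R].

Lemma CkE k f : Ck k f <-> Cn axes k f.
Proof.
elim: k f => [|k IH] f; first by [].
split=> -[cf H]; split=> // v Dv; have [df Cf] := H v Dv; split=> //; exact/IH.
Qed.

Lemma fst_cont : continuous (fst : plane -> R).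
Proof. by move=> p; exact: cvg_fst. Qed.

Lemma snd_cont : continuous (snd : plane -> R).
Proof. by move=> p; exact: cvg_snd. Qed.

Definition aff (a b c : R) (p : plane) : R := a * p.1 + b * p.2 + c.

Lemma is_derive_aff a b c p v : is_derive p v (aff a b c) (a * v.1 + b * v.2).
Proof.
have E : (fun h : R => h^-1 *: ((aff a b c \o shift p) (h *: v) - aff a b c p))
   @ 0^' --> a * v.1 + b * v.2.
  apply: cvg_near_cst; near=> h.
  have h0 : h != 0 by near: h; exact: nbhs_dnbhs_neq.
  by rewrite /aff /= /GRing.scale /=; field.
by apply: DeriveDef; [apply/cvg_ex; eexists; exact: E|exact: cvg_lim E].
Unshelve. all: by end_near. Qed.

Lemma aff_cont a b c : continuous (aff a b c).
Proof.
move=> p; apply: cvgD; last exact: cvg_cst.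
by apply: cvgD; (apply: cvgM; first exact: cvg_cst); [exact: fst_cont|exact: snd_cont].
Qed.

Lemma Ck_aff a b c k : Ck k (aff a b c).
Proof.
case: k => [|k]; first by split=> //; exact: aff_cont.
split; first exact: aff_cont.
move=> v Dv; split; first by move=> p; case: (is_derive_aff a b c p v).
have -> : (fun p => 'D_v (aff a b c) p) = (fun _ => a * v.1 + b * v.2).
  by apply/funext => p; case: (is_derive_aff a b c p v).
by apply/CkE; exact: Cn_cst.
Qed.

Lemma CkD k f u : Ck k f -> Ck k u -> Ck k (fun p => f p + u p).
Proof. by move=> /CkE Cf /CkE Cu; apply/CkE; exact: CnD. Qed.

Lemma CkM k f u : Ck k f -> Ck k u -> Ck k (fun p => f p * u p).
Proof. by move=> /CkE Cf /CkE Cu; apply/CkE; exact: CnM. Qed.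

Lemma CkN k f : Ck k f -> Ck k (fun p => - f p).
Proof. by move=> /CkE Cf; apply/CkE; exact: CnN. Qed.

Lemma CkB k f u : Ck k f -> Ck k u -> Ck k (fun p => f p - u p).
Proof. by move=> Cf /CkN; exact: CkD. Qed.

Lemma Ck_cst k (a : R) : Ck k (fun _ : plane => a).
Proof. by apply/CkE; exact: Cn_cst. Qed.

Lemma CkZ k (a : R) f : Ck k f -> Ck k (fun p => a * f p).
Proof. by move=> Cf; apply: CkM => //; exact: Ck_cst. Qed.

Lemma Ck_comp k (g : R -> R) u : Cn1 k g -> Ck k u -> Ck k (fun p => g (u p)).
Proof. by move=> Cg /CkE Cu; apply/CkE; exact: Cn_comp. Qed.

Lemma Ck_continuous k f : Ck k f -> continuous f.
Proof. by move=> /CkE /Cn_continuous. Qed.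

Lemma Ck_is_derive k f v p : axes v -> Ck k.+1 f -> is_derive p v f ('D_v f p).
Proof. by move=> Dv [_ /(_ v Dv)[df _]]; exact: derivableP. Qed.

Lemma Ck_D k f v : axes v -> Ck k.+1 f -> Ck k (fun p => 'D_v f p).
Proof. by move=> Dv [_ /(_ v Dv)[_ Cf]]. Qed.

Lemma axes1 : axes (e1 R). Proof. by left. Qed.
Lemma axes2 : axes (e2 R). Proof. by right. Qed.

Lemma is_deriveMr_ f u (p v : plane) (df du : R) :
  is_derive p v f df -> is_derive p v u du ->
  is_derive p v (fun q => f q * u q) (f p * du + u p * df).
Proof. exact: is_deriveM. Qed.

Lemma is_deriveDr_ f u (p v : plane) (df du : R) :
  is_derive p v f df -> is_derive p v u du ->
  is_derive p v (fun q => f q + u q) (df + du).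
Proof. exact: is_deriveD. Qed.

Lemma is_deriveNr_ f (p v : plane) (df : R) :
  is_derive p v f df -> is_derive p v (fun q => - f q) (- df).
Proof. exact: is_deriveN. Qed.

Lemma compactly_supported_sub Om f u : compactly_supported Om f ->
  (forall p, f p = 0 -> u p = 0) -> compactly_supported Om u.
Proof.
move=> [cf sf] H.
have S : closure [set p | u p != 0] `<=` closure [set p | f p != 0].
  by apply: closure_subset => p /=; apply: contra_neq; exact: H.
split; last by move=> p /S /sf.
by apply: subclosed_compact S => //; exact: closed_closure.
Qed.

Lemma compactly_supportedS Om Om' f : Om `<=` Om' ->
  compactly_supported Om f -> compactly_supported Om' f.
Proof. by move=> S [cf sf]; split=> // p /sf /S. Qed.

Lemma D_outside_support f (p v : plane) :
  ~ closure [set p | f p != 0] p -> f p = 0 /\ 'D_v f p = 0.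
Proof.
move=> np; split.
  apply/eqP/negPn/negP => fp; apply: np; exact: subset_closure.
rewrite (@near_eq_derive _ _ _ f (cst 0)) ?derive_cst//.
have : open (~` closure [set p | f p != 0]).
  by apply: closed_openC; exact: closed_closure.
rewrite openE => /(_ p np); rewrite /interior => H.
apply: filterS H => q nq; apply/eqP/negPn/negP => fq; apply: nq.
exact: subset_closure.
Qed.

Lemma test_functionS Om Om' psi : Om `<=` Om' ->
  test_function Om psi -> test_function Om' psi.
Proof. by move=> S [Cp sp]; split=> //; exact: compactly_supportedS sp. Qed.

Lemma test_functionM Om psi u : test_function Om psi -> (forall k, Ck k u) ->
  test_function Om (fun p => psi p * u p).
Proof.
move=> [Cp sp] Cu; split; first by move=> k; exact: CkM.
by apply: compactly_supported_sub sp _ => p ->; rewrite mul0r.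
Qed.

Lemma test_function_comp Om psi (g : R -> R) : test_function Om psi ->
  (forall k, Cn1 k g) -> g 0 = 0 -> test_function Om (fun p => g (psi p)).
Proof.
move=> [Cp sp] Cg g0; split; first by move=> k; exact: Ck_comp.
by apply: compactly_supported_sub sp _ => p ->.
Qed.

End PlaneCalculus.

(** * Integration over bounded open sets *)

Section PlaneMeasure.
Context {R : realType}.
Local Notation plane := (R * R)%type.
Local Notation mplane := (measurableTypeR R * measurableTypeR R)%type.
Implicit Types (Om : set plane) (f g F : plane -> R).

(** The sigma-algebra is a product of two, so U has to be a countable union of rectangles: the
    squares with rational centre and radius 1/(n+1) that lie in U. *)
Lemma open_measurable_plane (U : set plane) :
  open U -> measurable (U : set mplane).
Proof.
move=> oU.
pose B (q : rat * rat * nat) : set mplane :=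
  ball (ratr q.1.1 : R) q.2.+1%:R^-1 `*` ball (ratr q.1.2 : R) q.2.+1%:R^-1.
pose C q : set mplane := if `[< B q `<=` U >] then B q else set0.
have -> : U = \bigcup_q C q.
  apply/seteqP; split => [p Up|p [q _]]; last first.
    by rewrite /C; case: asboolP => // H /H.
  have : nbhs p U by move: oU; rewrite openE => /(_ p Up).
  move=> /nbhs_ballP[e /= e0 He].
  have [n Hn] : exists n, n.+1%:R^-1 < e / 2 :> R.
    have e20 : 0 < e / 2 by rewrite divr_gt0.
    exists (Num.truncn (e / 2)^-1).
    by rewrite invf_plt ?posrE// truncnS_gt// .
  set r := n.+1%:R^-1 in Hn.
  have r0 : 0 < r by rewrite invr_gt0.
  have dense (x : R) : exists a : rat, `|ratr a - x| < r.
    have /rat_in_itvoo[a] : x - r < x + r by lra.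
    by rewrite in_itv /= => /andP[h1 h2]; exists a; rewrite ltr_norml; lra.
  have [a Ha] := dense p.1; have [b Hb] := dense p.2.
  exists (a, b, n) => //; rewrite /C asboolT; first by split.
  move=> q [/= h1 h2]; apply: He; split.
  - rewrite /ball /= in h1 *; rewrite /ball_ in h1 *.
    have -> : p.1 - q.1 = - (ratr a - p.1) + (ratr a - q.1) by ring.
    by apply: le_lt_trans (ler_normD _ _) _; rewrite normrN /=; move: h1; rewrite -/r; lra.
  - rewrite /ball /= in h2 *; rewrite /ball_ in h2 *.
    have -> : p.2 - q.2 = - (ratr b - p.2) + (ratr b - q.2) by ring.
    by apply: le_lt_trans (ler_normD _ _) _; rewrite normrN /=; move: h2; rewrite -/r; lra.
apply: countable_bigcupT_measurable; first exact: countableP.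
move=> q; rewrite /C; case: asboolP => // _.
by apply: measurableX; apply: open_measurable; exact: ball_open.
Qed.

Lemma continuous_measurable_plane f :
  continuous f -> measurable_fun setT (f : mplane -> R).
Proof.
move=> /continuousP cf; apply: (measurability _ (RGenOpens.measurableE R)).
move=> _ [_ [a [b ->] <-]]; rewrite setTI.
by apply: open_measurable_plane; exact/cf/interval_open.
Qed.

Definition boxed (M : R) Om := forall p, Om p -> `|p.1| <= M /\ `|p.2| <= M.

Definition bdomain Om := open Om /\ exists M, boxed M Om.

Lemma leb2_boxed M Om : measurable (Om : set mplane) -> boxed M Om ->
  (leb2 R Om < +oo)%E.
Proof.
move=> mOm bOm; pose Q : set mplane := `[-M, M]%classic `*` `[-M, M]%classic.
have mQ : measurable Q by apply: measurableX.
have OQ : Om `<=` Q.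
  move=> p /bOm[h1 h2]; split=> /=; rewrite in_itv /= -ler_norml//.
apply: (@le_lt_trans _ _ (leb2 R Q)); first by apply: le_measure; rewrite ?inE.
have -> : leb2 R Q = (@lebesgue_measure R `[(- M)%R, M]%classic
    * @lebesgue_measure R `[(- M)%R, M]%classic)%E by exact: product_measure1E.
rewrite !lebesgue_measure_itv /=.
by case: ifPn => _; rewrite -?EFinD -?EFinM ?mule0 ltry.
Qed.

Lemma continuous_bounded M f : continuous f ->
  exists2 K, 0 < K & forall p, `|p.1| <= M -> `|p.2| <= M -> `|f p| <= K.
Proof.
move=> cf; pose Q : set plane := `[-M, M]%classic `*` `[-M, M]%classic.
have cQ : compact Q by apply: compact_setX; exact: segment_compact.
have /compact_bounded[K [_ HK]] : compact (f @` Q).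
  by apply: continuous_compact => //; apply: continuous_subspaceT.
exists (`|K| + 1); first by rewrite ltr_wpDl.
move=> p h1 h2; apply: (HK (`|K| + 1)); first by have := ler_norm K; lra.
by exists p => //; split=> /=; rewrite in_itv /= -ler_norml.
Qed.

Lemma bdomain_measurable Om : bdomain Om -> measurable (Om : set mplane).
Proof. by move=> [oO _]; exact: open_measurable_plane. Qed.

Lemma bdomain_finite Om : bdomain Om -> (leb2 R Om < +oo)%E.
Proof. by move=> bO; have [_ [M bM]] := bO; exact: leb2_boxed (bdomain_measurable bO) bM. Qed.

Lemma continuous_integrable Om f : bdomain Om -> continuous f ->
  (leb2 R).-integrable Om (EFin \o f).
Proof.
move=> bO cf; have [_ [M bM]] := bO.
have [K K0 HK] := continuous_bounded M cf.
apply: measurable_bounded_integrable.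
- exact: bdomain_measurable.
- exact: bdomain_finite.
- by apply: measurable_funTS; exact: continuous_measurable_plane.
- exists K; split; first exact: num_real.
  by move=> x Kx p /bM[h1 h2]; apply: le_trans (HK _ h1 h2) (ltW Kx).
Qed.

Definition area Om : R := \int[leb2 R]_(p in Om) 1.

Lemma closure_inf (A : set R) : has_inf A -> closure A (inf A).
Proof.
move=> hA B /nbhs_ballP[e /= e0 He].
have [x Ax xe] := inf_adherent e0 hA.
exists x; split=> //; apply: He; rewrite /ball /= ltr_norml.
by have := ge_inf hA.2 Ax; lra.
Qed.

Lemma slice_bound (S : set R) (F f : R -> R) (b : R) :
  open S -> is_interval S -> has_lbound S -> has_ubound S ->
  (forall y : R, is_derive y 1 F (f y)) -> continuous f ->
  0 <= b -> (forall y, closure S y -> ~ S y -> `|F y| <= b) ->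
  (`|\int[@lebesgue_measure R]_(y in S) (f y)%:E| <= (2 * b)%:E)%E.
Proof.
move=> oS iS lS uS dF cf b0 Hb.
have cF : continuous F.
  by move=> x; apply/differentiable_continuous/derivable1_diffP; case: (dF x).
have [->|/set0P S0] := eqVneq S set0.
  by rewrite integral_set0 abse0 lee_fin mulr_ge0.
have E : S = `]inf S, sup S[%classic.
  have := interval_bounded_interior iS lS uS.
  by rewrite (interior_id _).1 // => {1}->; apply/seteqP; split=> x /=; rewrite in_itv.
have iSs : inf S < sup S.
  by move: S0 => [x]; rewrite {1}E /= in_itv /= => /andP[]; exact: lt_trans.
have hi : has_inf S by split.
have hs : has_sup S by split.
have Ninf : ~ S (inf S) by rewrite {1}E /= in_itv /= ltxx.
have Nsup : ~ S (sup S) by rewrite {1}E /= in_itv /= ltxx andbF.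
have Binf := Hb _ (closure_inf hi) Ninf.
have Bsup := Hb _ (closure_sup S0 uS) Nsup.
have mf : measurable_fun setT f by exact: continuous_measurable_fun.
rewrite E -(@integral_itv_bndoo R _ _ (EFin \o f) true false); last first.
  by apply/measurable_EFinP; exact: measurable_funTS.
rewrite (@continuous_FTC2 _ f F)//.
- rewrite -EFinB abse_EFin lee_fin; apply: le_trans (ler_normB _ _) _.
  by move: Binf Bsup; lra.
- exact: continuous_subspaceT.
- split.
  + by move=> x _; case: (dF x).
  + by apply: cvg_at_right_filter; exact: cF.
  + by apply: cvg_at_left_filter; exact: cF.
- by move=> x _; rewrite derive1E; case: (dF x).
Qed.

Lemma derive_slice2 f (p : plane) (d : R) :
  is_derive p (e2 R) f d -> is_derive p.2 1 (fun y => f (p.1, y)) d.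
Proof.
case: p => x y /= [df <-].
have E : (fun h : R => h^-1 *: (((fun y => f (x, y)) \o shift y) (h *: 1) - f (x, y)))
    = (fun h : R => h^-1 *: ((f \o shift (x, y)) (h *: e2 R) - f (x, y))).
  apply/funext => h /=; congr (_ *: (f (_, _) - _)).
  by rewrite /= /GRing.scale /= mulr0 add0r.
by apply: DeriveDef; [rewrite /derivable E|rewrite /derive E].
Qed.

Lemma derive_slice1 f (p : plane) (d : R) :
  is_derive p (e1 R) f d -> is_derive p.1 1 (fun x => f (x, p.2)) d.
Proof.
case: p => x y /= [df <-].
have E : (fun h : R => h^-1 *: (((fun x => f (x, y)) \o shift x) (h *: 1) - f (x, y)))
    = (fun h : R => h^-1 *: ((f \o shift (x, y)) (h *: e1 R) - f (x, y))).
  apply/funext => h /=; congr (_ *: (f (_, _) - _)).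
  by rewrite /= /GRing.scale /= mulr0 add0r.
by apply: DeriveDef; [rewrite /derivable E|rewrite /derive E].
Qed.

Lemma pair_cont1 (y : R) : continuous (fun x : R => (x, y) : plane).
Proof.
move=> x; apply: (@cvg_pair _ _ _ (nbhs x) (nbhs x) (nbhs y)).
  exact: cvg_id.
exact: cvg_cst.
Qed.

Lemma pair_cont2 (x : R) : continuous (fun y : R => (x, y) : plane).
Proof.
move=> y; apply: (@cvg_pair _ _ _ (nbhs y) (nbhs x) (nbhs y)).
  exact: cvg_cst.
exact: cvg_id.
Qed.

Definition cvx Om := forall p q t, Om p -> Om q -> 0 <= t <= 1 ->
  Om (t * p.1 + (1 - t) * q.1, t * p.2 + (1 - t) * q.2).

Lemma closure_preim (h : R -> plane) (A : set plane) y : continuous h ->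
  closure (h @^-1` A) y -> closure A (h y).
Proof.
move=> ch cA B /ch; rewrite /= => hB.
by have [z [Az Bz]] := cA _ hB; exists (h z).
Qed.

Lemma real_between (x y z : R) : x <= z <= y -> exists2 t, 0 <= t <= 1 &
  z = t * x + (1 - t) * y.
Proof.
move=> /andP[xz zy]; have [xy|xy] := eqVneq x y.
  exists 1; first by rewrite ler01 lexx.
  by rewrite subrr mul0r addr0 mul1r; apply/eqP; rewrite eq_le {1}xy zy xz.
have yx : 0 < y - x by rewrite subr_gt0 lt_neqAle xy (le_trans xz zy).
exists ((y - z) / (y - x)); last by field; exact: lt0r_neq0.
rewrite ler_pdivrMr// mul1r divr_ge0 ?(ltW yx) ?subr_ge0//=.
by rewrite lerB.
Qed.

Lemma iterated_bound (G : R -> \bar R) (c d b : R) :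
  measurable_fun setT G -> 0 <= b -> c <= d ->
  (forall x, (`|G x| <= (2 * b)%:E)%E) -> (forall x, ~~ (c <= x <= d) -> G x = 0%E) ->
  (`|\int[@lebesgue_measure R]_x G x| <= (2 * b * (d - c))%:E)%E.
Proof.
move=> mG b0 cd Gb G0.
have -> : (\int[@lebesgue_measure R]_x G x
    = \int[@lebesgue_measure R]_(x in `[c, d]) G x)%E.
  rewrite [RHS]integral_mkcond; apply: eq_integral => x _.
  rewrite patchE; case: ifPn => // xcd; apply: G0; apply: contra xcd => xcd.
  by rewrite inE /= in_itv.
have mG' : measurable_fun `[c, d]%classic G by exact: measurable_funTS.
have H1 := le_abse_integral (@lebesgue_measure R) (measurable_itv `[c, d]) mG'.
apply: (le_trans H1).
have b2 : (0 <= (2 * b)%:E)%E by rewrite lee_fin mulr_ge0.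
have H2 := @integral_le_bound _ _ _ (@lebesgue_measure R) _ G (2 * b)%:E
  (measurable_itv `[c, d]) mG' b2.
apply: (le_trans (H2 _)); first by apply: aeW => x _; exact: Gb.
have E : @lebesgue_measure R `[c, d]%classic = (d - c)%:E.
  rewrite lebesgue_measure_itv /= lte_fin; case: ltgtP cd => // -> _.
  by rewrite subrr.
suff : ((2 * b)%:E * @lebesgue_measure R `[c, d]%classic
  <= (2 * b * (d - c))%:E)%E by [].
by rewrite E -EFinM.
Qed.

(** A divergence theorem without boundary regularity: each vertical slice of a convex open set is an
    open interval whose end points are boundary points of [Om], and the slices are parametrised by
    [c, d]. *)
Lemma integral_D2_bound Om F (b c d M : R) :
  open Om -> boxed M Om -> cvx Om -> Ck 1 F ->
  (forall p, Om p -> c <= p.1 <= d) -> c <= d -> 0 <= b ->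
  (forall p, closure Om p -> ~ Om p -> `|F p| <= b) ->
  `|\int[leb2 R]_(p in Om) 'D_(e2 R) F p| <= 2 * b * (d - c).
Proof.
move=> oO bM cO CF Hcd cd b0 Hb.
have bO : bdomain Om by split=> //; exists M.
have cF' := Ck_continuous (Ck_D (axes2) CF).
have iF := continuous_integrable bO cF'.
rewrite -lee_fin EFin_normr_Rintegral//; last exact: bdomain_measurable.
set f := fun p => 'D_(e2 R) F p.
have iG : (leb2 R).-integrable setT ((EFin \o f) \_ Om).
  exact/(integrable_mkcond _ (bdomain_measurable bO)).
rewrite integral_mkcond -(integral12_prod_meas1 iG).
apply: iterated_bound => //.
- exact: (measurable_fubini_F iG).
- move=> x; rewrite /fubini_F.
  have -> : (\int[@lebesgue_measure R]_y ((EFin \o f) \_ Om) (x, y)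
     = \int[@lebesgue_measure R]_(y in (fun y => (x, y)) @^-1` Om) (f (x, y))%:E)%E.
    rewrite [RHS]integral_mkcond; apply: eq_integral => y _.
    by rewrite !patchE; congr (if _ then _ else _); apply/idP/idP; rewrite !inE.
  apply: (@slice_bound _ (fun y => F (x, y))).
  + by move/continuousP: (@pair_cont2 x) => /(_ _ oO).
  + move=> y1 y2 /= O1 O2 z zy; have [t t01 ->] := real_between zy.
    have := cO _ _ _ O1 O2 t01; rewrite /=.
    by congr (Om (_, _)); ring.
  + by exists (- M) => y /bM[_]; rewrite ler_norml => /andP[].
  + by exists M => y /bM[_]; rewrite ler_norml => /andP[].
  + move=> y; apply: (@derive_slice2 F (x, y)).
    exact: Ck_is_derive axes2 CF.
  + move=> y; apply: continuous_comp; [exact: pair_cont2|exact: cF'].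
  + exact: b0.
  + move=> y cy ny; apply: Hb => //.
    by apply: (closure_preim (@pair_cont2 x)) cy.
- move=> x nx; rewrite /fubini_F; apply: integral0_eq => y _.
  by rewrite patchE; case: ifPn => //; rewrite inE => /Hcd /= h; rewrite h in nx.
Qed.

Lemma integral_D1_bound Om F (b c d M : R) :
  open Om -> boxed M Om -> cvx Om -> Ck 1 F ->
  (forall p, Om p -> c <= p.2 <= d) -> c <= d -> 0 <= b ->
  (forall p, closure Om p -> ~ Om p -> `|F p| <= b) ->
  `|\int[leb2 R]_(p in Om) 'D_(e1 R) F p| <= 2 * b * (d - c).
Proof.
move=> oO bM cO CF Hcd cd b0 Hb.
have bO : bdomain Om by split=> //; exists M.
have cF' := Ck_continuous (Ck_D (axes1) CF).
have iF := continuous_integrable bO cF'.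
rewrite -lee_fin EFin_normr_Rintegral//; last exact: bdomain_measurable.
set f := fun p => 'D_(e1 R) F p.
have iG : (leb2 R).-integrable setT ((EFin \o f) \_ Om).
  exact/(integrable_mkcond _ (bdomain_measurable bO)).
rewrite integral_mkcond -(integral21_prod_meas1 iG).
apply: iterated_bound => //.
- exact: (measurable_fubini_G iG).
- move=> y; rewrite /fubini_G.
  have -> : (\int[@lebesgue_measure R]_x ((EFin \o f) \_ Om) (x, y)
     = \int[@lebesgue_measure R]_(x in (fun x => (x, y)) @^-1` Om) (f (x, y))%:E)%E.
    rewrite [RHS]integral_mkcond; apply: eq_integral => x _.
    by rewrite !patchE; congr (if _ then _ else _); apply/idP/idP; rewrite !inE.
  apply: (@slice_bound _ (fun x => F (x, y))).
  + by move/continuousP: (@pair_cont1 y) => /(_ _ oO).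
  + move=> y1 y2 /= O1 O2 z zy; have [t t01 ->] := real_between zy.
    have := cO _ _ _ O1 O2 t01; rewrite /=.
    by congr (Om (_, _)); ring.
  + by exists (- M) => x /bM[+ _]; rewrite ler_norml => /andP[].
  + by exists M => x /bM[+ _]; rewrite ler_norml => /andP[].
  + move=> x; apply: (@derive_slice1 F (x, y)).
    exact: Ck_is_derive axes1 CF.
  + move=> x; apply: continuous_comp; [exact: pair_cont1|exact: cF'].
  + exact: b0.
  + move=> x cx nx; apply: Hb => //.
    by apply: (closure_preim (@pair_cont1 y)) cx.
- move=> y ny; rewrite /fubini_G; apply: integral0_eq => x _.
  by rewrite patchE; case: ifPn => //; rewrite inE => /Hcd /= h; rewrite h in ny.
Qed.

End PlaneMeasure.

(** * Integrals of continuous and of square integrable functions *)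

Section IntegralCalculus.
Context {R : realType}.
Local Notation plane := (R * R)%type.
Local Notation mplane := (measurableTypeR R * measurableTypeR R)%type.
Local Notation "'int_' Om f" := (\int[leb2 R]_(p in Om) f p)
  (at level 10, Om at level 8, f at level 8).
Implicit Types (Om : set plane) (f g F u psi phi : plane -> R).

Lemma eq_int Om f g : (forall p, Om p -> f p = g p) -> int_ Om f = int_ Om g.
Proof. by move=> fg; apply: eq_Rintegral => p; rewrite inE; exact: fg. Qed.

Lemma intD Om f g : bdomain Om -> continuous f -> continuous g ->
  int_ Om (fun p => f p + g p) = int_ Om f + int_ Om g.
Proof.
move=> bO cf cg; apply: RintegralD; first exact: bdomain_measurable.
  exact: continuous_integrable.
exact: continuous_integrable.
Qed.

Lemma intB Om f g : bdomain Om -> continuous f -> continuous g ->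
  int_ Om (fun p => f p - g p) = int_ Om f - int_ Om g.
Proof.
move=> bO cf cg; apply: RintegralB; first exact: bdomain_measurable.
  exact: continuous_integrable.
exact: continuous_integrable.
Qed.

Lemma intZ Om f (c : R) : bdomain Om -> continuous f ->
  int_ Om (fun p => c * f p) = c * int_ Om f.
Proof.
move=> bO cf; apply: RintegralZl; first exact: bdomain_measurable.
exact: continuous_integrable.
Qed.

Lemma int_le Om f g : bdomain Om -> continuous f -> continuous g ->
  (forall p, Om p -> f p <= g p) -> int_ Om f <= int_ Om g.
Proof.
move=> bO cf cg fg; apply: le_Rintegral => //; first exact: bdomain_measurable.
  exact: continuous_integrable.
exact: continuous_integrable.
Qed.

Lemma int_ge0 Om f : (forall p, Om p -> 0 <= f p) -> 0 <= int_ Om f.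
Proof. by move=> H; apply: (@Rintegral_ge0 _ _ _ (leb2 R) Om f). Qed.

Lemma int_cst Om (c : R) : bdomain Om -> int_ Om (fun=> c) = c * area Om.
Proof.
move=> bO; rewrite -intZ//; last exact: cst_continuous.
by apply: eq_int => p _; rewrite mulr1.
Qed.

Lemma area_ge0 Om : 0 <= area Om.
Proof. exact: int_ge0. Qed.

Lemma int_sub_eq Om Om' f : Om' `<=` Om ->
  (forall p, Om p -> ~ Om' p -> f p = 0) -> int_ Om f = int_ Om' f.
Proof.
move=> S f0; rewrite Rintegral_mkcond [RHS]Rintegral_mkcond.
apply: eq_Rintegral => p _; rewrite !patchE.
case: ifPn => pO; case: ifPn => pO' //.
  by apply: f0; [move: pO; rewrite inE|move: pO'; rewrite notin_setE].
by move: pO; rewrite notin_setE => -[]; apply: S; move: pO'; rewrite inE.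
Qed.

Lemma int_sub_le Om Om' f : bdomain Om -> bdomain Om' -> Om' `<=` Om ->
  continuous f -> (forall p, Om p -> 0 <= f p) -> int_ Om' f <= int_ Om f.
Proof.
move=> bO bO' S cf f0.
have mO := bdomain_measurable bO; have mO' := bdomain_measurable bO'.
apply: fine_le.
- exact: integrable_fin_num (continuous_integrable bO' cf).
- exact: integrable_fin_num (continuous_integrable bO cf).
- apply: ge0_subset_integral => //.
  by apply/measurable_EFinP/measurable_funTS; exact: continuous_measurable_plane.
Qed.

Lemma area_sub Om Om' : bdomain Om -> bdomain Om' -> Om' `<=` Om ->
  area Om' <= area Om.
Proof. by move=> bO bO' S; apply: int_sub_le => //; exact: cst_continuous. Qed.

Definition box (x y r : R) : set plane :=
  [set p | x - r < p.1 < x + r /\ y - r < p.2 < y + r].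

Lemma box_open x y r : open (box x y r).
Proof.
have -> : box x y r = (fst @^-1` `]x - r, x + r[%classic)
    `&` (snd @^-1` `]y - r, y + r[%classic).
  by apply/seteqP; split=> p /=; rewrite /box /= !in_itv.
apply: openI.
  by move/continuousP: (@fst_cont R) => /(_ _ (@interval_open R (BRight _) (BLeft _) _ _)); exact.
by move/continuousP: (@snd_cont R) => /(_ _ (@interval_open R (BRight _) (BLeft _) _ _)); exact.
Qed.

Lemma box_boxed x y r : boxed (`|x| + `|y| + `|r|) (box x y r).
Proof.
move=> p [h1 h2].
have := ler_norm x; have := ler_norm (- x); have := ler_norm y; have := ler_norm (- y).
have := ler_norm r; have := ler_norm (- r); rewrite !normrN => *.
by split; rewrite ler_norml; lra.
Qed.

Lemma box_bdomain x y r : bdomain (box x y r).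
Proof. by split; [exact: box_open|eexists; exact: box_boxed]. Qed.

Lemma box_cvx x y r : cvx (box x y r).
Proof.
move=> p q t [/andP[p1 p2] /andP[p3 p4]] [/andP[q1 q2] /andP[q3 q4]] /andP[t0 t1].
have conv (a b c : R) : c < a -> c < b -> c < t * a + (1 - t) * b.
  move=> ca cb; have [t2|t2] := ltP 0 t.
    have : t * c < t * a by rewrite ltr_pM2l.
    have : (1 - t) * c <= (1 - t) * b by apply: ler_wpM2l; [lra|exact: ltW].
    lra.
  have -> : t = 0 by lra.
  by rewrite mul0r add0r subr0 mul1r.
have convN (a b c : R) : a < c -> b < c -> t * a + (1 - t) * b < c.
  rewrite -(ltrN2 c a) -(ltrN2 c b) => h1 h2.
  by have := conv _ _ _ h1 h2; rewrite !mulrN -opprD ltrN2.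
by split=> /=; rewrite conv//= convN.
Qed.

Lemma box_area x y r : 0 < r -> area (box x y r) = 4 * r ^+ 2.
Proof.
move=> r0; rewrite /area Rintegral_cst; last exact: bdomain_measurable (box_bdomain _ _ _).
rewrite mul1r.
have -> : box x y r = `]x - r, x + r[%classic `*` `]y - r, y + r[%classic.
  by apply/seteqP; split=> p /=; rewrite /box /= !in_itv.
have -> : leb2 R (`]x - r, x + r[%classic `*` `]y - r, y + r[%classic)
   = (@lebesgue_measure R `](x - r)%R, (x + r)%R[%classic
    * @lebesgue_measure R `](y - r)%R, (y + r)%R[%classic)%E.
  exact: product_measure1E.
rewrite !lebesgue_measure_itv /= !lte_fin !ifT; [|lra..].
by rewrite -!EFinB -EFinM /=; ring.
Qed.

(** Slices of [Om] can be complicated, but F vanishes off [Om], so the integral may be taken over a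
    larger box. The box is convex and F is 0 on its boundary, so the slice estimate holds with bound
    0. *)
Lemma int_D_eq0 Om F v : axes v -> bdomain Om -> Ck 1 F ->
  compactly_supported Om F -> int_ Om (fun p => 'D_v F p) = 0.
Proof.
move=> av bO CF cF; have [oO [M bM]] := bO.
set N := `|M| + 1.
have MN : M < N by rewrite /N; have := ler_norm M; lra.
have N0 : 0 < N by rewrite /N ltr_wpDl.
have OB : Om `<=` box 0 0 N.
  move=> p /bM[]; rewrite !ler_norml => h1 h2; split; lra.
have F0 p : ~ Om p -> F p = 0 /\ 'D_v F p = 0.
  by move=> nO; apply: D_outside_support => /cF.2.
rewrite -(@int_sub_eq (box 0 0 N))//; last by move=> p _ /F0[].
have Hb p : closure (box 0 0 N) p -> ~ box 0 0 N p -> `|F p| <= 0.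
  by move=> _ nB; rewrite (F0 p _).1 ?normr0//; move=> /OB.
have le0 (x : R) : `|x| <= 2 * 0 * (N - - N) -> x = 0.
  by rewrite mulr0 mul0r normr_le0 => /eqP.
have NN : - N <= N by lra.
have Hbd i (p : plane) : box 0 0 N p -> - N <= (if i then p.1 else p.2) <= N.
  by move=> [h1 h2]; case: i; lra.
apply: le0; case: av => ->.
- apply: (@integral_D1_bound _ _ _ _ _ _ _ (@box_open 0 0 N) (@box_boxed 0 0 N)
    (@box_cvx 0 0 N)) => //; exact: (Hbd false).
- apply: (@integral_D2_bound _ _ _ _ _ _ _ (@box_open 0 0 N) (@box_boxed 0 0 N)
    (@box_cvx 0 0 N)) => //; exact: (Hbd true).
Qed.

(** The discriminant of a nonnegative quadratic in c. It recovers Cauchy-Schwarz, and later the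
    scale invariant torsion inequality, from linearised forms. *)
Lemma quad_disc (x y z : R) : 0 <= z ->
  (forall c : R, 2 * c * y <= x + c ^+ 2 * z) -> y ^+ 2 <= x * z.
Proof.
move=> z0 H; have [z1|z1] := ltP 0 z.
  have := H (y / z); rewrite -(ler_pM2r z1) => H1.
  have : 2 * (y / z) * y * z = 2 * y ^+ 2 by field; exact: lt0r_neq0.
  have : (x + (y / z) ^+ 2 * z) * z = x * z + y ^+ 2 by field; exact: lt0r_neq0.
  by move: H1 => /[swap] -> /[swap] ->; lra.
have z2 : z = 0 by lra.
move: H; rewrite {}z2 => H; have [->|y0] := eqVneq y 0; first by rewrite expr0n /= !mulr0.
(* With z = 0 the hypothesis reads 2 c y <= x for all c; this c would give x + 1 <= x. *)
have := H ((x + 1) / (2 * y)); rewrite mulr0 addr0.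
have -> : 2 * ((x + 1) / (2 * y)) * y = x + 1 by field.
by lra.
Qed.

Lemma axes_weak_partial Om v psi phi : axes v -> bdomain Om ->
  test_function Om psi -> Ck 1 phi ->
  int_ Om (fun p => phi p * 'D_v psi p) = - int_ Om (fun p => 'D_v phi p * psi p).
Proof.
move=> av bO [Cp sp] Cphi.
have C1 := Cp 1%N; have c1 := Ck_continuous (Ck_D av C1).
have c2 := Ck_continuous (Ck_D av Cphi).
have cp := Ck_continuous C1; have cphi := Ck_continuous Cphi.
have sF : compactly_supported Om (fun p => phi p * psi p).
  by apply: compactly_supported_sub sp _ => p ->; rewrite mulr0.
have := int_D_eq0 av bO (CkM Cphi C1) sF.
rewrite (@eq_int _ _ (fun p => phi p * 'D_v psi p + 'D_v phi p * psi p)); last first.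
  move=> p _; have [_ ->] := is_deriveMr_ (Ck_is_derive p av Cphi) (Ck_is_derive p av C1).
  by rewrite [psi p * _]mulrC.
rewrite intD//.
- by move=> /eqP; rewrite addr_eq0 => /eqP.
- by move=> p; apply: cvgM; [exact: cphi|exact: c1].
- by move=> p; apply: cvgM; [exact: c2|exact: cp].
Qed.

Lemma continuous_L2 Om f : bdomain Om -> continuous f -> L2 Om f.
Proof.
move=> bO cf; split.
  by apply: measurable_funTS; exact: continuous_measurable_plane.
apply: (@continuous_integrable _ _ (fun p => f p ^+ 2)) => //.
by move=> p; apply: cvgM; exact: cf.
Qed.

Definition Rint Om f := (leb2 R).-integrable Om (EFin \o f).

Lemma RintD Om f g : bdomain Om -> Rint Om f -> Rint Om g ->
  Rint Om (fun p => f p + g p).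
Proof.
move=> bO If Ig; have mO := bdomain_measurable bO.
by have := integrableD mO If Ig; apply: eq_integrable.
Qed.

Lemma RintZ Om f (c : R) : bdomain Om -> Rint Om f -> Rint Om (fun p => c * f p).
Proof.
move=> bO If; have mO := bdomain_measurable bO.
by have := integrableZl mO c If; apply: eq_integrable.
Qed.

Lemma L2_integrableM Om (f g : plane -> R) : bdomain Om -> L2 Om f -> L2 Om g ->
  (leb2 R).-integrable Om (fun p => (f p * g p)%:E).
Proof.
move=> bO [mf If] [mg Ig].
apply: (@le_integrable _ _ _ (leb2 R) _ _ (fun p => (f p * g p)%:E) (EFin \o (fun p => f p ^+ 2 + g p ^+ 2))).
- exact: bdomain_measurable.
- by apply/measurable_EFinP; exact: measurable_funM.
- move=> p _; rewrite !abse_EFin lee_fin /=.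
  rewrite [X in _ <= X]ger0_norm ?addr_ge0 ?sqr_ge0// ler_norml.
  have := sqr_ge0 (f p + g p); have := sqr_ge0 (f p - g p).
  have := sqr_ge0 (f p); have := sqr_ge0 (g p); rewrite sqrrB sqrrD; lra.
- exact: RintD.
Qed.

Lemma L2B Om (f g : plane -> R) : bdomain Om -> L2 Om f -> L2 Om g ->
  L2 Om (fun p => f p - g p).
Proof.
move=> bO Lf Lg; have [mf If] := Lf; have [mg Ig] := Lg; split.
  exact: measurable_funB.
have mO := bdomain_measurable bO.
have := RintD bO (RintD bO If (RintZ (- 2) bO (L2_integrableM bO Lf Lg))) Ig.
by apply: eq_integrable => // p _ /=; congr EFin; ring.
Qed.

Lemma L2_integrable Om (f : plane -> R) : bdomain Om -> L2 Om f ->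
  (leb2 R).-integrable Om (EFin \o f).
Proof.
move=> bO Lf.
have L1 := @continuous_L2 Om (fun=> 1) bO (@cst_continuous _ _ _).
have := L2_integrableM bO Lf L1.
by apply: eq_integrable; [exact: bdomain_measurable|move=> p _ /=; rewrite mulr1].
Qed.

(** The main term keeps a factor close to 1; the large factor [eta^-1] falls on the approximation
    error, which can be made small after [eta] is fixed. *)
Lemma L2_young Om (f g : plane -> R) (eta : R) : bdomain Om -> L2 Om f -> L2 Om g ->
  0 < eta ->
  int_ Om (fun p => f p ^+ 2) <= (1 + eta) * int_ Om (fun p => g p ^+ 2)
    + (1 + eta^-1) * int_ Om (fun p => (f p - g p) ^+ 2).
Proof.
move=> bO Lf Lg e0; have mO := bdomain_measurable bO.
have [_ If] := Lf; have [_ Ig] := Lg; have [_ Ifg] := L2B bO Lf Lg.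
have I1 := RintZ (1 + eta) bO Ig.
have I2 := RintZ (1 + eta^-1) bO Ifg.
rewrite -!RintegralZl// -RintegralD//.
apply: le_Rintegral => //; first exact: (RintD bO I1 I2).
move=> p _; set a := f p; set b := g p.
have -> : a ^+ 2 = (b + (a - b)) ^+ 2 by congr (_ ^+ 2); ring.
set c := a - b; set k := eta^-1.
have k0 : 0 < k by rewrite invr_gt0.
have ek : eta * k = 1 by rewrite divff ?lt0r_neq0.
have : 0 <= k * (eta * b - c) ^+ 2 by rewrite mulr_ge0 ?sqr_ge0 ?ltW.
have -> : k * (eta * b - c) ^+ 2 = (eta * k) * (eta * b ^+ 2 - 2 * b * c) + k * c ^+ 2 by ring.
by rewrite ek mul1r; lra.
Qed.

Lemma cauchy_schwarz1 Om (f : plane -> R) : bdomain Om -> L2 Om f ->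
  (int_ Om f) ^+ 2 <= int_ Om (fun p => f p ^+ 2) * area Om.
Proof.
move=> bO Lf; apply: quad_disc; first exact: area_ge0.
move=> c; have mO := bdomain_measurable bO.
have [_ If2] := Lf; have If := L2_integrable bO Lf.
have Ic := continuous_integrable bO (@cst_continuous _ _ (c ^+ 2)).
rewrite -(@int_cst Om) // -RintegralZl// -RintegralD//.
apply: le_Rintegral => //; first exact: (RintZ (2 * c) bO If).
  exact: (RintD bO If2 Ic).
by move=> p _; have := sqr_ge0 (f p - c); rewrite sqrrB; lra.
Qed.

End IntegralCalculus.

(** * Torsion and first eigenvalue by test functions *)

Section Spectral.
Context {R : realType}.
Local Notation plane := (R * R)%type.
Local Notation mplane := (measurableTypeR R * measurableTypeR R)%type.
Local Notation "'int_' Om f" := (\int[leb2 R]_(p in Om) f p)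
  (at level 10, Om at level 8, f at level 8).
Implicit Types (Om : set plane) (f g F u psi phi : plane -> R).

Definition dir Om psi : R :=
  dirichlet Om (fun p => 'D_(e1 R) psi p) (fun p => 'D_(e2 R) psi p).

Lemma test_continuous Om psi : test_function Om psi -> continuous psi.
Proof. by move=> [Cp _]; exact: Ck_continuous (Cp 0%N). Qed.

Lemma test_D_continuous Om psi v : axes v -> test_function Om psi ->
  continuous (fun p => 'D_v psi p).
Proof. by move=> av [Cp _]; exact: Ck_continuous (Ck_D av (Cp 1%N)). Qed.

Lemma H10_test Om psi : bdomain Om -> test_function Om psi ->
  H10 Om psi (fun p => 'D_(e1 R) psi p) (fun p => 'D_(e2 R) psi p).
Proof.
move=> bO tp; split; first split.
- exact: continuous_L2 bO (test_continuous tp).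
- exact: continuous_L2 bO (test_D_continuous (@axes1 R) tp).
- exact: continuous_L2 bO (test_D_continuous (@axes2 R) tp).
- by move=> phi tphi; apply: axes_weak_partial => //; [exact: axes1|exact: tp.1].
- by move=> phi tphi; apply: axes_weak_partial => //; [exact: axes2|exact: tp.1].
move=> eps e0; exists psi => //.
have Z f : (fun p => (f p - f p) ^+ 2) = (fun=> 0) :> (plane -> R).
  by apply/funext => p; rewrite subrr expr0n.
have I0 : int_ Om (fun=> 0) = 0 by rewrite int_cst// mul0r.
by rewrite !Z I0 !addr0.
Qed.

Lemma dirichlet_split Om (g1 g2 : plane -> R) : bdomain Om -> L2 Om g1 -> L2 Om g2 ->
  dirichlet Om g1 g2 = int_ Om (fun p => g1 p ^+ 2) + int_ Om (fun p => g2 p ^+ 2).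
Proof.
move=> bO [_ I1] [_ I2]; rewrite /dirichlet RintegralD//.
exact: bdomain_measurable.
Qed.

Lemma dirichlet_ge0 Om (g1 g2 : plane -> R) : 0 <= dirichlet Om g1 g2.
Proof. by apply: int_ge0 => p _; rewrite addr_ge0 ?sqr_ge0. Qed.

Lemma H10_approx Om u (g1 g2 : plane -> R) (e : R) : bdomain Om -> H10 Om u g1 g2 -> 0 < e ->
  exists2 psi, test_function Om psi &
    int_ Om (fun p => (u p - psi p) ^+ 2) <= e /\
    forall eta, 0 < eta ->
      dir Om psi <= (1 + eta) * dirichlet Om g1 g2 + (1 + eta^-1) * e.
Proof.
move=> bO [[Lu L1 L2' _ _] H] e0; have [psi tp Hp] := H e e0.
have sym f g : int_ Om (fun p => (f p - g p) ^+ 2) = int_ Om (fun p => (g p - f p) ^+ 2).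
  by apply: eq_int => p _; rewrite -sqrrN opprB.
have P0 f g : 0 <= int_ Om (fun p => (f p - g p) ^+ 2).
  by apply: int_ge0 => p _; exact: sqr_ge0.
have := P0 psi u; have := P0 (fun p => 'D_(e1 R) psi p) g1.
have := P0 (fun p => 'D_(e2 R) psi p) g2 => a2 a1 a0.
have h12 (x y z : R) : 0 <= y -> 0 <= z -> x + y + z < e -> x <= e by lra.
have h3 (x y z : R) : 0 <= x -> x + y + z < e -> y + z <= e by lra.
exists psi => //; split; first by rewrite sym (h12 _ _ _ a1 a2 Hp).
move=> eta eta0; rewrite /dir !dirichlet_split//; last 2 first.
- exact: continuous_L2 bO (test_D_continuous (@axes1 R) tp).
- exact: continuous_L2 bO (test_D_continuous (@axes2 R) tp).
have Y1 := L2_young bO (continuous_L2 bO (test_D_continuous (@axes1 R) tp)) L1 eta0.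
have Y2 := L2_young bO (continuous_L2 bO (test_D_continuous (@axes2 R) tp)) L2' eta0.
apply: le_trans (lerD Y1 Y2) _.
rewrite addrACA -mulrDr -mulrDr lerD2l ler_wpM2l//.
  by rewrite addr_ge0// invr_ge0 ltW.
exact: h3 a0 Hp.
Qed.

(** First e tends to 0 with [eta] fixed, then [eta] tends to 0; the factor [eta^-1] forces this
    order. *)
Lemma young_limit (x y c : R) : 0 <= y ->
  (forall eta e, 0 < eta -> eta <= 1 -> 0 < e ->
     x <= (1 + eta) ^+ 2 * y + c * (1 + eta^-1) * e) -> x <= y.
Proof.
move=> y0 H.
have H1 eta : 0 < eta -> eta <= 1 -> x <= (1 + eta) ^+ 2 * y.
  move=> h0 h1; apply/ler_addgt0Pr => d d0.
  set k := `|c * (1 + eta^-1)| + 1.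
  have k0 : 0 < k by rewrite ltr_wpDl.
  have := H eta (d / k) h0 h1 (divr_gt0 d0 k0); move/le_trans; apply.
  rewrite lerD2l mulrA ler_pdivrMr// mulrC; apply: ler_wpM2l; first exact: ltW.
  by apply: le_trans (ler_norm _) _; rewrite lerDl.
apply/ler_addgt0Pr => d d0.
(* For eta <= 1 one has (1 + eta)^2 <= 1 + 3 eta, and 3 eta y <= d with this choice. *)
set eta := d / (3 * y + d).
have s0 : 0 < 3 * y + d by lra.
have h0 : 0 < eta by rewrite divr_gt0.
have h1 : eta <= 1 by rewrite ler_pdivrMr// mul1r; lra.
apply: le_trans (H1 _ h0 h1) _.
have h2 : eta * (3 * y + d) = d by rewrite divfK// lt0r_neq0.
have : eta * eta <= eta by rewrite ger_pMr.
have : 0 <= eta * d by rewrite mulr_ge0 ?ltW.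
nra.
Qed.

Lemma torsion_density Om (K : R) : bdomain Om -> 0 <= K ->
  (forall psi, test_function Om psi -> (int_ Om psi) ^+ 2 <= K * dir Om psi) ->
  forall u g1 g2, H10 Om u g1 g2 -> (int_ Om u) ^+ 2 <= K * dirichlet Om g1 g2.
Proof.
move=> bO K0 HK u g1 g2 Hu.
have A0 : 0 <= area Om by exact: area_ge0.
(* Young's inequality is used twice, on the integral and on the energy. The error of the second use
   carries (1 + eta) K <= 2 K; [area Om] comes from Cauchy-Schwarz. *)
apply: (@young_limit _ _ (2 * K + area Om)).
  by rewrite mulr_ge0// dirichlet_ge0.
move=> eta e h0 h1 e0; have [psi tp [Hpsi Hd]] := H10_approx bO Hu e0.
have Lu : L2 Om u by case: Hu => -[].
have Lp := continuous_L2 bO (test_continuous tp).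
have E : int_ Om u = int_ Om psi + int_ Om (fun p => u p - psi p).
  rewrite RintegralB; [by rewrite addrC subrK|exact: bdomain_measurable|..].
    exact: L2_integrable.
  exact: L2_integrable.
set a := int_ Om psi in E *; set b := int_ Om (fun p => u p - psi p) in E *.
have ab : (a + b) ^+ 2 <= (1 + eta) * a ^+ 2 + (1 + eta^-1) * b ^+ 2.
  have : 0 <= eta^-1 * (eta * a - b) ^+ 2 by rewrite mulr_ge0 ?sqr_ge0// invr_ge0 ltW.
  have -> : eta^-1 * (eta * a - b) ^+ 2 = eta * a ^+ 2 - 2 * a * b + eta^-1 * b ^+ 2.
    by field; exact: lt0r_neq0.
  lra.
have i0 : 0 < eta^-1 by rewrite invr_gt0.
have b2 : b ^+ 2 <= e * area Om.
  apply: le_trans (cauchy_schwarz1 bO (L2B bO Lu Lp)) _.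
  exact: ler_wpM2r.
have a2 : a ^+ 2 <= K * ((1 + eta) * dirichlet Om g1 g2 + (1 + eta^-1) * e).
  by apply: le_trans (HK _ tp) _; rewrite ler_wpM2l// Hd.
rewrite E; apply: le_trans ab _.
have D0 := dirichlet_ge0 Om g1 g2.
set D := dirichlet _ _ _ in D0 a2 *; set i := eta^-1 in i0 a2 *.
have h3 : (1 + eta) * a ^+ 2 <= (1 + eta) * (K * ((1 + eta) * D + (1 + i) * e)).
  by rewrite ler_wpM2l//; lra.
have h4 : (1 + i) * b ^+ 2 <= (1 + i) * (e * area Om).
  by rewrite ler_wpM2l//; lra.
apply: le_trans (lerD h3 h4) _.
have h5 : 0 <= (1 - eta) * (K * ((1 + i) * e)).
  by rewrite !mulr_ge0//; lra.
by move: h5; lra.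
Qed.

Lemma eigenvalue_density Om (a : R) : bdomain Om -> 0 <= a ->
  (forall psi, test_function Om psi -> a * int_ Om (fun p => psi p ^+ 2) <= dir Om psi) ->
  forall u g1 g2, H10 Om u g1 g2 ->
    a * int_ Om (fun p => u p ^+ 2) <= dirichlet Om g1 g2.
Proof.
move=> bO a0 Ha u g1 g2 Hu.
apply: (@young_limit _ _ (2 + a)); first exact: dirichlet_ge0.
move=> eta e h0 h1 e0; have [psi tp [Hpsi Hd]] := H10_approx bO Hu e0.
have Lu : L2 Om u by case: Hu => -[].
have Lp := continuous_L2 bO (test_continuous tp).
have Y := L2_young bO Lu Lp h0.
have Hap := Ha _ tp; have {}Hd := Hd _ h0.
have i0 : 0 < eta^-1 by rewrite invr_gt0.
have D0 := dirichlet_ge0 Om g1 g2.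
set D := dirichlet _ _ _ in Hd D0 *; set i := eta^-1 in i0 Y Hd *.
set U := (X in a * X <= _); set P := (X in a * X <= _) in Hap.
set E := (X in X <= _) in Hpsi; rewrite -/U -/P -/E in Y.
have h2 : a * U <= a * ((1 + eta) * P + (1 + i) * E) by rewrite ler_wpM2l.
have h3 : (1 + eta) * (a * P) <= (1 + eta) * ((1 + eta) * D + (1 + i) * e).
  by rewrite ler_wpM2l//; [lra|exact: le_trans Hap Hd].
have h4 : a * (1 + i) * E <= a * (1 + i) * e.
  by rewrite ler_wpM2l// mulr_ge0//; lra.
have h5 : 0 <= (1 - eta) * ((1 + i) * e).
  by rewrite !mulr_ge0//; lra.
by move: h2 h3 h4 h5; lra.
Qed.

(** * The barrier and the factorisation of test functions by it *)

Section Barrier.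
Variables (a b c d : R).
Hypothesis ab : a ^+ 2 + b ^+ 2 = 1.
Let l : plane -> R := aff a b c.

(* - Laplace barrier = 1, and barrier > 0 on the strip 0 < l < d. *)
Definition barrier (p : plane) : R := 2^-1 * (l p * (d - l p)).

Lemma Ck_barrier k : Ck k barrier.
Proof.
apply: CkZ; apply: CkM; first exact: Ck_aff.
by apply: CkB; [exact: Ck_cst|exact: Ck_aff].
Qed.

Lemma is_derive_barrier p v :
  is_derive p v barrier (2^-1 * (d - 2 * l p) * (a * v.1 + b * v.2)).
Proof.
have dl := is_derive_aff a b c p v.
have dm := is_deriveDr_ (is_derive_cst (d : R^o) p v) (is_deriveNr_ dl).
have := is_deriveMr_ (is_derive_cst (2^-1 : R^o) p v) (is_deriveMr_ dl dm).
by move=> H; apply: is_derive_eq H _; rewrite /= -/l /cst; ring.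
Qed.

Lemma is_derive_D_barrier p v w :
  is_derive p w (fun p => (a * v.1 + b * v.2) * (2^-1 * d - l p))
    (- (a * v.1 + b * v.2) * (a * w.1 + b * w.2)).
Proof.
have dl := is_derive_aff a b c p w.
have dm := is_deriveDr_ (is_derive_cst (2^-1 * d : R^o) p w) (is_deriveNr_ dl).
have := is_deriveMr_ (is_derive_cst (a * v.1 + b * v.2 : R^o) p w) dm.
by move=> H; apply: is_derive_eq H _; rewrite /= /cst; ring.
Qed.

Definition weighted_energy phi (p : plane) : R :=
  barrier p ^+ 2 * ('D_(e1 R) phi p ^+ 2 + 'D_(e2 R) phi p ^+ 2)
  + barrier p * phi p ^+ 2.

Lemma energy_continuous phi : (forall k, Ck k phi) -> continuous (weighted_energy phi).
Proof.
move=> Cphi; apply: (@Ck_continuous _ 0%N).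
have Cd v : axes v -> Ck 0%N (fun p => 'D_v phi p) by move=> av; apply: Ck_D.
have C0 := Ck_barrier 0%N.
have C1 := Cd _ (@axes1 R); have C2 := Cd _ (@axes2 R); have C3 := Cphi 0%N.
apply: CkD; apply: CkM; rewrite ?/(_ ^+ 2) //; try exact: CkM.
by apply: CkD; exact: CkM.
Qed.

(** Ground state substitution: |grad (v phi)|^2 = v^2 |grad phi|^2 + div (phi^2 v grad v) - phi^2 v
    Laplace v. The divergence has compact support and integrates to 0, and - Laplace v = 1. *)
Lemma dir_factor Om phi : bdomain Om -> test_function Om phi ->
  dir Om (fun p => barrier p * phi p) =
  int_ Om (weighted_energy phi).
Proof.
move=> bO tphi; have [Cphi sphi] := tphi.
(* [B v] is the derivative of [barrier] along [v], so that [H] gives the components of phi^2 barrier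
   grad barrier. *)
pose B v (p : plane) := (a * v.1 + b * v.2) * (2^-1 * d - l p).
have CB v k : Ck k (B v).
  by apply: CkZ; apply: CkB; [exact: Ck_cst|exact: Ck_aff].
pose H v p := phi p * phi p * (barrier p * B v p).
have CH v k : Ck k (H v).
  by apply: CkM; apply: CkM => //; exact: Ck_barrier.
have sH v : compactly_supported Om (H v).
  by apply: compactly_supported_sub sphi _ => p; rewrite /H => ->; rewrite !mul0r.
have dH v p : axes v -> 'D_v (H v) p = 2 * phi p * 'D_v phi p * (barrier p * B v p)
   + phi p ^+ 2 * (B v p ^+ 2 - (a * v.1 + b * v.2) ^+ 2 * barrier p).
  move=> av; have dphi := Ck_is_derive p av (Cphi 1%N).
  have db := is_derive_barrier p v.
  have dB := is_derive_D_barrier p v v.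
  have [_ ->] := is_deriveMr_ (is_deriveMr_ dphi dphi) (is_deriveMr_ db dB).
  by rewrite /B; field.
have dprod v p : axes v -> 'D_v (fun p => barrier p * phi p) p
    = barrier p * 'D_v phi p + phi p * B v p.
  move=> av; have dphi := Ck_is_derive p av (Cphi 1%N).
  have [_ ->] := is_deriveMr_ (is_derive_barrier p v) dphi.
  by rewrite /B; field.
have a1 := @axes1 R; have a2 := @axes2 R.
have I1 := int_D_eq0 a1 bO (CH _ 1%N) (sH (e1 R)).
have I2 := int_D_eq0 a2 bO (CH _ 1%N) (sH (e2 R)).
have cD v : axes v -> continuous (fun p => 'D_v (H v) p).
  by move=> av; exact: Ck_continuous (Ck_D av (CH _ 1%N)).
have cI := energy_continuous Cphi.
rewrite -[RHS]addr0 -I1 -[RHS]addr0 -I2.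
rewrite -intD//; [|exact: cD..].
rewrite -intD//; [|by move=> p; apply: cvgD; [exact: cI|exact: cD]|exact: cD].
apply: eq_int => p _; rewrite /weighted_energy !dprod// !dH//.
have -> : barrier p * phi p ^+ 2
   = (a ^+ 2 + b ^+ 2) * (barrier p * phi p ^+ 2) by rewrite ab mul1r.
by rewrite /=; ring.
Qed.

Lemma barrier_gt0 p : 0 < l p < d -> 0 < barrier p.
Proof. by move=> /andP[h1 h2]; rewrite !mulr_gt0// ?invr_gt0// subr_gt0. Qed.

Lemma barrier_le p : 0 < l p < d -> barrier p <= d * l p.
Proof. by move=> /andP[h1 h2]; rewrite /barrier; nra. Qed.

(** On the compact support of psi the barrier has a positive minimum [dl]. Dividing by [posid dl] of
    the barrier is division by the barrier there, and is smooth on the whole plane. *)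
Lemma test_factor Om psi : test_function Om psi ->
  (forall p, Om p -> 0 < l p < d) ->
  exists2 phi, test_function Om phi & psi = (fun p => barrier p * phi p).
Proof.
move=> tp Hl; have [Cp [cS sS]] := tp.
set S := closure _ in cS sS.
have [dl dl0 Hdl] : exists2 dl, 0 < dl & forall p, S p -> dl <= barrier p.
  have [->|/set0P S0] := eqVneq S set0; first by exists 1.
  have cb : {within S, continuous barrier}.
    by apply: continuous_subspaceT; exact: Ck_continuous (Ck_barrier 0%N).
  have [q Sq Hq] := compact_EVT_min S0 cS cb.
  exists (barrier q); first by apply: barrier_gt0; apply: Hl; apply: sS; rewrite -inE.
  by move=> p Sp; apply: Hq; rewrite inE.
exists (fun p => psi p * (posid dl (barrier p))^-1).
  apply: test_functionM => // k.
  apply: (@Ck_comp _ k (fun t => (posid dl t)^-1)); last exact: Ck_barrier.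
  apply: (@CnV R R [set 1] k (posid dl)); last exact: Cn_posid.
  by move=> t; exact: lt0r_neq0 (posid_gt0 t dl0).
apply/funext => p.
have [Sp|nS] := pselect (S p).
  have bp := Hdl _ Sp; rewrite (posid_id dl0 bp) mulrCA divff ?mulr1//.
  by rewrite lt0r_neq0// (lt_le_trans dl0).
by have [-> _] := D_outside_support (e1 R) nS; rewrite mul0r mulr0.
Qed.

(** The zero order term v phi^2 of [weighted_energy] alone controls (v phi)^2, because v <= d^2. *)
Lemma barrier_poincare Om psi : bdomain Om -> test_function Om psi ->
  (forall p, Om p -> 0 < l p < d) -> 0 < d ->
  int_ Om (fun p => psi p ^+ 2) <= d ^+ 2 * dir Om psi.
Proof.
move=> bO tp Hl d0; have [phi tphi Ep] := test_factor tp Hl.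
rewrite Ep dir_factor// -intZ//; last exact: energy_continuous tphi.1.
apply: int_le => //.
- apply: (@Ck_continuous _ 0%N); have C0 := Ck_barrier 0%N.
  by apply: CkM; apply: CkM => //; exact: tphi.1.
- by move=> p; apply: cvgM; [exact: cvg_cst|exact: energy_continuous tphi.1 _].
move=> p /Hl lp; have v0 := barrier_gt0 lp; have vd := barrier_le lp.
rewrite exprMn /weighted_energy; set X := _ ^+ 2 + _ ^+ 2.
have X0 : 0 <= X by rewrite addr_ge0 ?sqr_ge0.
set v := barrier p in v0 vd *; set f2 := phi p ^+ 2.
have f0 : 0 <= f2 by rewrite sqr_ge0.
have vd2 : v <= d ^+ 2 by apply: le_trans vd _; rewrite expr2 ler_wpM2l ?ltW//; case/andP: lp.
have h1 := mulr_ge0 (sqr_ge0 d) (mulr_ge0 (sqr_ge0 v) X0).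
have w0 : 0 <= d ^+ 2 - v by rewrite subr_ge0.
have h2 := mulr_ge0 w0 (mulr_ge0 (ltW v0) f0).
by move: h1 h2; lra.
Qed.

End Barrier.

(** * Cutoffs, and torsion and eigenvalue as best constants *)

Definition cutoff (x y r : R) (p : plane) : R :=
  plateau (r^-1 * (p.1 - x)) * plateau (r^-1 * (p.2 - y)).

Lemma Ck_cutoff x y r k : Ck k (cutoff x y r).
Proof.
have C1 : Ck k (fun p : plane => r^-1 * (p.1 - x)).
  have := Ck_aff r^-1 0 (- (r^-1 * x)) k; congr (Ck _ _).
  by apply/funext => p; rewrite /aff mul0r addr0 mulrBr.
have C2 : Ck k (fun p : plane => r^-1 * (p.2 - y)).
  have := Ck_aff 0 r^-1 (- (r^-1 * y)) k; congr (Ck _ _).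
  by apply/funext => p; rewrite /aff mul0r add0r mulrBr.
by apply: CkM; [apply: Ck_comp C1|apply: Ck_comp C2]; exact: Cn_plateau.
Qed.

Lemma cutoff01 x y r p : 0 <= cutoff x y r p <= 1.
Proof.
have /andP[h1 h2] := plateau01 (r^-1 * (p.1 - x)).
have /andP[h3 h4] := plateau01 (r^-1 * (p.2 - y)).
by rewrite mulr_ge0//= mulr_ile1.
Qed.

Lemma cutoff_eq1 x y r p : 0 < r -> `|p.1 - x| <= r -> `|p.2 - y| <= r ->
  cutoff x y r p = 1.
Proof.
move=> r0; rewrite !ler_norml => /andP[h1 h2] /andP[h3 h4].
have H t : - r <= t -> t <= r -> -1 <= r^-1 * t <= 1.
  move=> t1 t2; rewrite mulrC ler_pdivlMr// ler_pdivrMr// mulN1r mul1r.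
  by rewrite t1 t2.
by rewrite /cutoff !plateau_eq1 ?mulr1//; exact: H.
Qed.

Lemma cutoff_neq0 x y r p : 0 < r -> cutoff x y r p != 0 ->
  `|p.1 - x| <= 2 * r /\ `|p.2 - y| <= 2 * r.
Proof.
move=> r0 H.
have K t : plateau (r^-1 * t) != 0 -> `|t| <= 2 * r.
  move=> pt; rewrite leNgt; apply: contra pt => tr; apply/eqP/plateau_eq0.
  rewrite normrM ger0_norm; last by rewrite invr_ge0 ltW.
  by rewrite mulrC ler_pdivlMr// ltW.
move: H; rewrite /cutoff mulf_eq0 negb_or => /andP[h1 h2].
by split; exact: K.
Qed.

Definition cbox (x y r : R) : set plane :=
  `[x - r, x + r]%classic `*` `[y - r, y + r]%classic.

Lemma cutoff_support x y r Om : 0 < r -> cbox x y (2 * r) `<=` Om ->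
  compactly_supported Om (cutoff x y r).
Proof.
move=> r0 S; set B := cbox x y (2 * r) in S.
have cB : compact B by apply: compact_setX; exact: segment_compact.
have SB : closure [set p | cutoff x y r p != 0] `<=` B.
  rewrite [X in _ `<=` X](closure_id _).1; last first.
    by apply: compact_closed => //; exact: norm_hausdorff.
  apply: closure_subset => p /= /(cutoff_neq0 r0)[]; rewrite !ler_norml => h1 h2.
  by split; rewrite /= in_itv /=; lra.
split; last by move=> p /SB /S.
by apply: subclosed_compact cB SB; exact: closed_closure.
Qed.

Lemma open_cbox Om (p : plane) : open Om -> Om p ->
  exists2 r, 0 < r & cbox p.1 p.2 r `<=` Om.
Proof.
rewrite openE => H /H /nbhs_ballP[e /= e0 He].
exists (e / 2); first by rewrite divr_gt0.
move=> q [/=]; rewrite !in_itv /= => /andP[h1 h2] /andP[h3 h4]; apply: He.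
by split; rewrite /ball /= ltr_norml; lra.
Qed.

Lemma bump_exists Om : Om !=set0 -> bdomain Om ->
  exists2 psi, test_function Om psi & 0 < int_ Om psi.
Proof.
move=> [p Op] bO; have [r r0 S] := open_cbox bO.1 Op.
set s := r / 2; have s0 : 0 < s by rewrite divr_gt0.
have r2 : 2 * s = r by rewrite /s; lra.
rewrite -r2 in S; exists (cutoff p.1 p.2 s).
  by split; [move=> k; exact: Ck_cutoff|exact: cutoff_support].
have SB : box p.1 p.2 s `<=` Om.
  by move=> q [/= h1 h2]; apply: S; split; rewrite /= in_itv /=; lra.
have cc := Ck_continuous (Ck_cutoff p.1 p.2 s 0%N).
apply: (@lt_le_trans _ _ (area (box p.1 p.2 s))).
  by rewrite box_area// mulr_gt0// exprn_gt0.
apply: le_trans (int_sub_le bO (box_bdomain _ _ _) SB cc _); last first.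
  by move=> q _; case/andP: (cutoff01 p.1 p.2 s q).
apply: int_le => //; [exact: box_bdomain|exact: cst_continuous|].
by move=> q [/= h1 h2]; rewrite cutoff_eq1// ler_norml; lra.
Qed.

(** A bounded set lies in a strip 0 < l < 2 N, here with l = p.1 + N. *)
Lemma poincare Om : bdomain Om -> exists2 C, 0 < C & forall psi, test_function Om psi ->
  int_ Om (fun p => psi p ^+ 2) <= C * dir Om psi.
Proof.
move=> bO; have [_ [M bM]] := bO.
set N := `|M| + 1; have N0 : 0 < N by rewrite ltr_wpDl.
exists ((2 * N) ^+ 2); first by rewrite exprn_gt0 ?mulr_gt0.
move=> psi tp.
apply: (@barrier_poincare 1 0 N (2 * N)) => //; first by rewrite expr1n expr0n /= addr0.
  move=> p /bM[]; rewrite /aff mul1r mul0r addr0 ler_norml => /andP[h1 h2] _.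
  have := ler_norm M; rewrite /N; lra.
by rewrite mulr_gt0.
Qed.

Lemma sqr_int_eq0 Om u : bdomain Om -> L2 Om u ->
  ae_eq (leb2 R) Om (u : mplane -> R) (cst 0) -> int_ Om (fun p => u p ^+ 2) = 0.
Proof.
move=> bO [mu Iu] H; have mO := bdomain_measurable bO.
have E : (\int[leb2 R]_(p in Om) (u p ^+ 2)%:E = \int[leb2 R]_(p in Om) (cst 0%E) p)%E.
  apply: ae_eq_integral => //; first exact: (measurable_int _ Iu).
  by apply: filterS H => p /= up Op; rewrite up// expr0n.
by rewrite /Rintegral E integral0.
Qed.

Lemma sqr_int_gt0 Om u : bdomain Om -> L2 Om u ->
  ~ ae_eq (leb2 R) Om (u : mplane -> R) (cst 0) -> 0 < int_ Om (fun p => u p ^+ 2).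
Proof.
move=> bO [mu Iu] H; have mO := bdomain_measurable bO.
have i0 : 0 <= int_ Om (fun p => u p ^+ 2) by apply: int_ge0 => p _; exact: sqr_ge0.
rewrite lt_neqAle i0 andbT; apply/eqP => E; apply: H.
have E0 : (\int[leb2 R]_(p in Om) `|(u p ^+ 2)%:E| = 0)%E.
  have -> : (\int[leb2 R]_(p in Om) `|(u p ^+ 2)%:E|
      = \int[leb2 R]_(p in Om) (u p ^+ 2)%:E)%E.
    by apply: eq_integral => p _; rewrite abse_EFin ger0_norm ?sqr_ge0.
  rewrite -[LHS]fineK; last exact: integrable_fin_num Iu.
  by rewrite -[fine _]/(int_ Om (fun p => u p ^+ 2)) -E.
have /ae_eq_integral_abs := E0 => /(_ mO (measurable_int _ Iu)).
apply: filterS => p /= H Op; have := H Op => -[] /eqP.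
by rewrite sqrf_eq0 => /eqP.
Qed.

Lemma not_ae0 Om psi : bdomain Om -> L2 Om psi -> int_ Om psi != 0 ->
  ~ ae_eq (leb2 R) Om (psi : mplane -> R) (cst 0).
Proof.
move=> bO Lp i0 /(sqr_int_eq0 bO Lp) E.
have := cauchy_schwarz1 bO Lp; rewrite E mul0r => h.
by move: i0; rewrite -sqrf_eq0 eq_le h sqr_ge0.
Qed.

(** Density turns the supremum over H^1_0 into the least constant of a quotient-free inequality over
    test functions, which is the form in which two domains are compared. Poincare gives finiteness,
    a bump function positivity. *)
Lemma torsion_spec Om : Om !=set0 -> bdomain Om -> exists T : R,
  [/\ 0 < T, torsion Om = T%:E,
    forall psi, test_function Om psi -> (int_ Om psi) ^+ 2 <= T * dir Om psi
  & forall K, 0 <= K ->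
      (forall psi, test_function Om psi -> (int_ Om psi) ^+ 2 <= K * dir Om psi) ->
      T <= K].
Proof.
move=> O0 bO; have [C C0 HC] := poincare bO.
have [psi0 tpsi0 psi00] := bump_exists O0 bO.
have HK0 psi : test_function Om psi -> (int_ Om psi) ^+ 2 <= (area Om * C) * dir Om psi.
  move=> tp.
  apply: le_trans (cauchy_schwarz1 bO (continuous_L2 bO (test_continuous tp))) _.
  by rewrite mulrC -mulrA ler_wpM2l ?area_ge0// HC.
have ub K : 0 <= K ->
    (forall psi, test_function Om psi -> (int_ Om psi) ^+ 2 <= K * dir Om psi) ->
    (torsion Om <= K%:E)%E.
  move=> K0 HK; apply: ge_ereal_sup => _ [u [g1 [g2 [Hu _ ->]]]].
  rewrite lee_fin; have D0 := dirichlet_ge0 Om g1 g2.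
  have [Dp|Dn] := ltP 0 (dirichlet Om g1 g2).
    by rewrite ler_pdivrMr//; exact: torsion_density Hu.
  (* With zero energy the quotient is 0 by the convention x / 0 = 0. *)
  have -> : dirichlet Om g1 g2 = 0 by apply/eqP; rewrite eq_le Dn D0.
  by rewrite invr0 mulr0.
have lb psi : test_function Om psi -> int_ Om psi != 0 ->
    ((int_ Om psi ^+ 2 / dir Om psi)%:E <= torsion Om)%E.
  move=> tp i0; apply: ereal_sup_ubound.
  exists psi; exists (fun p => 'D_(e1 R) psi p); exists (fun p => 'D_(e2 R) psi p).
  split=> //; first exact: H10_test.
  by apply: not_ae0 => //; exact: continuous_L2 (test_continuous tp).
have dp psi : test_function Om psi -> int_ Om psi != 0 -> 0 < dir Om psi.
  move=> tp i0; rewrite lt_neqAle dirichlet_ge0 andbT; apply: contra i0 => /eqP d0.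
  by have := HK0 _ tp; rewrite -d0 mulr0 => h; rewrite -sqrf_eq0 eq_le h sqr_ge0.
have A0 : 0 <= area Om * C by rewrite mulr_ge0 ?area_ge0 ?ltW.
have i0 : int_ Om psi0 != 0 by rewrite gt_eqF.
have q0 : 0 < int_ Om psi0 ^+ 2 / dir Om psi0.
  by rewrite divr_gt0 ?exprn_gt0// dp.
have l0 := lb _ tpsi0 i0.
have u0 := ub _ A0 HK0.
have fT : torsion Om \is a fin_num.
  rewrite fin_numElt (lt_le_trans _ l0) ?ltNyr//=.
  by rewrite (le_lt_trans u0)// ltry.
have ET : torsion Om = (fine (torsion Om))%:E by rewrite fineK.
exists (fine (torsion Om)); split=> //.
- by rewrite -lte_fin -ET (lt_le_trans _ l0).
- move=> psi tp; have [->|ip] := eqVneq (int_ Om psi) 0.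
    rewrite expr0n mulr_ge0// ?dirichlet_ge0//.
    by rewrite -lee_fin -ET ltW// (lt_le_trans _ l0).
  by rewrite -ler_pdivrMr ?dp// -lee_fin -ET lb.
- by move=> K K0 HK; rewrite -lee_fin -ET ub.
Qed.

Lemma eigenvalue_spec Om : Om !=set0 -> bdomain Om -> exists L : R,
  [/\ 0 < L, eigenvalue1 Om = L%:E,
    forall psi, test_function Om psi ->
      L * int_ Om (fun p => psi p ^+ 2) <= dir Om psi
  & forall K, 0 <= K ->
      (forall psi, test_function Om psi ->
        K * int_ Om (fun p => psi p ^+ 2) <= dir Om psi) ->
      K <= L].
Proof.
move=> O0 bO; have [C C0 HC] := poincare bO.
have [psi0 tpsi0 psi00] := bump_exists O0 bO.
have HK0 psi : test_function Om psi -> C^-1 * int_ Om (fun p => psi p ^+ 2) <= dir Om psi.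
  by move=> tp; rewrite mulrC ler_pdivrMr// mulrC HC.
have lb K : 0 <= K ->
    (forall psi, test_function Om psi ->
      K * int_ Om (fun p => psi p ^+ 2) <= dir Om psi) ->
    (K%:E <= eigenvalue1 Om)%E.
  move=> K0 HK; apply: le_ereal_inf_tmp => _ [u [g1 [g2 [Hu u0 ->]]]].
  rewrite lee_fin ler_pdivlMr; first exact: eigenvalue_density Hu.
  by apply: sqr_int_gt0 => //; case: Hu => -[].
have ub psi : test_function Om psi -> ~ ae_eq (leb2 R) Om (psi : mplane -> R) (cst 0) ->
    (eigenvalue1 Om <= (dir Om psi / int_ Om (fun p => psi p ^+ 2))%:E)%E.
  move=> tp i0; apply: ereal_inf_lbound.
  exists psi; exists (fun p => 'D_(e1 R) psi p); exists (fun p => 'D_(e2 R) psi p).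
  by split=> //; exact: H10_test.
have Ci0 : 0 <= C^-1 by rewrite invr_ge0 ltW.
have l0 := lb _ Ci0 HK0.
have n0 : ~ ae_eq (leb2 R) Om (psi0 : mplane -> R) (cst 0).
  apply: not_ae0 => //; last by rewrite gt_eqF.
  exact: continuous_L2 (test_continuous tpsi0).
have u0 := ub _ tpsi0 n0.
have fT : eigenvalue1 Om \is a fin_num.
  rewrite fin_numElt (lt_le_trans _ l0) ?ltNyr//=.
  by rewrite (le_lt_trans u0)// ltry.
have ET : eigenvalue1 Om = (fine (eigenvalue1 Om))%:E by rewrite fineK.
exists (fine (eigenvalue1 Om)); split=> //.
- by rewrite -lte_fin -ET (lt_le_trans _ l0)// lte_fin invr_gt0.
- move=> psi tp.
  have [p0|p0] := pselect (ae_eq (leb2 R) Om (psi : mplane -> R) (cst 0)).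
    have -> := sqr_int_eq0 bO (continuous_L2 bO (test_continuous tp)) p0.
    by rewrite mulr0 dirichlet_ge0.
  rewrite -ler_pdivlMr; first by rewrite -lee_fin -ET ub.
  by apply: sqr_int_gt0 => //; exact: continuous_L2 (test_continuous tp).
- by move=> K K0 HK; rewrite -lee_fin -ET lb.
Qed.

End Spectral.

(** * Torsion of a cut domain *)

Section TorsionCut.
Context {R : realType}.
Local Notation plane := (R * R)%type.
Local Notation "'int_' Om f" := (\int[leb2 R]_(p in Om) f p)
  (at level 10, Om at level 8, f at level 8).
Implicit Types (Om S : set plane) (f g F u psi phi : plane -> R).

Lemma bdomainI Om S : bdomain Om -> open S -> bdomain (Om `&` S).
Proof.
move=> [oO [M bM]] oS; split; first exact: openI.
by exists M => p [/bM].
Qed.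

Lemma aff_open_gt (a b c e : R) : open [set p | e < aff a b c p].
Proof.
by move/continuousP: (@aff_cont R a b c) => /(_ _ (@open_gt R e)).
Qed.

Lemma aff_open_lt (a b c e : R) : open [set p | aff a b c p < e].
Proof.
by move/continuousP: (@aff_cont R a b c) => /(_ _ (@open_lt R e)).
Qed.

(** The positive part of f is still continuous and vanishes off S. *)
Lemma int_le_area Om S f (K : R) : bdomain Om -> open S -> continuous f -> 0 <= K ->
  (forall p, Om p -> f p <= K) -> (forall p, Om p -> ~ S p -> f p <= 0) ->
  int_ Om f <= K * area (Om `&` S).
Proof.
move=> bO oS cf K0 fK f0.
have cm : continuous (fun p => Num.max (f p) 0).
  by move=> p; apply: (@continuous_max _ _ f (fun=> 0)); [exact: cf|exact: cvg_cst].
apply: (@le_trans _ _ (int_ Om (fun p => Num.max (f p) 0))).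
  by apply: int_le => // p _; rewrite le_max lexx.
have bOS := bdomainI bO oS.
rewrite (@int_sub_eq _ _ (Om `&` S)); last 2 first.
- by move=> p [].
- by move=> p Op nS; apply/max_idPr/f0 => // Sp; apply: nS.
rewrite -int_cst//; apply: int_le => //; first exact: cst_continuous.
by move=> p [Op _]; rewrite ge_max K0 fK.
Qed.

Lemma norm_mid (x d : R) : 0 < x -> x < d -> `|d - 2 * x| <= d.
Proof. by move=> x0 xd; rewrite ler_norml; lra. Qed.

(** The pointwise estimate behind [ramp_key]: f is the truncated competitor, X its squared gradient,
    v the barrier, u = v / e, and s1, s2 are the derivatives of the step. The X-term has a
    favourable sign. The constant 80 is 4 (4 + 16), from f^2 <= 4 and u <= 4 d; the constant 9 is 1
    + 4 + 4, bounding 2 f - f^2, - 2 f eta and (f eta)^2. *)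
Lemma ramp_num (f eta X v u l d K s1 s2 : R) :
  0 < d -> 0 < K -> f ^+ 2 <= 4 -> 0 <= eta <= 1 -> 0 <= X -> 0 <= v <= d ^+ 2 ->
  0 <= u <= 4 * d -> `|d - 2 * l| <= d -> `|s1| <= K -> `|s2| <= K ->
  v * (2 * f - f ^+ 2 - (2 * (f * eta) - (f * eta) ^+ 2))
   - v ^+ 2 * (1 - eta ^+ 2) * X - f ^+ 2 * eta * ((d - 2 * l) * u * s1 + u ^+ 2 * s2)
  <= 80 * d ^+ 2 * K + 9 * d ^+ 2.
Proof.
move=> d0 K0 f4 /andP[eta0 eta1] X0 /andP[v0 vd] /andP[u0 ud] dl s1K s2K.
have T1 : `|(d - 2 * l) * u * s1 + u ^+ 2 * s2| <= 20 * d ^+ 2 * K.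
  apply: le_trans (ler_normD _ _) _; rewrite !normrM (ger0_norm u0).
  have h1 : `|d - 2 * l| * u * `|s1| <= d * (4 * d) * K.
    by apply: ler_pM => //; [exact: mulr_ge0|exact: ler_pM].
  have h2 : u * u * `|s2| <= 4 * d * (4 * d) * K.
    by apply: ler_pM => //; [exact: mulr_ge0|exact: ler_pM].
  by rewrite expr2; move: h1 h2; lra.
set T := _ * u * s1 + _ in T1 *.
have dK0 : 0 <= 20 * d ^+ 2 * K by apply: le_trans T1.
have h3 : - (f ^+ 2 * eta * T) <= 4 * (20 * d ^+ 2 * K).
  apply: le_trans (ler_norm _) _; rewrite normrN normrM.
  have fe0 : 0 <= f ^+ 2 * eta by apply: mulr_ge0 => //; exact: sqr_ge0.
  rewrite (ger0_norm fe0); apply: ler_pM => //.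
  by rewrite -[4]mulr1; apply: ler_pM => //; exact: sqr_ge0.
have h4 : 0 <= v ^+ 2 * (1 - eta ^+ 2) * X.
  apply: mulr_ge0 => //; apply: mulr_ge0; first exact: sqr_ge0.
  by rewrite subr_ge0 expr_le1.
have h5 : v * (2 * f - f ^+ 2 - (2 * (f * eta) - (f * eta) ^+ 2)) <= d ^+ 2 * 9.
  have fe : (f * eta) ^+ 2 <= 4.
    by rewrite exprMn -[4]mulr1; apply: ler_pM; rewrite ?sqr_ge0 ?expr_le1.
  have : 2 * f - f ^+ 2 <= 1 by have := sqr_ge0 (1 - f); lra.
  have : - (2 * (f * eta)) <= 4 by have := sqr_ge0 (f * eta + 2); lra.
  move=> k1 k2; have k3 : 2 * f - f ^+ 2 - (2 * (f * eta) - (f * eta) ^+ 2) <= 9 by lra.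
  apply: (@le_trans _ _ (v * 9)); first exact: ler_wpM2l.
  exact: ler_wpM2r.
by move: h3 h4 h5; lra.
Qed.

Variables (a b c d : R).
Hypothesis ab : a ^+ 2 + b ^+ 2 = 1.
Let l : plane -> R := aff a b c.
Let v : plane -> R := barrier a b c d.
Let energy := weighted_energy a b c d.

(* By dir_factor, the integral of this density is 2 \int u - \int |grad u|^2
   for u = v phi; such quantities are bounded by the torsion. *)
Definition tors_density phi (p : plane) : R := 2 * (v p * phi p) - energy phi p.

Lemma tors_densityE Om phi : bdomain Om -> test_function Om phi ->
  2 * int_ Om (fun p => v p * phi p) - dir Om (fun p => v p * phi p)
  = int_ Om (tors_density phi).
Proof.
move=> bO tphi; rewrite dir_factor// -intZ//; last first.
  by move=> p; apply: cvgM; [exact: Ck_continuous (Ck_barrier a b c d 0%N) _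
    |exact: test_continuous tphi _].
rewrite -intB//; last exact: (@energy_continuous R a b c d phi tphi.1).
move=> p; apply: cvgM; first exact: cvg_cst.
by apply: cvgM; [exact: Ck_continuous (Ck_barrier a b c d 0%N) _
    |exact: test_continuous tphi _].
Qed.

Lemma tors_density_continuous phi : (forall k, Ck k phi) -> continuous (tors_density phi).
Proof.
move=> Cphi p; apply: cvgB; last exact: (@energy_continuous R a b c d phi Cphi).
apply: cvgM; first exact: cvg_cst.
by apply: cvgM; [exact: Ck_continuous (Ck_barrier a b c d 0%N) _
    |exact: Ck_continuous (Cphi 0%N) _].
Qed.

(** The density is v (1 - (1 - f)^2) - v^2 |grad f|^2; [trunc] does not move f away from 1 and has
    derivative at most 1 in absolute value. *)
Lemma tors_density_trunc Om phi p : test_function Om phi -> 0 < v p ->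
  tors_density phi p <= tors_density (fun q => trunc (phi q)) p.
Proof.
move=> tphi v0; have [Cphi _] := tphi.
have D w : axes w -> 'D_w (fun q => trunc (phi q)) p
    = 'D_1 (@trunc R) (phi p) * 'D_w phi p.
  move=> aw; have dphi := Ck_is_derive p aw (Cphi 1%N).
  have [dt _] := Cn1_derive (@Cn_trunc R 1).
  by have [_ ->] := is_derive_compV dphi (dt (phi p)).
rewrite /tors_density /energy /weighted_energy -/v (D _ (@axes1 R)) (D _ (@axes2 R)).
have := trunc_dist1 (phi p); have := dtrunc_sqr (phi p).
set k := 'D_1 (@trunc R) _; set t := trunc _; set f := phi p.
set x := 'D_(e1 R) phi p; set y := 'D_(e2 R) phi p; set w := v p in v0 *.
move=> k1 tf.
have h1 : 0 <= w * ((1 - f) ^+ 2 - (1 - t) ^+ 2).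
  by rewrite mulr_ge0 ?subr_ge0// ltW.
have h2 : 0 <= (1 - k ^+ 2) * (w ^+ 2 * (x ^+ 2 + y ^+ 2)).
  by apply: mulr_ge0; [rewrite subr_ge0|apply: mulr_ge0; [exact: sqr_ge0|
    apply: addr_ge0; exact: sqr_ge0]].
by move: h1 h2; lra.
Qed.

(** It rises from 0 at l = 2 e to 1 at l = 3 e. Starting at 2 e rather than e keeps the closed
    support of a product off the cut line l = e. *)
Definition ramp (e : R) (p : plane) : R := step (e^-1 * l p - 2).

Section Ramp.
Variable e : R.
Hypothesis e0 : 0 < e.

Lemma Ck_ramp_arg k : Ck k (fun p => e^-1 * l p - 2).
Proof. by apply: CkB; [apply: CkZ; exact: Ck_aff|exact: Ck_cst]. Qed.

Lemma Ck_ramp k : Ck k (ramp e).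
Proof. by apply: (@Ck_comp _ k step); [exact: Cn_step|exact: Ck_ramp_arg]. Qed.

Let dramp (w p : plane) := e^-1 * (a * w.1 + b * w.2) * 'D_1 step (e^-1 * l p - 2).

Lemma is_derive_ramp_arg p w :
  is_derive p w (fun p => e^-1 * l p - 2) (e^-1 * (a * w.1 + b * w.2)).
Proof.
have H := is_deriveDr_ (is_deriveMr_ (is_derive_cst (e^-1 : R^o) p w)
  (is_derive_aff a b c p w)) (is_deriveNr_ (is_derive_cst (2 : R^o) p w)).
by apply: is_derive_eq H _; rewrite /cst; ring.
Qed.

Lemma is_derive_ramp p w : is_derive p w (ramp e) (dramp w p).
Proof.
have [ds _] := Cn1_derive (@Cn_step R 1).
have H := is_derive_compV (is_derive_ramp_arg p w) (ds (e^-1 * l p - 2)).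
by apply: is_derive_eq H _; rewrite /dramp mulrC.
Qed.

Lemma Ck_dramp w k : Ck k (dramp w).
Proof.
apply: CkZ; apply: (@Ck_comp _ k (fun t => 'D_1 step t)); last exact: Ck_ramp_arg.
by have [_] := Cn1_derive (@Cn_step R k.+1).
Qed.

Lemma is_derive_dramp p w w' : is_derive p w' (dramp w)
  (e^-1 ^+ 2 * (a * w.1 + b * w.2) * (a * w'.1 + b * w'.2)
    * 'D_1 (fun t => 'D_1 step t) (e^-1 * l p - 2)).
Proof.
have [_ C1] := Cn1_derive (@Cn_step R 2).
have [ds _] := Cn1_derive C1.
have H := is_derive_compV (is_derive_ramp_arg p w') (ds (e^-1 * l p - 2)).
have H' := is_deriveMr_ (is_derive_cst (e^-1 * (a * w.1 + b * w.2) : R^o) p w') H.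
by apply: is_derive_eq H' _; rewrite /cst; ring.
Qed.

Lemma ramp_eq1 p : 3 * e <= l p -> ramp e p = 1.
Proof.
move=> h; rewrite /ramp step_ge1// lerBrDr mulrC ler_pdivlMr//; lra.
Qed.

Lemma ramp_eq0 p : l p <= 2 * e -> ramp e p = 0.
Proof.
move=> h; rewrite /ramp step_le0// subr_le0 mulrC ler_pdivrMr//.
Qed.

Definition chop Om : set plane := Om `&` [set p | e < l p].

Lemma test_function_chop Om phi : test_function Om phi ->
  test_function (chop Om) (fun p => phi p * ramp e p).
Proof.
move=> [Cp sp]; split; first by move=> k; apply: CkM => //; exact: Ck_ramp.
have [cS sS] : compactly_supported Om (fun p => phi p * ramp e p).
  by apply: compactly_supported_sub sp _ => p ->; rewrite mul0r.
split=> // p Sp; split; first exact: sS.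
have cl : closed [set p | 2 * e <= l p].
  rewrite -[X in closed X]setCK; apply: open_closedC.
  have -> : ~` [set p | 2 * e <= l p] = [set p | l p < 2 * e].
    by apply/seteqP; split=> q /=; [move=> /negP; rewrite -ltNge|rewrite ltNge => /negP].
  exact: aff_open_lt.
suff h : [set p | 2 * e <= l p] p by apply: lt_le_trans h; rewrite -[ltLHS]mul1r ltr_pM2r// ltr1n.
rewrite [X in X p](closure_id _).1//; move: Sp; apply: closure_subset => q /= H.
rewrite leNgt; apply: contra H => h; apply/eqP.
by rewrite ramp_eq0 ?mulr0// ltW.
Qed.

(* The vector field phi^2 v^2 eta grad eta, where eta is the ramp, vanishes near
   the boundary; subtracting its divergence removes the cross terms
   phi grad phi . grad eta, on which there is no control. *)
Lemma ramp_key Om phi (K : R) : bdomain Om -> test_function Om phi ->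
  0 < K -> (forall t : R, `|'D_1 step t| <= K /\ `|'D_1 (fun t => 'D_1 step t) t| <= K) ->
  (forall p, Om p -> 0 < l p < d) -> 0 < d ->
  (forall p, phi p ^+ 2 <= 4) ->
  int_ Om (tors_density phi) <= int_ Om (tors_density (fun p => phi p * ramp e p))
    + (80 * d ^+ 2 * K + 9 * d ^+ 2) * area (Om `&` [set p | l p < 4 * e]).
Proof.
move=> bO tphi K0 HK Hl d0 phi4; have [Cphi sphi] := tphi.
set eta := ramp e.
pose W w p := phi p * phi p * (v p * v p * (eta p * dramp w p)).
have Cv k : Ck k v by exact: Ck_barrier.
have CW w k : Ck k (W w).
  apply: CkM; first exact: CkM.
  apply: CkM; first exact: CkM.
  by apply: CkM; [exact: Ck_ramp|exact: Ck_dramp].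
have sW w : compactly_supported Om (W w).
  by apply: compactly_supported_sub sphi _ => p; rewrite /W => ->; rewrite !mul0r.
have I1 := int_D_eq0 (@axes1 R) bO (CW _ 1%N) (sW (e1 R)).
have I2 := int_D_eq0 (@axes2 R) bO (CW _ 1%N) (sW (e2 R)).
have cD w : axes w -> continuous (fun p => 'D_w (W w) p).
  by move=> aw; exact: Ck_continuous (Ck_D aw (CW _ 1%N)).
pose divW p := 'D_(e1 R) (W (e1 R)) p + 'D_(e2 R) (W (e2 R)) p.
have cdivW : continuous divW.
  by move=> p; apply: cvgD; [exact: (cD _ (@axes1 R))|exact: (cD _ (@axes2 R))].
have IW : int_ Om divW = 0.
  by rewrite intD ?I1 ?I2 ?addr0//; [exact: (cD _ (@axes1 R))|exact: (cD _ (@axes2 R))].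
have Ceta k : Ck k (fun p => phi p * eta p) by apply: CkM => //; exact: Ck_ramp.
have c1 := tors_density_continuous Cphi.
have c2 := tors_density_continuous Ceta.
pose h p := tors_density phi p - (tors_density (fun p => phi p * eta p) p + divW p).
have c12 : continuous (fun p => tors_density (fun p => phi p * eta p) p + divW p).
  by move=> p; apply: cvgD; [exact: c2|exact: cdivW].
have ch : continuous h by move=> p; apply: cvgB; [exact: c1|exact: c12].
have -> : int_ Om (tors_density phi) =
    int_ Om (tors_density (fun p => phi p * eta p)) + int_ Om h.
  have E1 := @intB R Om _ _ bO c1 c12; have E2 := @intD R Om _ _ bO c2 cdivW.
  have -> : int_ Om h = int_ Om (tors_density phi)
      - (int_ Om (tors_density (fun p => phi p * eta p)) + int_ Om divW).
    by rewrite -E2 -E1.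
  by rewrite IW addr0 addrC subrK.
rewrite lerD2l.
have dphi w p : axes w -> is_derive p w phi ('D_w phi p).
  by move=> aw; exact: Ck_is_derive aw (Cphi 1%N).
have dv p w := is_derive_barrier a b c d p w.
have deta w p := is_derive_ramp p w.
have ddeta w p := is_derive_dramp p w w.
have DW w p : axes w -> 'D_w (W w) p =
   2 * phi p * 'D_w phi p * (v p ^+ 2 * eta p * dramp w p)
   + phi p ^+ 2 * (v p ^+ 2 * dramp w p ^+ 2)
   + phi p ^+ 2 * eta p * (2 * v p * (2^-1 * (d - 2 * l p) * (a * w.1 + b * w.2)) * dramp w p
       + v p ^+ 2 * (e^-1 ^+ 2 * (a * w.1 + b * w.2) ^+ 2
            * 'D_1 (fun t => 'D_1 step t) (e^-1 * l p - 2))).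
  move=> aw.
  have [_ ->] := is_deriveMr_ (is_deriveMr_ (dphi w p aw) (dphi w p aw))
     (is_deriveMr_ (is_deriveMr_ (dv p w) (dv p w)) (is_deriveMr_ (deta w p) (ddeta w p))).
  by rewrite -/v -/l -/eta; ring.
have Dpe w p : axes w -> 'D_w (fun p => phi p * eta p) p =
   phi p * dramp w p + eta p * 'D_w phi p.
  by move=> aw; have [_ ->] := is_deriveMr_ (dphi w p aw) (deta w p).
(* Besides the cross terms, the two copies of phi^2 v^2 |grad eta|^2 cancel. What remains of the
   ramp in the last term is 2 v grad v . grad eta + v^2 Laplace eta. *)
have hE p : h p = v p * (2 * phi p - phi p ^+ 2 - (2 * (phi p * eta p) - (phi p * eta p) ^+ 2))
   - v p ^+ 2 * (1 - eta p ^+ 2) * ('D_(e1 R) phi p ^+ 2 + 'D_(e2 R) phi p ^+ 2)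
   - phi p ^+ 2 * eta p * (2 * v p * (2^-1 * (d - 2 * l p)) * (e^-1 * 'D_1 step (e^-1 * l p - 2))
       + v p ^+ 2 * (e^-1 ^+ 2 * 'D_1 (fun t => 'D_1 step t) (e^-1 * l p - 2))).
  rewrite /h /divW /tors_density /energy /weighted_energy -/v.
  rewrite (DW _ _ (@axes1 R)) (DW _ _ (@axes2 R)) (Dpe _ _ (@axes1 R)) (Dpe _ _ (@axes2 R)).
  rewrite /dramp /=.
  set X := 'D_(e1 R) phi p; set Y := 'D_(e2 R) phi p.
  set s1 := 'D_1 step _; set s2 := 'D_1 (fun t => 'D_1 step t) _.
  rewrite !mulr1 !mulr0 !addr0 !add0r.
  set t1 := 2 * v p * _ * (e^-1 * s1); set t2 := v p ^+ 2 * (e^-1 ^+ 2 * s2).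
  have -> : t1 = (a ^+ 2 + b ^+ 2) * t1 by rewrite ab mul1r.
  have -> : t2 = (a ^+ 2 + b ^+ 2) * t2 by rewrite ab mul1r.
  by rewrite /t1 /t2; ring.
have d2 : 0 <= d ^+ 2 by exact: sqr_ge0.
have bound_ge0 : 0 <= 80 * d ^+ 2 * K + 9 * d ^+ 2.
  by rewrite addr_ge0 ?mulr_ge0 ?ltW.
(* The ramp is complete at 3 e, but the second derivative of the step is shown to vanish only
   strictly beyond 1; 4 e leaves room. *)
have h_eq0 p : 4 * e <= l p -> h p = 0.
  move=> lp; have e0' : 0 < e := e0.
  have h3 : 3 * e <= l p by lra.
  have t1 : 1 < e^-1 * l p - 2.
    by rewrite ltrBrDr mulrC ltr_pdivlMr//; lra.
  rewrite hE ddstep_gt1// dstep_ge1 ?ltW// /eta ramp_eq1//.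
  by rewrite !mulr1 !expr1n !mulr0 addr0 !mulr0 !subrr !mulr0 !mul0r !subr0.
apply: int_le_area => //.
- exact: aff_open_lt.
- move=> p Op; have lp := Hl p Op.
  have [l4|l4] := leP (4 * e) (l p); first by rewrite h_eq0 ?bound_ge0.
  have v0 : 0 < v p by exact: barrier_gt0.
  have vd : v p <= d * l p by exact: barrier_le.
  have /andP[l0 ld] := lp.
  have [s1K s2K] := HK (e^-1 * l p - 2).
  rewrite hE; set s1 := 'D_1 step _ in s1K *; set s2 := 'D_1 (fun t => 'D_1 step t) _ in s2K *.
  set u := e^-1 * v p.
  set X := _ ^+ 2 + 'D_(e2 R) phi p ^+ 2.
  have -> : 2 * v p * (2^-1 * (d - 2 * l p)) * (e^-1 * s1) + v p ^+ 2 * (e^-1 ^+ 2 * s2)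
     = (d - 2 * l p) * u * s1 + u ^+ 2 * s2 by rewrite /u; field; exact: lt0r_neq0.
  apply: ramp_num => //.
  + by rewrite (step_ge0 _) (step_le1 _).
  + by rewrite addr_ge0 ?sqr_ge0.
  + rewrite ltW//=; apply: le_trans vd _; rewrite expr2 ler_wpM2l ?ltW//.
  (* The decisive compensation: v <= d l < 4 d e, so v / e stays bounded as e tends to 0. *)
  + have u0 : 0 <= u by apply: mulr_ge0; [rewrite invr_ge0; exact: ltW|exact: ltW].
    rewrite u0 /= /u mulrC ler_pdivrMr//; apply: le_trans vd _.
    by rewrite [4 * d * e]mulrAC mulrC; apply: ler_wpM2r; exact: ltW.
  + exact: norm_mid.
- by move=> p Op /=; move=> /negP; rewrite -leNgt => lp; rewrite h_eq0.
Qed.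

End Ramp.

(** The functional 2 y - z, with y = \int u and z = \int |grad u|^2, is additive over the domain,
    unlike y^2 / z, so truncation and ramp can be estimated pointwise in it. Scaling phi by t and
    [quad_disc] lead back to the quotient. *)
Lemma torsion_cut_bound Om (K e T : R) : bdomain Om -> 0 < e -> 0 < K ->
  (forall t : R, `|'D_1 step t| <= K /\ `|'D_1 (fun t => 'D_1 step t) t| <= K) ->
  (forall p, Om p -> 0 < l p < d) -> 0 < d -> 0 <= T ->
  (forall psi, test_function (chop e Om) psi ->
     (int_ (chop e Om) psi) ^+ 2 <= T * dir (chop e Om) psi) ->
  forall psi, test_function Om psi -> (int_ Om psi) ^+ 2 <=
    (T + (80 * d ^+ 2 * K + 9 * d ^+ 2) * area (Om `&` [set p | l p < 4 * e]))
      * dir Om psi.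
Proof.
move=> bO e0 K0 HK Hl d0 T0 HT psi tpsi.
set C := _ * area _.
have key phi0 : test_function Om phi0 ->
    2 * int_ Om (fun p => v p * phi0 p) - dir Om (fun p => v p * phi0 p) <= T + C.
  move=> tphi0; rewrite (tors_densityE bO tphi0).
  (* Truncation precedes the ramp: [ramp_key] needs phi^2 <= 4. *)
  pose phi1 p := trunc (phi0 p).
  have t1 : test_function Om phi1.
    apply: test_function_comp => //; first exact: Cn_trunc.
    by rewrite trunc_id//; lra.
  apply: (@le_trans _ _ (int_ Om (tors_density phi1))).
    apply: int_le => //.
    - exact: tors_density_continuous tphi0.1.
    - exact: tors_density_continuous t1.1.
    - move=> p /Hl lp; apply: tors_density_trunc tphi0 _.
      exact: barrier_gt0.
  have t2 := test_function_chop e0 t1.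
  apply: le_trans (ramp_key e0 bO t1 K0 HK Hl d0 _) _.
    by move=> p; exact: trunc_sqr.
  rewrite lerD2r.
  have bC : bdomain (chop e Om) by apply: bdomainI => //; exact: aff_open_gt.
  rewrite (@int_sub_eq _ Om (chop e Om)); last 2 first.
  - by move=> p [].
  - move=> p _ nC; have H w : phi1 p * ramp e p = 0
        /\ 'D_w (fun p => phi1 p * ramp e p) p = 0.
      by apply: D_outside_support => /t2.2.2.
    rewrite /tors_density /energy /weighted_energy (H 0).1 (H (e1 R)).2 (H (e2 R)).2.
    by rewrite !mulr0 expr0n /= addr0 !mulr0 addr0 subr0.
  rewrite -(tors_densityE bC t2).
  have t3 : test_function (chop e Om) (fun p => v p * (phi1 p * ramp e p)).
    have -> : (fun p => v p * (phi1 p * ramp e p)) = (fun p => phi1 p * ramp e p * v p).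
      by apply/funext => p; rewrite mulrC.
    by apply: test_functionM t2 _ => k; exact: Ck_barrier.
  have := HT _ t3; set y := (X in 2 * X - _); set z := dir _ _.
  rewrite -/y => yz.
  have z0 : 0 <= z by exact: dirichlet_ge0.
  (* From y^2 <= T z follows (2 y)^2 <= 4 T z <= (T + z)^2, hence 2 y - z <= T. *)
  rewrite leNgt; apply/negP => h.
  have h1 : 0 <= T + z by lra.
  have h2 : 0 < (2 * y - (T + z)) * (2 * y + (T + z)) by rewrite mulr_gt0//; lra.
  have := sqr_ge0 (T - z); nra.
have C0 : 0 <= C by rewrite mulr_ge0 ?area_ge0// addr_ge0 ?mulr_ge0 ?sqr_ge0 ?ltW.
have [phi tphi ->] := test_factor tpsi Hl.
apply: quad_disc; first exact: dirichlet_ge0.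
move=> t.
have tt : test_function Om (fun p => phi p * t).
  by apply: test_functionM => // k; exact: Ck_cst.
have := key _ tt.
have cv : continuous (fun p => v p * phi p).
  by move=> p; apply: cvgM; [exact: Ck_continuous (Ck_barrier a b c d 0%N) _
    |exact: test_continuous tphi _].
have -> : int_ Om (fun p => v p * (phi p * t)) = t * int_ Om (fun p => v p * phi p).
  by rewrite -intZ//; apply: eq_int => p _; rewrite mulrA mulrC.
have -> : dir Om (fun p => v p * (phi p * t)) = t ^+ 2 * dir Om (fun p => v p * phi p).
  rewrite !dir_factor// -intZ//; last exact: (@energy_continuous R a b c d phi tphi.1).
  apply: eq_int => p _; rewrite /weighted_energy.
  have D w : axes w -> 'D_w (fun p => phi p * t) p = t * 'D_w phi p.
    move=> aw; have dphi := Ck_is_derive p aw (tphi.1 1%N).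
    have [_ ->] := is_deriveMr_ dphi (is_derive_cst (t : R^o) p w).
    by rewrite mulr0 add0r.
  by rewrite (D _ (@axes1 R)) (D _ (@axes2 R)); ring.
lra.
Qed.

End TorsionCut.

(** * Perimeter of a domain cut at a corner *)

Section Perimeter.
Context {R : realType}.
Local Notation plane := (R * R)%type.
Local Notation "'int_' Om f" := (\int[leb2 R]_(p in Om) f p)
  (at level 10, Om at level 8, f at level 8).
Implicit Types (Om U : set plane) (f g F : plane -> R).

Lemma D_open_eq U f g (v p : plane) : open U -> U p -> (forall q, U q -> f q = g q) ->
  'D_v f p = 'D_v g p.
Proof.
rewrite openE => /(_ p) /[apply] Up fg; apply: near_eq_derive.
by apply: filterS Up => q; exact: fg.
Qed.

Lemma bounded_support f (M : R) :
  (forall p, f p != 0 -> `|p.1| <= M /\ `|p.2| <= M) -> compactly_supported setT f.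
Proof.
move=> H; split=> //.
pose B := cbox 0 0 M : set plane.
have cB : compact B by apply: compact_setX; exact: segment_compact.
have SB : closure [set p | f p != 0] `<=` B.
  rewrite [X in _ `<=` X](closure_id _).1; last first.
    by apply: compact_closed => //; exact: norm_hausdorff.
  apply: closure_subset => p /= /H[]; rewrite !ler_norml => h1 h2.
  by split; rewrite /= in_itv /=; lra.
by apply: subclosed_compact cB SB; exact: closed_closure.
Qed.

Lemma support_bounded Om f : compactly_supported Om f ->
  exists M, forall p, f p != 0 -> `|p.1| <= M /\ `|p.2| <= M.
Proof.
move=> [/compact_bounded[M [_ HM]] _].
exists (`|M| + 1) => p fp.
have /HM : M < `|M| + 1 by have := ler_norm M; lra.
move=> /(_ p (@subset_closure _ [set p | f p != 0] p fp)).
by rewrite /= prod_normE ge_max => /andP[].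
Qed.

Definition admissible (F1 F2 : plane -> R) :=
  [/\ Ck 1 F1 /\ compactly_supported setT F1,
      Ck 1 F2 /\ compactly_supported setT F2
    & forall p, F1 p ^+ 2 + F2 p ^+ 2 <= 1].

Definition div F1 F2 (p : plane) : R := 'D_(e1 R) F1 p + 'D_(e2 R) F2 p.

Lemma div_continuous F1 F2 : Ck 1 F1 -> Ck 1 F2 -> continuous (div F1 F2).
Proof.
move=> C1 C2 p; apply: cvgD.
  exact: (Ck_continuous (Ck_D (@axes1 R) C1)).
exact: (Ck_continuous (Ck_D (@axes2 R) C2)).
Qed.

Lemma closure_le Om f (b : R) : continuous f -> (forall p, Om p -> `|f p| <= b) ->
  forall p, closure Om p -> `|f p| <= b.
Proof.
move=> cf H p cp.
have cl : closed [set p | `|f p| <= b].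
  apply: (@closed_comp _ _ (fun p => `|f p|) [set x | x <= b]); last exact: closed_le.
  by move=> q _; apply: cvg_norm; exact: cf.
suff : [set p | `|f p| <= b] p by [].
by rewrite [X in X p](closure_id _).1//; move: cp; exact: closure_subset.
Qed.

(** Two partial derivatives, each contributing at most 2 b times the width 2 w of a projection of
    [Om]. *)
Lemma div_bound Om F1 F2 (x0 y0 w b : R) : bdomain Om -> cvx Om ->
  Ck 1 F1 -> Ck 1 F2 -> 0 <= w -> 0 <= b ->
  (forall p, Om p -> `|p.1 - x0| <= w /\ `|p.2 - y0| <= w) ->
  (forall p, Om p -> `|F1 p| <= b) -> (forall p, Om p -> `|F2 p| <= b) ->
  `|int_ Om (div F1 F2)| <= 8 * b * w.
Proof.
move=> bO cO C1 C2 w0 b0 Hw H1 H2; have [oO [M bM]] := bO.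
rewrite intD//; last 2 first.
- exact: (Ck_continuous (Ck_D (@axes1 R) C1)).
- exact: (Ck_continuous (Ck_D (@axes2 R) C2)).
have k1 p : Om p -> x0 - w <= p.1 <= x0 + w.
  by move=> /Hw[+ _]; rewrite ler_norml; lra.
have k2 p : Om p -> y0 - w <= p.2 <= y0 + w.
  by move=> /Hw[_]; rewrite ler_norml; lra.
have cd (z : R) : z - w <= z + w by lra.
have B1 := integral_D1_bound oO bM cO C1 k2 (cd y0) b0
  (fun p cp _ => closure_le (Ck_continuous C1) H1 cp).
have B2 := integral_D2_bound oO bM cO C2 k1 (cd x0) b0
  (fun p cp _ => closure_le (Ck_continuous C2) H2 cp).
apply: le_trans (ler_normD _ _) _.
apply: le_trans (lerD B1 B2) _.
by rewrite le_eqVlt; apply/orP; left; apply/eqP; ring.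
Qed.

Lemma sqr_sum_le1 (x y : R) : x ^+ 2 + y ^+ 2 <= 1 -> `|x| <= 1 /\ `|y| <= 1.
Proof.
have := sqr_ge0 x; have := sqr_ge0 y => y0 x0 H.
by split; rewrite -(@expr_le1 _ 2)// real_normK ?num_real//; lra.
Qed.

(** Finiteness is [div_bound]. Positivity is tested with the field (p.1 / (2 N), 0), multiplied by a
    cutoff: it has divergence 1 / (2 N) on [Om], and length at most 1 since the cutoff vanishes
    where |p.1| > 2 N. *)
Lemma perimeter_spec Om : Om !=set0 -> bdomain Om -> cvx Om -> exists P : R,
  [/\ 0 < P, perimeter Om = P%:E,
     forall F1 F2, admissible F1 F2 -> int_ Om (div F1 F2) <= P
   & forall K, (forall F1 F2, admissible F1 F2 -> int_ Om (div F1 F2) <= K) -> P <= K].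
Proof.
move=> O0 bO cO; have [_ [M bM]] := bO.
pose N := `|M| + 1.
have N0 : 0 < N by rewrite ltr_wpDl.
have MN : M <= N by rewrite /N; have := ler_norm M; lra.
have HN p : Om p -> `|p.1 - 0| <= N /\ `|p.2 - 0| <= N.
  by move=> /bM[h1 h2]; rewrite !subr0; split; apply: le_trans MN.
have adm_le F1 F2 : admissible F1 F2 -> int_ Om (div F1 F2) <= 8 * 1 * N.
  move=> [[C1 _] [C2 _] H]; apply: le_trans (ler_norm _) _.
  apply: (@div_bound _ _ _ 0 0) => //; first exact: ltW.
    by move=> p _; have [] := sqr_sum_le1 (H p).
  by move=> p _; have [] := sqr_sum_le1 (H p).
have ub K : (forall F1 F2, admissible F1 F2 -> int_ Om (div F1 F2) <= K) ->
    (perimeter Om <= K%:E)%E.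
  move=> HK; apply: ge_ereal_sup => _ [F1 [F2 [h1 h2 h3 ->]]].
  by rewrite lee_fin; exact: (HK F1 F2).
have lb F1 F2 : admissible F1 F2 -> ((int_ Om (div F1 F2))%:E <= perimeter Om)%E.
  by move=> [h1 h2 h3]; apply: ereal_sup_ubound; exists F1, F2.
pose F1 p := cutoff 0 0 N p * ((2 * N)^-1 * p.1).
pose F2 : plane -> R := fun=> 0.
have Clin k : Ck k (fun p : plane => (2 * N)^-1 * p.1).
  have := Ck_aff (2 * N)^-1 0 0 k; congr (Ck _ _).
  by apply/funext => p; rewrite /aff mul0r !addr0.
have CF1 k : Ck k F1 by apply: CkM => //; exact: Ck_cutoff.
have N2 : 0 < 2 * N by rewrite mulr_gt0.
have aF : admissible F1 F2.
  split; [split=> //|split; first exact: Ck_cst|].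
  - apply: (@bounded_support _ (2 * N)) => p; rewrite mulf_eq0 negb_or => /andP[h _].
    by have := cutoff_neq0 N0 h; rewrite !subr0.
  - by apply: (@bounded_support _ 0) => p; rewrite /F2 eqxx.
  - move=> p; rewrite /F2 expr0n addr0 /F1 exprMn.
    have [->|h] := eqVneq (cutoff 0 0 N p) 0; first by rewrite expr0n /= mul0r.
    have /andP[c0 c1] := cutoff01 0 0 N p.
    have [] := cutoff_neq0 N0 h; rewrite !subr0 => h1 _.
    have h3 : `|(2 * N)^-1 * p.1| <= 1.
      rewrite normrM ger0_norm; last by rewrite invr_ge0 ltW.
      by rewrite mulrC ler_pdivrMr// mul1r.
    have h4 : ((2 * N)^-1 * p.1) ^+ 2 <= 1 by rewrite -real_normK ?num_real// expr_le1.
    have h5 : cutoff 0 0 N p ^+ 2 <= 1 by rewrite expr_le1.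
    by apply: mulr_ile1 => //; exact: sqr_ge0.
have IF : int_ Om (div F1 F2) = (2 * N)^-1 * area Om.
  rewrite -int_cst//; apply: eq_int => p Op; rewrite /div.
  have -> : 'D_(e1 R) F1 p = 'D_(e1 R) (aff (2 * N)^-1 0 0) p.
    apply: (D_open_eq _ bO.1 Op) => q /HN[]; rewrite !subr0 => h1 h2.
    by rewrite /F1 cutoff_eq1 ?subr0// mul1r /aff mul0r !addr0.
  have [_ ->] := is_derive_aff (2 * N)^-1 0 0 p (e1 R).
  by rewrite /F2 derive_cst /= mulr1 mul0r !addr0.
have A0 : 0 < area Om.
  move: O0 => [p Op]; have [r r0 S] := open_cbox bO.1 Op.
  have SB : box p.1 p.2 r `<=` Om.
    by move=> q [/= h1 h2]; apply: S; split; rewrite /= in_itv /=; lra.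
  apply: lt_le_trans (area_sub bO (box_bdomain _ _ _) SB).
  by rewrite box_area// mulr_gt0// exprn_gt0.
have l0 := lb _ _ aF; have u0 := ub _ adm_le.
have fT : perimeter Om \is a fin_num.
  rewrite fin_numElt (lt_le_trans _ l0) ?ltNyr//=.
  by rewrite (le_lt_trans u0)// ltry.
have ET : perimeter Om = (fine (perimeter Om))%:E by rewrite fineK.
exists (fine (perimeter Om)); split=> //.
- rewrite -lte_fin -ET (lt_le_trans _ l0)// IF lte_fin mulr_gt0 ?invr_gt0//.
- by move=> G1 G2 aG; rewrite -lee_fin -ET lb.
- by move=> K HK; rewrite -lee_fin -ET ub.
Qed.

Section Corner.
Variables (a b x0 y0 k : R).
Hypothesis ab : a ^+ 2 + b ^+ 2 = 1.
Hypothesis k0 : 0 < k.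
Let c := - (a * x0 + b * y0).
Let l : plane -> R := aff a b c.
Variable Om : set plane.
Hypothesis bO : bdomain Om.
Hypothesis cO : cvx Om.
Hypothesis Hk : forall p, Om p -> k * (`|p.1 - x0| + `|p.2 - y0|) <= l p.

Let lE p : l p = a * (p.1 - x0) + b * (p.2 - y0).
Proof. by rewrite /l /aff /c; ring. Qed.

Lemma near_corner (t : R) p : Om p -> l p <= t ->
  `|p.1 - x0| + `|p.2 - y0| <= t / k.
Proof. by move=> Op lt; rewrite ler_pdivlMr// mulrC (le_trans (Hk Op)). Qed.

Lemma cvxI Om1 Om2 : cvx Om1 -> cvx Om2 -> cvx (Om1 `&` Om2).
Proof. by move=> c1 c2 p q t [p1 p2] [q1 q2] t01; split; [exact: c1|exact: c2]. Qed.

Lemma cvx_lt (a' b' c' e : R) : cvx [set p | aff a' b' c' p < e].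
Proof.
move=> p q t /= hp hq /andP[t0 t1].
have -> : aff a' b' c' (t * p.1 + (1 - t) * q.1, t * p.2 + (1 - t) * q.2)
  = t * aff a' b' c' p + (1 - t) * aff a' b' c' q by rewrite /aff /=; ring.
have [tp|tn] := ltP 0 t.
  have : t * aff a' b' c' p < t * e by rewrite ltr_pM2l.
  have : (1 - t) * aff a' b' c' q <= (1 - t) * e.
    by apply: ler_wpM2l; [rewrite subr_ge0|exact: ltW].
  lra.
have -> : t = 0 by apply/eqP; rewrite eq_le tn t0.
by rewrite mul0r add0r subr0 mul1r.
Qed.

Lemma cvx_gt (a' b' c' e : R) : cvx [set p | e < aff a' b' c' p].
Proof.
have -> : [set p | e < aff a' b' c' p] = [set p | aff (- a') (- b') (- c') p < - e].
  apply/seteqP; split=> p /=; rewrite -ltrN2; congr (_ < _); rewrite /aff; ring.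
exact: cvx_lt.
Qed.

(** * The field glued into the tip *)

Section Field.
Variables (e dl tau : R).
Hypothesis e0 : 0 < e.
Hypothesis dl0 : 0 < dl.
Hypothesis dle : dl < e.
Hypothesis tau0 : 0 < tau.
Hypothesis tauk : tau <= k / 8.

(** By [near_corner], the part of [Om] with l <= 2 e lies in the square of radius [rho], where [kap]
    is 1; [kap] serves to give the inner field compact support. *)
Let rho := 2 * e / k.
(** The transition from the inner field on l <= e to the given field on l >= e + dl. The width [dl]
    is independent of e so that it can be chosen after the given field. *)
Let chi (p : plane) : R := step (dl^-1 * (l p - e)).
Let sigma (p : plane) : R := dl^-1 * 'D_1 (@step R) (dl^-1 * (l p - e)).
Let s (p : plane) : R := tau / e * (b * (p.1 - x0) - a * (p.2 - y0)).
(* Since s is linear along the direction (b, - a) of the cut, the field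
   s (b, - a) - (1 - s^2) (a, b) has divergence tau / e, and the square of its
   length is 1 - s^2 (1 - s^2). *)
Let X1 (p : plane) : R := s p * b - (1 - s p * s p) * a.
Let X2 (p : plane) : R := - (s p * a) - (1 - s p * s p) * b.
Let kap := cutoff x0 y0 rho.

Let rho0 : 0 < rho.
Proof. by rewrite divr_gt0// mulr_gt0. Qed.

Lemma Ck_chi_arg n : Ck n (fun p => dl^-1 * (l p - e)).
Proof. by apply: CkZ; apply: CkB; [exact: Ck_aff|exact: Ck_cst]. Qed.

Lemma Ck_chi n : Ck n chi.
Proof. by apply: (@Ck_comp _ n step); [exact: Cn_step|exact: Ck_chi_arg]. Qed.

Lemma sigma_continuous : continuous sigma.
Proof.
apply: (@Ck_continuous _ 0%N); apply: CkZ.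
apply: (@Ck_comp _ 0%N (fun t => 'D_1 step t)); last exact: Ck_chi_arg.
by have [_] := Cn1_derive (@Cn_step R 1).
Qed.

Lemma is_derive_chi (p v : plane) : is_derive p v chi (sigma p * (a * v.1 + b * v.2)).
Proof.
have [ds _] := Cn1_derive (@Cn_step R 1).
have H := is_deriveMr_ (is_derive_cst (dl^-1 : R^o) p v)
  (is_deriveDr_ (is_derive_aff a b c p v) (is_deriveNr_ (is_derive_cst (e : R^o) p v))).
have H' := is_derive_compV H (ds (dl^-1 * (l p - e))).
by apply: is_derive_eq H' _; rewrite /sigma /cst; ring.
Qed.

Lemma Ck_s n : Ck n s.
Proof.
have := Ck_aff (tau / e * b) (- (tau / e * a)) (tau / e * (a * y0 - b * x0)) n.
by congr (Ck _ _); apply/funext => p; rewrite /aff /s; ring.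
Qed.

Lemma is_derive_s (p v : plane) : is_derive p v s (tau / e * (b * v.1 - a * v.2)).
Proof.
have H := is_derive_aff (tau / e * b) (- (tau / e * a)) (tau / e * (a * y0 - b * x0)) p v.
have E : aff (tau / e * b) (- (tau / e * a)) (tau / e * (a * y0 - b * x0)) = s.
  by apply/funext => q; rewrite /aff /s; ring.
by rewrite E in H; apply: is_derive_eq H _; ring.
Qed.

Lemma Ck_X1 n : Ck n X1.
Proof.
have Cs := Ck_s n.
apply: CkB; apply: CkM => //; try exact: Ck_cst.
by apply: CkB; [exact: Ck_cst|exact: CkM].
Qed.

Lemma Ck_X2 n : Ck n X2.
Proof.
have Cs := Ck_s n.
apply: CkB; last first.
  apply: CkM; last exact: Ck_cst.
  by apply: CkB; [exact: Ck_cst|exact: CkM].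
by apply: CkN; apply: CkM => //; exact: Ck_cst.
Qed.

Lemma is_derive_X1 (p v : plane) : is_derive p v X1
  (tau / e * (b * v.1 - a * v.2) * (b + 2 * a * s p)).
Proof.
have ds := is_derive_s p v.
have H := is_deriveDr_ (is_deriveMr_ ds (is_derive_cst (b : R^o) p v))
  (is_deriveNr_ (is_deriveMr_ (is_deriveDr_ (is_derive_cst (1 : R^o) p v)
     (is_deriveNr_ (is_deriveMr_ ds ds))) (is_derive_cst (a : R^o) p v))).
by apply: is_derive_eq H _; rewrite /cst; ring.
Qed.

Lemma is_derive_X2 (p v : plane) : is_derive p v X2
  (tau / e * (b * v.1 - a * v.2) * (- a + 2 * b * s p)).
Proof.
have ds := is_derive_s p v.
have H := is_deriveDr_ (is_deriveNr_ (is_deriveMr_ ds (is_derive_cst (a : R^o) p v)))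
  (is_deriveNr_ (is_deriveMr_ (is_deriveDr_ (is_derive_cst (1 : R^o) p v)
     (is_deriveNr_ (is_deriveMr_ ds ds))) (is_derive_cst (b : R^o) p v))).
by apply: is_derive_eq H _; rewrite /cst; ring.
Qed.

Definition glue (F X : plane -> R) (p : plane) : R :=
  chi p * F p + (1 - chi p) * (kap p * X p).

Lemma s_bound (p : plane) (t : R) : `|p.1 - x0| + `|p.2 - y0| <= t -> `|s p| <= tau / e * t.
Proof.
move=> h; have te : 0 <= tau / e by rewrite divr_ge0 ?ltW.
rewrite /s normrM (ger0_norm te) ler_wpM2l//.
apply: le_trans h; apply: le_trans (ler_normB _ _) _.
have [a1 b1] : `|a| <= 1 /\ `|b| <= 1 by apply: sqr_sum_le1; rewrite ab.
by rewrite !normrM lerD// ler_piMl.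
Qed.

(** The glued field is a pointwise convex combination of two fields in the unit disc. For the inner
    one |s| <= 1 is needed where [kap] is nonzero, within 2 rho in each coordinate; there |s| <= 8
    tau / k, whence [tauk]. *)
Lemma glue_admissible F1 F2 : admissible F1 F2 ->
  admissible (glue F1 X1) (glue F2 X2).
Proof.
move=> [[C1 S1] [C2 S2] H].
have Cg F X : Ck 1 F -> Ck 1 X -> Ck 1 (glue F X).
  move=> CF CX; have Cc := Ck_chi 1.
  apply: (CkD (CkM Cc CF)).
  exact: (CkM (CkB (Ck_cst 1 1) Cc) (CkM (Ck_cutoff x0 y0 rho 1) CX)).
have Sg F X : compactly_supported setT F -> compactly_supported setT (glue F X).
  move=> /support_bounded[M HM].
  apply: (@bounded_support _ (`|M| + (`|x0| + `|y0| + 2 * rho))) => p.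
  have z0 : 0 <= `|x0| by []. have z1 : 0 <= `|y0| by []. have z2 : 0 <= `|M| by [].
  have [F0|Fp] := eqVneq (F p) 0; last first.
    move=> _; have := HM p Fp; have := ler_norm M; have := rho0.
    by move: z0 z1 z2; set q := `|p.1|; set q' := `|p.2|; lra.
  rewrite /glue F0 mulr0 add0r mulf_eq0 negb_or => /andP[_].
  rewrite mulf_eq0 negb_or => /andP[kp _].
  have [h1 h2] := cutoff_neq0 rho0 kp.
  have t1 : `|p.1| <= `|p.1 - x0| + `|x0| by rewrite -{1}(subrK x0 p.1) ler_normD.
  have t2 : `|p.2| <= `|p.2 - y0| + `|y0| by rewrite -{1}(subrK y0 p.2) ler_normD.
  by move: z0 z1 z2 h1 h2 t1 t2; set q := `|p.1|; set q' := `|p.2|; lra.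
split; [by split; [apply: Cg => //; exact: Ck_X1|exact: Sg]
       |by split; [apply: Cg => //; exact: Ck_X2|exact: Sg]|].
move=> p; rewrite /glue.
have Y1 : (kap p * X1 p) ^+ 2 + (kap p * X2 p) ^+ 2 <= 1.
  have kE x : (kap p * x) ^+ 2 = kap p ^+ 2 * x ^+ 2 by rewrite exprMn.
  rewrite !kE -mulrDr.
  have [->|kp] := eqVneq (kap p) 0; first by rewrite expr0n /= mul0r.
  have [h1 h2] := cutoff_neq0 rho0 kp.
  have s1 : `|s p| <= 1.
    apply: le_trans (s_bound (lerD h1 h2)) _.
    have -> : tau / e * (2 * rho + 2 * rho) = 8 * tau / k.
      by rewrite /rho; field; rewrite !lt0r_neq0.
    rewrite ler_pdivrMr// mul1r; move: tauk; rewrite ler_pdivlMr//; lra.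
  have s2 : s p ^+ 2 <= 1 by rewrite -real_normK ?num_real// expr_le1.
  have -> : X1 p ^+ 2 + X2 p ^+ 2 = (a ^+ 2 + b ^+ 2) * (1 - s p ^+ 2 * (1 - s p ^+ 2)).
    by rewrite /X1 /X2; ring.
  rewrite ab mul1r.
  have /andP[c0 c1] := cutoff01 x0 y0 rho p.
  have q0 : 0 <= s p ^+ 2 * (1 - s p ^+ 2).
    by apply: mulr_ge0; [exact: sqr_ge0|rewrite subr_ge0].
  have q1 : s p ^+ 2 * (1 - s p ^+ 2) <= 1.
    by apply: mulr_ile1; rewrite ?sqr_ge0 ?subr_ge0// gerBl sqr_ge0.
  by apply: mulr_ile1; rewrite ?sqr_ge0 ?expr_le1 ?subr_ge0 ?gerBl.
have := H p; have c0 : 0 <= chi p by exact: step_ge0.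
have c1 : chi p <= 1 by exact: step_le1.
move: Y1; set y1 := kap p * _; set y2 := kap p * _; set f1 := F1 p; set f2 := F2 p.
set x := chi p in c0 c1 *; move=> hy hf.
have cx (u v : R) : (x * u + (1 - x) * v) ^+ 2 <= x * u ^+ 2 + (1 - x) * v ^+ 2.
  have : 0 <= x * (1 - x) * (u - v) ^+ 2.
    by apply: mulr_ge0; [apply: mulr_ge0; rewrite ?subr_ge0|exact: sqr_ge0].
  lra.
apply: le_trans (lerD (cx f1 y1) (cx f2 y2)) _.
have h1 : x * (f1 ^+ 2 + f2 ^+ 2) <= x * 1 by rewrite ler_wpM2l.
have h2 : (1 - x) * (y1 ^+ 2 + y2 ^+ 2) <= (1 - x) * 1 by rewrite ler_wpM2l// subr_ge0.
lra.
Qed.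

Lemma chi_gt p : e + dl <= l p -> chi p = 1.
Proof. by move=> h; rewrite /chi step_ge1// mulrC ler_pdivlMr//; lra. Qed.

Lemma chi_le p : l p <= e -> chi p = 0.
Proof. by move=> h; rewrite /chi step_le0// mulrC ler_pdivrMr//; lra. Qed.

Lemma sigma_gt p : e + dl <= l p -> sigma p = 0.
Proof. by move=> h; rewrite /sigma dstep_ge1 ?mulr0// mulrC ler_pdivlMr//; lra. Qed.

Lemma sigma_ge0 p : 0 <= sigma p.
Proof. by rewrite mulr_ge0 ?dstep_ge0// invr_ge0 ltW. Qed.

(** The gradient of [chi] contributes sigma (F - X) . (a, b). Since F . (a, b) >= -1 and X . (a, b)
    = - (1 - s^2), this is at least - s^2 sigma, and |s| <= 2 tau / k on l < 2 e. *)
Lemma glue_div F1 F2 p : admissible F1 F2 -> Om p ->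
  chi p * div F1 F2 p + tau / e * (1 - chi p) - 4 * tau ^+ 2 / k ^+ 2 * sigma p
  <= div (glue F1 X1) (glue F2 X2) p.
Proof.
move=> [[C1 _] [C2 _] H] Op.
(* The glued field coincides with F on the open set l > e + dl, and has [kap] = 1 on the part of
   [Om] with l < 2 e; [dle] makes these two regions cover [Om]. *)
have [l2|l2] := ltP (l p) (2 * e); last first.
  have h : e + dl < l p by apply: lt_le_trans l2; rewrite mulr_natl mulr2n ltrD2l.
  rewrite (chi_gt (ltW h)) (sigma_gt (ltW h)) mul1r subrr !mulr0 subr0 addr0.
  pose U := [set q | e + dl < l q].
  have oU : open U by exact: aff_open_gt.
  have E F X q : U q -> glue F X q = F q.
    by move=> Uq; rewrite /glue chi_gt ?ltW// mul1r subrr mul0r addr0.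
  by rewrite /div (D_open_eq _ oU h (E F1 X1)) (D_open_eq _ oU h (E F2 X2)).
pose U := Om `&` [set q | l q < 2 * e].
have oU : open U by apply: openI; [exact: bO.1|exact: aff_open_lt].
have Up : U p by split.
have E F X q : U q -> glue F X q = chi q * F q + (1 - chi q) * X q.
  move=> [Oq lq]; rewrite /glue /kap cutoff_eq1 ?mul1r//.
    apply: le_trans (near_corner Oq (ltW lq)); by rewrite lerDl.
  by apply: le_trans (near_corner Oq (ltW lq)); rewrite lerDr.
rewrite /div (D_open_eq _ oU Up (E F1 X1)) (D_open_eq _ oU Up (E F2 X2)).
have D (F X : plane -> R) (v : plane) (dF dX : R) :
   is_derive p v F dF -> is_derive p v X dX ->
   'D_v (fun q => chi q * F q + (1 - chi q) * X q) p
   = chi p * dF + (1 - chi p) * dX + sigma p * (a * v.1 + b * v.2) * (F p - X p).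
  move=> HF HX; have dc := is_derive_chi p v.
  have [_ ->] := is_deriveDr_ (is_deriveMr_ dc HF)
    (is_deriveMr_ (is_deriveDr_ (is_derive_cst (1 : R^o) p v) (is_deriveNr_ dc)) HX).
  by rewrite /cst; ring.
rewrite (D _ _ _ _ _ (Ck_is_derive p (@axes1 R) C1) (is_derive_X1 p (e1 R))).
rewrite (D _ _ _ _ _ (Ck_is_derive p (@axes2 R) C2) (is_derive_X2 p (e2 R))).
rewrite /= !mulr1 !mulr0 subr0 sub0r addr0 add0r.
have HF := H p.
set d1 := 'D_(e1 R) F1 p; set d2 := 'D_(e2 R) F2 p.
have -> : chi p * d1 + (1 - chi p) * (tau / e * b * (b + 2 * a * s p)) +
    sigma p * a * (F1 p - X1 p) +
    (chi p * d2 + (1 - chi p) * (tau / e * - a * (- a + 2 * b * s p)) +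
    sigma p * b * (F2 p - X2 p))
  = chi p * (d1 + d2) + tau / e * (1 - chi p) * (a ^+ 2 + b ^+ 2)
   + sigma p * (a * F1 p + b * F2 p + (1 - s p ^+ 2) * (a ^+ 2 + b ^+ 2)).
  by rewrite /X1 /X2; ring.
rewrite ab !mulr1 lerD2l -mulNr mulrC.
apply: ler_wpM2l; first exact: sigma_ge0.
have F0 : - 1 <= a * F1 p + b * F2 p.
  have := sqr_ge0 (a + F1 p); have := sqr_ge0 (b + F2 p).
  by move: HF ab; lra.
have s2 : s p ^+ 2 <= 4 * tau ^+ 2 / k ^+ 2.
  have := s_bound (near_corner Op (ltW l2)).
  have -> : tau / e * (2 * e / k) = 2 * tau / k by field; rewrite !lt0r_neq0.
  move=> h; rewrite -real_normK ?num_real//.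
  have -> : 4 * tau ^+ 2 / k ^+ 2 = (2 * tau / k) ^+ 2 by field; rewrite lt0r_neq0.
  by rewrite lerXn2r// nnegrE// divr_ge0 ?mulr_ge0 ?ltW.
lra.
Qed.

(** Orders of magnitude after integrating [glue_div]: the tip gains tau / e times its area, the
    [sigma] term costs a multiple of tau^2 e, and the strip e < l < e + dl, where [chi] has not yet
    reached 1, costs O(dl). *)
Lemma glue_int F1 F2 (P K : R) : admissible F1 F2 ->
  int_ Om (div (glue F1 X1) (glue F2 X2)) <= P ->
  (forall p, Om p -> `|div F1 F2 p| <= K) -> 0 <= K ->
  int_ (Om `&` [set p | e < l p]) (div F1 F2) <=
    P - tau / e * area (Om `&` [set p | l p < e])
    + 4 * tau ^+ 2 / k ^+ 2 * (16 * e / k) + K * (16 * e / k) * dl.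
Proof.
move=> aF HP HK K0; have [[C1 _] [C2 _] _] := aF.
have [[Cg1 _] [Cg2 _] _] := glue_admissible aF.
have cdiv := div_continuous C1 C2.
have cg := div_continuous Cg1 Cg2.
have cchi := Ck_continuous (Ck_chi 0).
have csig := sigma_continuous.
have oC : open [set p | e < l p] by exact: aff_open_gt.
have bC : bdomain (Om `&` [set p | e < l p]) by exact: bdomainI.
have w0 : 0 <= 2 * e / k by rewrite divr_ge0 ?mulr_ge0 ?ltW.
have capw U : (forall p, U p -> Om p /\ l p <= 2 * e) ->
    forall p, U p -> `|p.1 - x0| <= 2 * e / k /\ `|p.2 - y0| <= 2 * e / k.
  move=> HU p /HU[Op lp]; have H := near_corner Op lp.
  by split; apply: le_trans H; rewrite ?lerDl ?lerDr.
have [a1 b1] : `|a| <= 1 /\ `|b| <= 1 by apply: sqr_sum_le1; rewrite ab.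
(* The field (a, b) * chi has divergence sigma. *)
have Isig : int_ Om sigma <= 16 * e / k.
  pose U := Om `&` [set p | l p < 2 * e].
  have oU : open [set p | l p < 2 * e] by exact: aff_open_lt.
  have bU : bdomain U by exact: bdomainI.
  have cU : cvx U by apply: cvxI => //; exact: cvx_lt.
  rewrite (@int_sub_eq _ Om U); last 2 first.
  - by move=> p [].
  - move=> p Op nU; apply: sigma_gt; rewrite leNgt; apply/negP => h; apply: nU.
    by split=> //=; apply: lt_trans h _; rewrite mulr_natl mulr2n ltrD2l.
  have -> : int_ U sigma = int_ U (div (fun p => a * chi p) (fun p => b * chi p)).
    apply: eq_int => p _; rewrite /div.
    have [_ ->] := is_deriveMr_ (is_derive_cst (a : R^o) p (e1 R)) (is_derive_chi p (e1 R)).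
    have [_ ->] := is_deriveMr_ (is_derive_cst (b : R^o) p (e2 R)) (is_derive_chi p (e2 R)).
    rewrite /cst /= !mulr0 !mulr1 addr0 add0r addr0.
    have -> : sigma p = sigma p * (a ^+ 2 + b ^+ 2) by rewrite ab mulr1.
    by rewrite ab mulr1 -[LHS]mulr1 -ab; ring.
  apply: le_trans (ler_norm _) _.
  have -> : 16 * e / k = 8 * 1 * (2 * e / k) by ring.
  have ch p : `|chi p| <= 1 by rewrite ger0_norm ?step_ge0 ?step_le1.
  apply: (@div_bound U _ _ x0 y0) => //.
  - by apply: CkZ; exact: Ck_chi.
  - by apply: CkZ; exact: Ck_chi.
  - by apply: capw => p [Op lp]; split=> //; exact: ltW.
  - by move=> p _; rewrite normrM mulr_ile1.
  - by move=> p _; rewrite normrM mulr_ile1.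
have Ichi : area (Om `&` [set p | l p < e]) <= int_ Om (fun p => 1 - chi p).
  have oU : open [set p | l p < e] by exact: aff_open_lt.
  have bU : bdomain (Om `&` [set p | l p < e]) by exact: bdomainI.
  have c1 : continuous (fun p => 1 - chi p).
    by move=> p; apply: cvgB; [exact: cvg_cst|exact: cchi].
  apply: le_trans (int_sub_le bO bU _ c1 _).
  - rewrite le_eqVlt; apply/orP; left; apply/eqP; apply: eq_int => p [_ /= lp].
    by rewrite chi_le ?subr0// ltW.
  - by move=> p [].
  - by move=> p _; rewrite subr_ge0 step_le1.
(* The field (a, b) * (l - e) has divergence 1. *)
have Astrip : area (Om `&` [set p | e < l p] `&` [set p | l p < e + dl])
    <= 16 * e / k * dl.
  set S := _ `&` _.
  have oS : open [set p | l p < e + dl] by exact: aff_open_lt.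
  have bS : bdomain S by exact: bdomainI.
  have cS : cvx S.
    by apply: cvxI; [apply: cvxI => //; exact: cvx_gt|exact: cvx_lt].
  have Cl z n : Ck n (fun p => z * (l p - e)).
    by apply: CkZ; apply: CkB; [exact: Ck_aff|exact: Ck_cst].
  have -> : area S = int_ S (div (fun p => a * (l p - e)) (fun p => b * (l p - e))).
    apply: eq_int => p _; rewrite /div.
    have D z v : 'D_v (fun p => z * (l p - e)) p = z * (a * v.1 + b * v.2).
      have [_ ->] := is_deriveMr_ (is_derive_cst (z : R^o) p v)
        (is_deriveDr_ (is_derive_aff a b c p v) (is_deriveNr_ (is_derive_cst (e : R^o) p v))).
      by rewrite /cst; ring.
    by rewrite !D /= !mulr1 !mulr0 addr0 add0r -!expr2 ab.
  apply: le_trans (ler_norm _) _.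
  have -> : 16 * e / k * dl = 8 * dl * (2 * e / k) by ring.
  have ch p : S p -> `|l p - e| <= dl.
    move=> [[_ /= h1] /= h2]; rewrite ger0_norm ?subr_ge0 1?ltW//.
    by rewrite ltrBlDl.
  apply: (@div_bound S _ _ x0 y0) => //.
  - exact: ltW.
  - apply: capw => p [[Op _] /= lp]; split=> //; apply: ltW; apply: lt_trans lp _.
    by rewrite mulr_natl mulr2n ltrD2l.
  - by move=> p Sp; rewrite normrM; apply: le_trans (ch p Sp); rewrite ler_piMl.
  - by move=> p Sp; rewrite normrM; apply: le_trans (ch p Sp); rewrite ler_piMl.
have cchid : continuous (fun p => chi p * div F1 F2 p).
  by move=> p; apply: cvgM; [exact: cchi|exact: cdiv].
have Idiv : int_ (Om `&` [set p | e < l p]) (div F1 F2) <=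
   int_ Om (fun p => chi p * div F1 F2 p) + K * (16 * e / k * dl).
  rewrite (@int_sub_eq _ Om (Om `&` [set p | e < l p]) (fun p => chi p * div F1 F2 p)); last 2 first.
  - by move=> p [].
  - move=> p Op nC; rewrite chi_le ?mul0r// leNgt; apply/negP => h; apply: nC.
    by split.
  rewrite -lerBlDl -intB//.
  have := @int_le_area _ (Om `&` [set p | e < l p]) [set p | l p < e + dl]
    (fun p => div F1 F2 p - chi p * div F1 F2 p) K bC.
  move=> /(_ (@aff_open_lt _ _ _ _ _)) H; apply: le_trans (H _ K0 _ _) _.
  - by move=> p; apply: cvgB; [exact: cdiv|exact: cchid].
  - move=> p [Op _]; have -> : div F1 F2 p - chi p * div F1 F2 p
        = (1 - chi p) * div F1 F2 p by ring.
    apply: le_trans (ler_norm _) _; rewrite normrM; apply: le_trans (HK p Op).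
    rewrite ler_piMl// ger0_norm ?subr_ge0 ?step_le1// gerBl step_ge0//.
  - move=> p _ /= /negP; rewrite -leNgt => h.
    by rewrite chi_gt// mul1r subrr.
  - exact: ler_wpM2l.
have te : 0 <= tau / e by rewrite divr_ge0 ?ltW.
have tk : 0 <= 4 * tau ^+ 2 / k ^+ 2 by rewrite divr_ge0 ?mulr_ge0 ?exprn_ge0 ?ltW.
have c1 : continuous (fun p => tau / e * (1 - chi p)).
  move=> p; apply: cvgM; first exact: cvg_cst.
  by apply: cvgB; [exact: cvg_cst|exact: cchi].
have c2 : continuous (fun p => 4 * tau ^+ 2 / k ^+ 2 * sigma p).
  by move=> p; apply: cvgM; [exact: cvg_cst|exact: csig].
have c3 : continuous (fun p => chi p * div F1 F2 p + tau / e * (1 - chi p)).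
  by move=> p; apply: cvgD; [exact: cchid|exact: c1].
have c4 : continuous (fun p => chi p * div F1 F2 p + tau / e * (1 - chi p)
   - 4 * tau ^+ 2 / k ^+ 2 * sigma p).
  by move=> p; apply: cvgB; [exact: c3|exact: c2].
have := le_trans (int_le bO c4 cg (fun p Op => glue_div aF Op)) HP.
have cc : continuous (fun p => 1 - chi p).
  by move=> p; apply: cvgB; [exact: cvg_cst|exact: cchi].
have E1 := intZ (tau / e) bO cc.
have E2 := intZ (4 * tau ^+ 2 / k ^+ 2) bO csig.
rewrite intB// intD// E1 E2.
have h1 := ler_wpM2l te Ichi; have h2 := ler_wpM2l tk Isig.
move: h1 h2 Idiv.
set u1 := int_ _ (div F1 F2); set u2 := int_ Om (fun p => chi p * _).
set u3 := int_ Om sigma; set u4 := int_ Om (fun p => 1 - chi p).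
set u5 := area _; set u6 := tau / e; set u7 := 4 * _ / _; set u8 := 16 * e / k.
lra.
Qed.

End Field.
End Corner.
End Perimeter.

(** * The perimeter gain is linear in the height of the cut *)

Section PerimeterCut.
Context {R : realType}.
Local Notation plane := (R * R)%type.
Local Notation "'int_' Om f" := (\int[leb2 R]_(p in Om) f p)
  (at level 10, Om at level 8, f at level 8).
Implicit Types (Om U : set plane) (f g F : plane -> R).

(** Replace p by a nearby p' in [Om] and compensate by shifting q to q' = q + ((1 - t) / t) (p -
    p'), which stays in [Om] since [Om] is open; the target is t q' + (1 - t) p'. *)
Lemma cvx_closure Om (p q : plane) (t : R) : open Om -> cvx Om ->
  closure Om p -> Om q -> 0 < t <= 1 ->
  Om (t * q.1 + (1 - t) * p.1, t * q.2 + (1 - t) * p.2).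
Proof.
move=> oO cO cp Oq /andP[t0 t1].
have [r r0 S] := open_cbox oO Oq.
have [p' [Op' Bp']] := cp _ (nbhsx_ballx p (t * r) (mulr_gt0 t0 r0)).
case: Bp'; rewrite /ball /= => h1 h2.
pose s := (1 - t) / t.
have s0 : 0 <= s by rewrite divr_ge0 ?subr_ge0// ltW.
have bnd (x : R) : `|x| < t * r -> `|s * x| <= r.
  move=> h; rewrite normrM (ger0_norm s0).
  apply: (@le_trans _ _ (s * (t * r))); first by rewrite ler_wpM2l// ltW.
  rewrite mulrA /s divfK ?lt0r_neq0// ler_piMl// ?ltW//; lra.
pose q' : plane := (q.1 + s * (p.1 - p'.1), q.2 + s * (p.2 - p'.2)).
have Oq' : Om q'.
  apply: S; have := bnd _ h1; have := bnd _ h2; rewrite !ler_norml => k2 k1.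
  by split; rewrite /= in_itv /=; lra.
have t01 : 0 <= t <= 1 by rewrite ltW.
have := cO _ _ _ Oq' Op' t01; congr (Om (_, _)); rewrite /q' /s /=; field;
  exact: lt0r_neq0.
Qed.

Variables (a b x0 y0 k : R).
Hypothesis ab : a ^+ 2 + b ^+ 2 = 1.
Hypothesis k0 : 0 < k.
Let c := - (a * x0 + b * y0).
Let l : plane -> R := aff a b c.
Variable Om : set plane.
Hypothesis bO : bdomain Om.
Hypothesis cO : cvx Om.
Hypothesis Hk : forall p, Om p -> k * (`|p.1 - x0| + `|p.2 - y0|) <= l p.

Lemma cap_boxed (t : R) : forall p, (Om `&` [set p | l p < t]) p ->
  `|p.1 - x0| <= t / k /\ `|p.2 - y0| <= t / k.
Proof.
move=> p [Op lp]; have H := near_corner k0 Hk Op (ltW lp).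
by split; apply: le_trans H; rewrite ?lerDl ?lerDr.
Qed.

Lemma cap_bdomain (t : R) : bdomain (Om `&` [set p | l p < t]).
Proof. by apply: bdomainI => //; exact: aff_open_lt. Qed.

Lemma cap_cvx (t : R) : cvx (Om `&` [set p | l p < t]).
Proof. by apply: cvxI => //; exact: cvx_lt. Qed.

(** The field (x - x0, 0) has divergence 1 and is at most t / k on the tip, which also has half
    width at most t / k. *)
Lemma cap_area_le (t : R) : 0 < t ->
  area (Om `&` [set p | l p < t]) <= 8 / k ^+ 2 * t ^+ 2.
Proof.
move=> t0; set S := Om `&` _.
have bS : bdomain S by exact: cap_bdomain.
have w0 : 0 <= t / k by rewrite divr_ge0 ?ltW.
have -> : area S = int_ S (div (aff 1 0 (- x0)) (fun=> 0)).
  apply: eq_int => p _; rewrite /div derive_cst addr0.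
  by have [_ ->] := is_derive_aff 1 0 (- x0) p (e1 R); rewrite /= mulr1 mulr0 addr0.
apply: le_trans (ler_norm _) _.
have := @div_bound _ S (aff 1 0 (- x0)) (fun=> 0) x0 y0 (t / k) (t / k) bS
  (@cap_cvx t) (Ck_aff _ _ _ 1) (Ck_cst 1 0) w0 w0 (@cap_boxed t).
have -> : 8 * (t / k) * (t / k) = 8 / k ^+ 2 * t ^+ 2.
  by field; rewrite lt0r_neq0.
apply.
  move=> p /cap_boxed[h _]; rewrite /aff mul1r mul0r addr0//.
by move=> p _; rewrite normr0.
Qed.

Variables (q0 : plane) (r M : R).
Hypothesis r0 : 0 < r.
Hypothesis Sr : box q0.1 q0.2 r `<=` Om.
Hypothesis cp0 : closure Om (x0, y0).
Hypothesis HM : forall p, box q0.1 q0.2 r p -> l p < M.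
Hypothesis M0 : 0 < M.

(** The homothety of ratio e / M centred at the corner maps the box into the tip: by convexity it
    stays in [Om], and it multiplies l by e / M. *)
Lemma cap_area_ge (e : R) : 0 < e -> e <= M ->
  4 * r ^+ 2 / M ^+ 2 * e ^+ 2 <= area (Om `&` [set p | l p < e]).
Proof.
move=> e0 eM; pose t := e / M.
have t0 : 0 < t by rewrite divr_gt0.
have t1 : t <= 1 by rewrite ler_pdivrMr// mul1r.
have tr : 0 < t * r by rewrite mulr_gt0.
have -> : 4 * r ^+ 2 / M ^+ 2 * e ^+ 2
   = area (box (t * q0.1 + (1 - t) * x0) (t * q0.2 + (1 - t) * y0) (t * r)).
  by rewrite box_area// /t; field; rewrite lt0r_neq0.
apply: area_sub; [exact: cap_bdomain|exact: box_bdomain|].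
move=> z [/= z1 z2].
pose q : plane := ((z.1 - (1 - t) * x0) / t, (z.2 - (1 - t) * y0) / t).
have inv (x y m : R) : t * x + (1 - t) * y - t * r < m < t * x + (1 - t) * y + t * r ->
    x - r < (m - (1 - t) * y) / t < x + r.
  move=> h; have t0' := t0; rewrite ltr_pdivlMr// ltr_pdivrMr//.
  by move: h; rewrite [(x - r) * t]mulrC [(x + r) * t]mulrC; lra.
have Bq : box q0.1 q0.2 r q by split; exact: inv.
have zE : z = (t * q.1 + (1 - t) * x0, t * q.2 + (1 - t) * y0).
  rewrite [LHS]surjective_pairing /q /=; congr (_, _); field; exact: lt0r_neq0.
have t01 : 0 < t <= 1 by rewrite t0.
split.
  rewrite zE; apply: (@cvx_closure Om (x0, y0) q t bO.1 cO cp0 _ t01).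
  exact: Sr.
rewrite /=.
have -> : l z = t * l q by rewrite {1}zE /l /aff /c /=; ring.
have -> : e = t * M by rewrite /t divfK// lt0r_neq0.
by rewrite ltr_pM2l// HM.
Qed.

(** The first bound is the one required by [glue_admissible]. The second makes the loss 64 tau^2 e /
    k^3 at most half of the gain 4 tau r^2 e / M^2; the other half is [cut_gain]. *)
Let tau := Num.min (k / 8) (r ^+ 2 * k ^+ 3 / (32 * M ^+ 2)).

Definition cut_gain : R := 2 * tau * r ^+ 2 / M ^+ 2.

Let tau0 : 0 < tau.
Proof. by rewrite lt_min !divr_gt0 ?mulr_gt0 ?exprn_gt0. Qed.

Lemma cut_gain_gt0 : 0 < cut_gain.
Proof. by rewrite divr_gt0 ?mulr_gt0 ?exprn_gt0. Qed.

Lemma perimeter_cut (P e : R) : 0 < e -> e <= M ->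
  (forall F1 F2, admissible F1 F2 -> int_ Om (div F1 F2) <= P) ->
  forall F1 F2, admissible F1 F2 ->
    int_ (chop a b c e Om) (div F1 F2) <= P - cut_gain * e.
Proof.
move=> e0 eM HP F1 F2 aF; have [[C1 _] [C2 _] _] := aF.
have bC : bdomain (chop a b c e Om) by apply: bdomainI => //; exact: aff_open_gt.
have cdiv := div_continuous C1 C2.
have [_ [N bN]] := bO.
have [K K0 HK] := continuous_bounded N cdiv.
have tauk : tau <= k / 8 by rewrite ge_min lexx.
have tauM : tau <= r ^+ 2 * k ^+ 3 / (32 * M ^+ 2) by rewrite ge_min lexx orbT.
(* K bounds the divergence of the given field, so [dl] can tend to 0 only once that field is
   fixed. *)
suff main dl : 0 < dl -> dl < e ->
   int_ (chop a b c e Om) (div F1 F2) <= P - cut_gain * e + (16 * e / k * K) * dl.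
  set C := 16 * e / k * K in main.
  have C0 : 0 <= C by rewrite mulr_ge0 ?divr_ge0 ?mulr_ge0 ?ltW.
  apply/ler_addgt0Pr => d d0.
  pose dl := Num.min (e / 2) (d / (C + 1)).
  have C1' : 0 < C + 1 by lra.
  have dl0 : 0 < dl by rewrite lt_min !divr_gt0.
  have dle : dl < e by rewrite gt_min; apply/orP; left; lra.
  apply: le_trans (main dl dl0 dle) _; rewrite lerD2l.
  have : dl <= d / (C + 1) by rewrite ge_min lexx orbT.
  rewrite ler_pdivlMr// => h; apply: le_trans h; rewrite mulrC ler_wpM2l ?(ltW dl0)//; lra.
move=> dl0 dle.
have aG := glue_admissible x0 y0 ab k0 dl e0 tau0 tauk aF.
have dK p : Om p -> `|div F1 F2 p| <= K by move=> /bN[]; exact: HK.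
apply: le_trans (glue_int ab k0 bO cO Hk e0 dl0 dle tau0 tauk aF (HP _ _ aG) dK (ltW K0)) _.
have hA := cap_area_ge e0 eM.
have te : 0 <= tau / e by rewrite divr_ge0 ?ltW.
have h1 := ler_wpM2l te hA.
have E1 : tau / e * (4 * r ^+ 2 / M ^+ 2 * e ^+ 2) = 4 * tau * r ^+ 2 / M ^+ 2 * e.
  by field; rewrite !lt0r_neq0.
have h2 : 4 * tau ^+ 2 / k ^+ 2 * (16 * e / k) <= 2 * tau * r ^+ 2 / M ^+ 2 * e.
  have -> : 4 * tau ^+ 2 / k ^+ 2 * (16 * e / k) = 64 / k ^+ 3 * (tau * e) * tau.
    by field; rewrite lt0r_neq0.
  have -> : 2 * tau * r ^+ 2 / M ^+ 2 * e
     = 64 / k ^+ 3 * (tau * e) * (r ^+ 2 * k ^+ 3 / (32 * M ^+ 2)).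
    by field; rewrite !lt0r_neq0.
  apply: ler_wpM2l => //; rewrite mulr_ge0 ?divr_ge0 ?exprn_ge0 ?ltW//.
  exact: mulr_gt0.
have E2 : K * (16 * e / k) * dl = 16 * e / k * K * dl by ring.
rewrite E1 in h1; rewrite E2 /cut_gain; move: h1 h2; rewrite /l.
set z1 := tau / e * _; set z2 := 2 * tau * r ^+ 2 / M ^+ 2 * e.
have -> : 4 * tau * r ^+ 2 / M ^+ 2 * e = 2 * z2 by rewrite /z2; ring.
lra.
Qed.

End PerimeterCut.

(** * Maximisers have no corner *)

Section NoCorner.
Context {R : realType}.
Local Notation plane := (R * R)%type.
Local Notation "'int_' Om f" := (\int[leb2 R]_(p in Om) f p)
  (at level 10, Om at level 8, f at level 8).
Implicit Types (Om U : set plane) (f g F : plane -> R).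

Lemma convex_set_cvx Om : convex_set (Om : set (convex_lmodType plane)) <-> cvx Om.
Proof.
split=> [H p q t Op Oq /andP[t0 t1]|H p q t].
  by have := H p q (Itv01 t0 t1); rewrite !inE => /(_ Op Oq).
rewrite !inE => Op Oq.
have t01 : 0 <= t%:num <= 1 by rewrite ge0 le1.
exact: H Op Oq t01.
Qed.

Lemma convex_domainE Om : convex_domain Om <-> [/\ Om !=set0, bdomain Om & cvx Om].
Proof.
split=> [ [ O0 oO [M [_ HM]] cO]|[ O0 [oO [M bM]] cO]].
  split=> //; last exact/convex_set_cvx.
  split=> //; exists (`|M| + 1) => p Op.
  have /HM : M < `|M| + 1 by have := ler_norm M; lra.
  by move=> /(_ p Op); rewrite /= prod_normE ge_max => /andP[].
split=> //; last exact/convex_set_cvx.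
exists M; split; first exact: num_real.
move=> x Mx p /bM[h1 h2]; rewrite /= prod_normE ge_max.
by rewrite (le_trans h1 (ltW Mx)) (le_trans h2 (ltW Mx)).
Qed.

Lemma G_fin Om (T L P : R) : torsion Om = T%:E -> eigenvalue1 Om = L%:E ->
  perimeter Om = P%:E -> 0 < P -> G Om = (T * L / P ^+ 2)%:E.
Proof.
rewrite /G => -> -> -> P0.
by rewrite -EFin_expe inver expf_eq0 /= gt_eqF// -!EFinM.
Qed.

Lemma dir_sub Om Om' psi : Om' `<=` Om -> test_function Om' psi ->
  dir Om psi = dir Om' psi.
Proof.
move=> S tp; apply: int_sub_eq => // p _ nO.
have H v : psi p = 0 /\ 'D_v psi p = 0 by apply: D_outside_support => /tp.2.2.
by rewrite (H (e1 R)).2 (H (e2 R)).2 expr0n /= addr0.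
Qed.

Lemma int_test_sub Om Om' psi n : Om' `<=` Om -> test_function Om' psi ->
  int_ Om (fun p => psi p ^+ n.+1) = int_ Om' (fun p => psi p ^+ n.+1).
Proof.
move=> S tp; apply: int_sub_eq => // p _ nO.
have [-> _] : psi p = 0 /\ 'D_0 psi p = 0 by apply: D_outside_support => /tp.2.2.
by rewrite expr0n.
Qed.

(* A first order drop of P outweighs a second order drop of T. *)
Lemma cut_arith (T L P c C m : R) : 0 < T -> 0 < L -> 0 < c ->
  0 <= C -> 0 < m ->
  (forall e, 0 < e -> e < m ->
    exists T' L' P', [/\ T <= T' + C * e ^+ 2, L <= L', 0 < P' & P' <= P - c * e] /\
      T' * L' / P' ^+ 2 <= T * L / P ^+ 2 /\ 0 < T') -> False.
Proof.
move=> T0 L0 c0 C0 m0 H.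
(* The comparison gives T P^2 <= T (P - c e)^2 + C e^2 P^2, that is 2 T P c <= e (T c^2 + C P^2).
   The extra 1 in D contradicts this strictly as soon as e D <= 2 T P c. *)
pose D := C * P ^+ 2 + T * c ^+ 2 + 1.
have D0 : 0 < D.
  have := mulr_ge0 C0 (sqr_ge0 P); have := mulr_ge0 (ltW T0) (sqr_ge0 c).
  by rewrite /D; lra.
(* A preliminary cut at m / 2, used only to see that P > 0. *)
have [T1 [L1 [P1 [[_ _ q1 q2] _]]]] : exists T' L' P',
    [/\ T <= T' + C * (m / 2) ^+ 2, L <= L', 0 < P' & P' <= P - c * (m / 2)] /\
      T' * L' / P' ^+ 2 <= T * L / P ^+ 2 /\ 0 < T'.
  by apply: H; lra.
have cm0 : 0 < c * (m / 2) by rewrite mulr_gt0 ?divr_gt0.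
have P0 : 0 < P by lra.
pose e := Num.min (m / 2) (2 * T * P * c / D).
have TPc : 0 < 2 * T * P * c by rewrite !mulr_gt0.
have e0 : 0 < e by rewrite lt_min !divr_gt0.
have em : e < m by rewrite gt_min; apply/orP; left; lra.
have eD : e * D <= 2 * T * P * c by rewrite -ler_pdivlMr// ge_min lexx orbT.
have [T2 [L2 [P2 [[hT hL p0 hP] [hG t0]]]]] := H e e0 em.
have P20 : 0 < P2 ^+ 2 by rewrite exprn_gt0.
have PP0 : 0 < P ^+ 2 by rewrite exprn_gt0.
have h1 : T2 * L / P2 ^+ 2 <= T * L / P ^+ 2.
  by apply: le_trans hG; rewrite ler_pM2r ?invr_gt0// ler_pM2l.
have h2 : T2 * P ^+ 2 <= T * P2 ^+ 2.
  rewrite ler_pdivrMr// mulrAC ler_pdivlMr// in h1.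
  by rewrite -(ler_pM2r L0) mulrAC (le_trans h1)// mulrAC.
have h3 : P2 ^+ 2 <= (P - c * e) ^+ 2.
  by rewrite lerXn2r// nnegrE ?(ltW p0)//; apply: le_trans hP; exact: ltW.
have h4 : T * P2 ^+ 2 <= T * (P - c * e) ^+ 2 by rewrite ler_pM2l.
have h5 : T * P ^+ 2 <= (T2 + C * e ^+ 2) * P ^+ 2 by rewrite ler_pM2r.
have h6 : e * (e * D) <= e * (2 * T * P * c) by rewrite ler_pM2l.
have h7 : 0 < e ^+ 2 by rewrite exprn_gt0.
by move: h2 h4 h5 h6; rewrite /D; lra.
Qed.

Lemma no_corner Om (a b x0 y0 k : R) : convex_domain Om ->
  (forall Om', convex_domain Om' -> (G Om' <= G Om)%E) ->
  a ^+ 2 + b ^+ 2 = 1 -> 0 < k -> closure Om (x0, y0) ->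
  (forall p, Om p -> k * (`|p.1 - x0| + `|p.2 - y0|) <= a * (p.1 - x0) + b * (p.2 - y0)) ->
  False.
Proof.
move=> dO maxO ab k0 cp0 Hk0; have /convex_domainE[ O0 bO cO] := dO.
pose c := - (a * x0 + b * y0); pose l := aff a b c.
have lE p : l p = a * (p.1 - x0) + b * (p.2 - y0) by rewrite /l /aff /c; ring.
have Hk p : Om p -> k * (`|p.1 - x0| + `|p.2 - y0|) <= l p by move=> /Hk0; rewrite lE.
have [a1 b1] : `|a| <= 1 /\ `|b| <= 1 by apply: sqr_sum_le1; rewrite ab.
(* The corner inequality gives l >= 0 on [Om]. Equality is excluded by moving a little against the
   gradient (a, b) inside the open set. *)
have lpos p : Om p -> 0 < l p.
  move=> Op; rewrite ltNge; apply/negP => lp.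
  have [r r0 S] := open_cbox bO.1 Op.
  pose q : plane := (p.1 - r * a, p.2 - r * b).
  have rb (z : R) : `|z| <= 1 -> `|r * z| <= r.
    by move=> z1; rewrite normrM (gtr0_norm r0) ler_piMr// ltW.
  have Oq : Om q.
    apply: S; have := rb _ a1; have := rb _ b1; rewrite !ler_norml => k2 k1.
    by split; rewrite /= in_itv /=; lra.
  have lq : l q = l p - r * (a ^+ 2 + b ^+ 2) by rewrite /l /aff /q /=; ring.
  have h0 : 0 <= k * (`|q.1 - x0| + `|q.2 - y0|) by rewrite mulr_ge0 ?addr_ge0// ltW.
  by have := le_trans h0 (Hk _ Oq); rewrite lq ab; lra.
have [_ [N bN]] := bO.
pose d := `|N| + `|N| + `|x0| + `|y0| + 1.
have d0 : 0 < d by rewrite ltr_wpDl// !addr_ge0.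
have lltd p : Om p -> l p < d.
  move=> /bN[h1 h2]; rewrite lE.
  have n1 := ler_norm N.
  have t1 : a * (p.1 - x0) <= `|p.1| + `|x0|.
    apply: le_trans (ler_norm _) _; rewrite normrM.
    by apply: le_trans (ler_normB _ _); rewrite ler_piMl.
  have t2 : b * (p.2 - y0) <= `|p.2| + `|y0|.
    apply: le_trans (ler_norm _) _; rewrite normrM.
    by apply: le_trans (ler_normB _ _); rewrite ler_piMl.
  by rewrite /d; lra.
have l0d p : Om p -> 0 < l p < d by move=> Op; rewrite lpos// lltd.
have [q0 Oq0] := O0.
have [r r0 S0] := open_cbox bO.1 Oq0.
have Sr : box q0.1 q0.2 r `<=` Om.
  by move=> q [/= h1 h2]; apply: S0; split; rewrite /= in_itv /=; lra.
have HM p : box q0.1 q0.2 r p -> l p < d by move=> /Sr /lltd.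
have [T [T0 ET _ lbT]] := torsion_spec O0 bO.
have [L [L0 EL lbL _]] := eigenvalue_spec O0 bO.
have [P [P0 EP HP _]] := perimeter_spec O0 bO cO.
have [K K0 HK] := @step_bounds R.
pose gain := cut_gain k r d.
have g0 : 0 < gain by exact: cut_gain_gt0.
pose B := 80 * d ^+ 2 * K + 9 * d ^+ 2.
have B0 : 0 <= B by rewrite addr_ge0 ?mulr_ge0 ?sqr_ge0 ?ltW.
(* The torsion loss lives on l < 4 e, so the area bound is applied at 4 e and produces 16. *)
pose C := B * (8 / k ^+ 2 * 16).
have C0 : 0 <= C by rewrite mulr_ge0 ?mulr_ge0 ?invr_ge0 ?sqr_ge0.
(* For e < l q0 the point q0 survives the cut, so the cut domain is nonempty. *)
apply: (@cut_arith T L P gain C (l q0)) => //; first exact: lpos.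
move=> e e0 eq0.
have ed : e <= d by apply: ltW; apply: lt_trans eq0 _; exact: lltd.
pose Oe := chop a b c e Om.
have bE : bdomain Oe by apply: bdomainI => //; exact: aff_open_gt.
have cE : cvx Oe by apply: cvxI => //; exact: cvx_gt.
have E0 : Oe !=set0 by exists q0; split.
have SE : Oe `<=` Om by move=> p [].
have dE : convex_domain Oe by apply/convex_domainE.
have [T' [T'0 ET' HT' _]] := torsion_spec E0 bE.
have [L' [L'0 EL' _ ubL']] := eigenvalue_spec E0 bE.
have [P' [P'0 EP' _ lbP']] := perimeter_spec E0 bE cE.
exists T', L', P'; split; last first.
  split=> //; have := maxO _ dE.
  by rewrite (G_fin ET EL EP P0) (G_fin ET' EL' EP' P'0) lee_fin.
split=> //.
- have Tb := torsion_cut_bound ab bO e0 K0 HK l0d d0 (ltW T'0) HT'.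
  have A0 := area_ge0 (Om `&` [set p | l p < 4 * e]).
  have := lbT _ _ Tb; rewrite -/B => Tle; apply: le_trans (Tle _) _.
    by rewrite addr_ge0 ?mulr_ge0// ltW.
  have e40 : 0 < 4 * e by rewrite mulr_gt0.
  rewrite lerD2l; have -> : C * e ^+ 2 = B * (8 / k ^+ 2 * (4 * e) ^+ 2).
    by rewrite /C; ring.
  by apply: ler_wpM2l => //; exact: (cap_area_le k0 bO cO Hk e40).
- have := ubL' L (ltW L0); apply => psi tpsi.
  rewrite -(int_test_sub 1 SE tpsi) -(dir_sub SE tpsi); apply: lbL.
  exact: test_functionS tpsi.
- apply: lbP' => F1 F2 aF.
  exact: (perimeter_cut ab k0 bO cO Hk r0 Sr cp0 HM d0 e0 ed HP aF).
Qed.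

End NoCorner.

(** * Convex sets with unique supporting slopes *)

Section Graph.
Context {R : realType}.
Implicit Types x y : R.

(** The inequality at x and at x + h traps the difference quotient between [al x] and [al (x + h)],
    which merge by continuity. *)
Lemma C1_of_subgradient (g al : R -> R) :
  (forall x x', g x + al x * (x' - x) <= g x') -> continuous al -> C1_fun g.
Proof.
move=> H ca.
have D x : is_derive x 1 g (al x).
  have C : (fun h : R => h^-1 *: ((g \o shift x) (h *: 1) - g x)) @ 0^' --> al x.
    apply/cvgrPdist_lt => e e0.
    have ch : (fun h : R => al (h + x)) @ 0 --> al x.
      rewrite -[X in _ --> al X](add0r x).
      apply: (@continuous_comp _ _ _ (fun h : R => h + x) al 0); last exact: ca.
      by apply: cvgD; [exact: cvg_id|exact: cvg_cst].
    move/cvgrPdist_lt : ch => /(_ _ e0) ch.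
    near=> h.
    have h0 : h != 0 by near: h; exact: nbhs_dnbhs_neq.
    have hh : `|al x - al (h + x)| < e.
      by near: h; exact: (nbhs_dnbhs ch).
    rewrite /= [h *: 1]mulr1.
    have H1 := H x (h + x); have H2 := H (h + x) x.
    have E1 : h + x - x = h by ring.
    have E2 : x - (h + x) = - h by ring.
    rewrite E1 in H1; rewrite E2 in H2.
    set q := h^-1 *: (g (h + x) - g x).
    have qh : q * h = g (h + x) - g x by rewrite /q /GRing.scale /= mulrC mulrA divff ?mul1r.
    set A := al (h + x) in hh H2.
    apply: le_lt_trans hh.
    have [hp|hn] := ltP 0 h.
      have k1 : al x <= q by rewrite -(ler_pM2r hp) qh; lra.
      have k2 : q <= A by rewrite -(ler_pM2r hp) qh; lra.
      by rewrite !ler0_norm ?subr_le0 ?(le_trans k1 k2)//; lra.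
    have hp : 0 < - h by rewrite oppr_gt0 lt_neqAle h0.
    have k1 : A <= q by rewrite -(ler_pM2r hp) mulrN [q * - h]mulrN qh; lra.
    have k2 : q <= al x by rewrite -(ler_pM2r hp) mulrN [al x * - h]mulrN qh; lra.
    by rewrite !ger0_norm ?subr_ge0 ?(le_trans k1 k2)//; lra.
  by apply: DeriveDef; [apply/cvg_ex; exists (al x)|exact: cvg_lim C].
split; first by move=> t; case: (D t).
suff -> : g^`()%classic = al by [].
by apply/funext => x; rewrite derive1E; case: (D x).
Unshelve. all: by end_near. Qed.

Variable A : R -> R -> Prop.
Hypothesis cA : forall x1 y1 x2 y2 t, A x1 y1 -> A x2 y2 -> 0 <= t <= 1 ->
  A (t * x1 + (1 - t) * x2) (t * y1 + (1 - t) * y2).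
Hypothesis oA : forall x y, A x y -> exists2 e, 0 < e &
  forall x' y', `|x' - x| < e -> `|y' - y| < e -> A x' y'.
Variable M : R.
Hypothesis bA : forall x y, A x y -> - M <= y.
Variables (u0 w1 r : R).
Hypothesis r0 : 0 < r.
Hypothesis boxA : forall x, `|x - u0| < r -> A x w1.

(** [bA] bounds the fibres below and [boxA] makes them nonempty for [|x - u0| < r], so that the
    infimum is a genuine one there rather than a default value. *)
Definition lower (x : R) : R := inf [set y | A x y].

(** Support is required against all of [A], not only near x: the exclusion of corners needs
    half-planes that contain the whole domain. *)
Definition subslope (x a : R) : Prop :=
  forall x' y', A x' y' -> lower x + a * (x' - x) <= y'.

Lemma lower_le x y : A x y -> lower x <= y.
Proof. by move=> Axy; apply: ge_inf => //; exists (- M) => z /bA. Qed.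

Lemma lower_lt x y : A x y -> lower x < y.
Proof.
move=> /oA[e e0 He]; have : A x (y - e / 2).
  apply: He; first by rewrite subrr normr0.
  rewrite addrAC subrr add0r normrN gtr0_norm ?divr_gt0//.
  by rewrite ltr_pdivrMr// ltr_pMr// ltr1n.
move=> /lower_le h; apply: le_lt_trans h _.
by rewrite ltrBlDr ltrDl divr_gt0.
Qed.

Lemma lower_ge x z : `|x - u0| < r -> (forall y, A x y -> z <= y) -> z <= lower x.
Proof. by move=> xr H; apply: lb_le_inf; [exists w1; exact: boxA|]. Qed.

Lemma lower_mem x y : `|x - u0| < r -> lower x < y -> y <= w1 -> A x y.
Proof.
move=> xr ly yw.
have hi : has_inf [set y | A x y].
  by split; [exists w1; exact: boxA|exists (- M) => z /bA].
have yl : 0 < y - lower x by rewrite subr_gt0.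
have [z Az] := inf_adherent yl hi.
rewrite -/(lower x) addrC subrK => zy.
have yzw : z <= y <= w1 by rewrite (ltW zy) yw.
have [t t01 ->] := real_between yzw.
have := cA Az (boxA xr) t01; congr (A _ _); ring.
Qed.

(** The supremum of the left secant slopes, hence the left derivative of the convex function
    [lower]. *)
Definition slope (x : R) : R :=
  sup [set a | exists x' y', [/\ A x' y', x' < x & a = (lower x - y') / (x - x')]].

(** At abscissa x, the segment joining the two points of [A] lies above [lower x]. *)
Lemma slope_comparison x x1 y1 x2 y2 : A x1 y1 -> A x2 y2 -> x1 < x -> x < x2 ->
  (lower x - y1) / (x - x1) <= (y2 - lower x) / (x2 - x).
Proof.
move=> A1 A2 x1x xx2.
have d1 : 0 < x - x1 by rewrite subr_gt0.
have d2 : 0 < x2 - x by rewrite subr_gt0.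
have d3 : 0 < x2 - x1 by lra.
pose t := (x2 - x) / (x2 - x1).
have t01 : 0 <= t <= 1.
  by rewrite /t divr_ge0 ?(ltW d2) ?(ltW d3)//= ler_pdivrMr// mul1r; lra.
have := lower_le (cA A1 A2 t01).
have -> : t * x1 + (1 - t) * x2 = x by rewrite /t; field; exact: lt0r_neq0.
move=> h; rewrite ler_pdivrMr// mulrAC ler_pdivlMr//.
have : (x2 - x1) * lower x <= (x2 - x1) * (t * y1 + (1 - t) * y2) by rewrite ler_pM2l.
have -> : (x2 - x1) * (t * y1 + (1 - t) * y2) = (x2 - x) * y1 + (x - x1) * y2.
  by rewrite /t; field; exact: lt0r_neq0.
lra.
Qed.

Lemma slope_sub x : `|x - u0| < r -> subslope x (slope x).
Proof.
move=> xr.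
pose S := [set a | exists x' y', [/\ A x' y', x' < x & a = (lower x - y') / (x - x')]].
have -> : slope x = sup S by [].
have [e e0 He] := oA (boxA xr).
have e2 : 0 < e / 2 by rewrite divr_gt0.
have ee : e / 2 < e by lra.
have Al : A (x - e / 2) w1.
  by apply: He; rewrite ?subrr ?normr0// addrAC subrr add0r normrN gtr0_norm.
have Ar : A (x + e / 2) w1.
  by apply: He; rewrite ?subrr ?normr0// addrAC subrr add0r gtr0_norm.
have S0 : S !=set0 by eexists; exists (x - e / 2), w1; split=> //; lra.
have ubS x2 y2 : A x2 y2 -> x < x2 -> ubound S ((y2 - lower x) / (x2 - x)).
  by move=> A2 xx2 _ [x1 [y1 [A1 x1x ->]]]; exact: slope_comparison.
have hS : has_sup S.
  by split=> //; eexists; apply: (ubS _ _ Ar); lra.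
move=> x' y' A'; have [h|h|h] := ltgtP x' x;
    [ | |by move: A'; rewrite h subrr mulr0 addr0; exact: lower_le].
  have d : 0 < x - x' by rewrite subr_gt0.
  have : (lower x - y') / (x - x') <= sup S.
    by apply: sup_upper_bound => //; exists x', y'.
  by rewrite ler_pdivrMr//; lra.
have d : 0 < x' - x by rewrite subr_gt0.
have : sup S <= (y' - lower x) / (x' - x) by apply: ge_sup => //; exact: ubS.
by rewrite ler_pdivlMr//; lra.
Qed.

Lemma lower_slope x x' : `|x - u0| < r -> `|x' - u0| < r ->
  lower x + slope x * (x' - x) <= lower x'.
Proof. by move=> xr xr'; apply: lower_ge => // y; exact: slope_sub. Qed.

(** A supporting line rises by at most w1 + M over a horizontal distance r / 4. *)
Let B := 4 * (w1 + M) / r.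

Lemma slope_bound x : `|x - u0| <= r / 2 -> `|slope x| <= B.
Proof.
move=> xr; have r0' := r0.
have xr' : `|x - u0| < r by apply: le_lt_trans xr _; lra.
have Aw := boxA xr'.
have lM : - M <= lower x by apply: lower_ge => // y; exact: bA.
have sh s : `|s| <= r / 4 -> A (x + s) w1.
  move=> hs; apply: boxA; rewrite addrAC; apply: le_lt_trans (ler_normD _ _) _; lra.
have n4 : `|r / 4| = r / 4 by rewrite gtr0_norm ?divr_gt0.
have h1 := slope_sub xr' (sh (r / 4) _); have h2 := slope_sub xr' (sh (- (r / 4)) _).
rewrite n4 lexx in h1; rewrite normrN n4 lexx in h2.
have {}h1 := h1 isT; have {}h2 := h2 isT.
rewrite addrAC subrr add0r in h1; rewrite addrAC subrr add0r in h2.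
by rewrite /B ler_norml -mulNr ler_pdivlMr// ler_pdivrMr//; lra.
Qed.

Lemma lower_lipschitz x x' : `|x - u0| <= r / 2 -> `|x' - u0| <= r / 2 ->
  `|lower x' - lower x| <= B * `|x' - x|.
Proof.
move=> xr xr'; have r0' := r0.
have h2 : r / 2 < r by lra.
have k1 := lower_slope (le_lt_trans xr h2) (le_lt_trans xr' h2).
have k2 := lower_slope (le_lt_trans xr' h2) (le_lt_trans xr h2).
have b1 : `|slope x * (x' - x)| <= B * `|x' - x|.
  by rewrite normrM ler_wpM2r// slope_bound.
have b2 : `|slope x' * (x - x')| <= B * `|x' - x|.
  by rewrite normrM [`|x - x'|]distrC ler_wpM2r// slope_bound.
by move: b1 b2; rewrite !ler_norml; lra.
Qed.

Hypothesis uniqA : forall x a b, `|x - u0| < r -> subslope x a -> subslope x b -> a = b.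

Lemma not_subslope x a : `|x - u0| < r -> a != slope x ->
  exists X Y, A X Y /\ Y < lower x + a * (X - x).
Proof.
move=> xr an; apply: contrapT => H; move/eqP: an; apply.
apply: uniqA xr _ (slope_sub xr) => X Y AXY.
by rewrite leNgt; apply/negP => h; apply: H; exists X, Y.
Qed.

(** The right side depends on x' through [lower] and through a x', with Lipschitz constant B + |a|
    in total. *)
Lemma violation_near x a X Y : `|x - u0| < r / 2 -> Y < lower x + a * (X - x) ->
  \forall x' \near x, `|x' - u0| < r / 2 /\ Y < lower x' + a * (X - x').
Proof.
move=> xr h.
pose eta := lower x + a * (X - x) - Y.
have eta0 : 0 < eta by rewrite /eta; lra.
pose C := B + `|a| + 1.
have B0 : 0 <= B by apply: le_trans (slope_bound (ltW xr)).
have C0 : 0 < C by rewrite ltr_wpDl// addr_ge0.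
pose dl := Num.min (r / 2 - `|x - u0|) (eta / C).
have dl0 : 0 < dl by rewrite lt_min subr_gt0 xr divr_gt0.
near=> x'.
have hx : `|x' - x| < dl.
  by rewrite distrC; near: x'; exact: (@cvgr_dist_lt _ _ _ (nbhs x) _ id x cvg_id _ dl0).
have [h1 h2] : `|x' - x| < r / 2 - `|x - u0| /\ `|x' - x| < eta / C.
  by move: hx; rewrite lt_min => /andP.
have xr' : `|x' - u0| < r / 2.
  have -> : x' - u0 = (x' - x) + (x - u0) by ring.
  by apply: le_lt_trans (ler_normD _ _) _; lra.
split=> //.
have k := lower_lipschitz (ltW xr) (ltW xr').
rewrite ltr_pdivlMr// mulrC /C in h2.
have k2 : `|a * (x' - x)| <= `|a| * `|x' - x| by rewrite normrM.
have k3 := normr_ge0 (x' - x).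
move: k k2; rewrite !ler_norml => /andP[k _] /andP[_ k2].
have h3 : B * `|x' - x| + `|a| * `|x' - x| < eta by lra.
rewrite /eta in h3.
have -> : a * (X - x') = a * (X - x) - a * (x' - x) by ring.
lra.
Unshelve. all: by end_near. Qed.

(** By uniqueness, slope x + e and slope x - e each fail to support at some point of [A]. The same
    two points witness the failure for all x' near x and confine slope x'. *)
Lemma slope_continuous x : `|x - u0| < r / 2 -> {for x, continuous slope}.
Proof.
move=> xr; have r0' := r0.
have xr1 : `|x - u0| < r by apply: lt_trans xr _; lra.
rewrite /prop_for /continuous_at; apply/cvgrPdist_le => e e0.
have ne1 : slope x + e != slope x by rewrite -subr_eq0 addrAC subrr add0r gt_eqF.
have ne2 : slope x - e != slope x by rewrite -subr_eq0 addrAC subrr add0r oppr_eq0 gt_eqF.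
have [X1 [Y1 [A1 V1]]] := not_subslope xr1 ne1.
have [X2 [Y2 [A2 V2]]] := not_subslope xr1 ne2.
(* On the left of x a larger slope gives a weaker condition, so the violation for slope x + e occurs
   on the right. *)
have X1x : x < X1.
  rewrite ltNge; apply/negP => h; have := slope_sub xr1 A1.
  have : e * (X1 - x) <= 0 by rewrite pmulr_rle0// subr_le0.
  lra.
have X2x : X2 < x.
  rewrite ltNge; apply/negP => h; have := slope_sub xr1 A2.
  have : 0 <= e * (X2 - x) by rewrite pmulr_rge0// subr_ge0.
  lra.
have N1 := violation_near xr V1; have N2 := violation_near xr V2.
near=> x'.
have [xr' v1] : `|x' - u0| < r / 2 /\ Y1 < lower x' + (slope x + e) * (X1 - x').
  by near: x'; exact: N1.
have [_ v2] : `|x' - u0| < r / 2 /\ Y2 < lower x' + (slope x - e) * (X2 - x').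
  by near: x'; exact: N2.
have xX1 : x' < X1 by near: x'; exact: lt_nbhsl.
have xX2 : X2 < x' by near: x'; exact: lt_nbhsr.
have xr1' : `|x' - u0| < r by apply: lt_trans xr' _; lra.
have s1 := slope_sub xr1' A1; have s2 := slope_sub xr1' A2.
have d1 : 0 < X1 - x' by rewrite subr_gt0.
have d2 : 0 < x' - X2 by rewrite subr_gt0.
have k1 : slope x' <= slope x + e.
  by rewrite -(ler_pM2r d1); lra.
have k2 : slope x - e <= slope x'.
  by rewrite -(ler_pM2r d2); lra.
by rewrite ler_norml; lra.
Unshelve. all: by end_near. Qed.

Definition clamp (x : R) : R := Num.max (u0 - r / 4) (Num.min x (u0 + r / 4)).

Lemma clamp_near x : `|clamp x - u0| <= r / 4.
Proof.
have r0' := r0; rewrite ler_distl /clamp le_max lexx /= ge_max ge_min lexx orbT andbT.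
lra.
Qed.

Lemma clamp_id x : `|x - u0| <= r / 4 -> clamp x = x.
Proof.
rewrite ler_distl => /andP[h1 h2]; rewrite /clamp.
by rewrite (min_idPl h2) (max_idPr h1).
Qed.

Lemma clamp_continuous : continuous clamp.
Proof.
move=> x; apply: (@continuous_max _ _ (fun=> u0 - r / 4) (fun x => Num.min x (u0 + r / 4))).
  exact: cvg_cst.
by apply: (@continuous_min _ _ id (fun=> u0 + r / 4)); [exact: cvg_id|exact: cvg_cst].
Qed.

Lemma clamp_sign (z x' : R) : `|z - u0| <= r / 4 ->
  [\/ x' = clamp x', x' < clamp x' /\ clamp x' <= z | clamp x' < x' /\ z <= clamp x'].
Proof.
rewrite ler_distl => /andP[h1 h2]; have r0' := r0.
have [a1|a1] := ltP x' (u0 - r / 4).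
  apply: Or32; have -> : clamp x' = u0 - r / 4.
    rewrite /clamp (min_idPl _); last lra.
    by rewrite (max_idPl _)// ltW.
  by split.
have [a2|a2] := ltP (u0 + r / 4) x'.
  apply: Or33; have -> : clamp x' = u0 + r / 4.
    rewrite /clamp (min_idPr _); last exact: ltW.
    by rewrite (max_idPr _)//; lra.
  by split.
by apply: Or31; rewrite clamp_id// ler_distl a1 a2.
Qed.

(** [C1_domain] asks for a function on the whole line: outside [u0 - r/4, u0 + r/4] the graph
    continues along its supporting lines at the end points. *)
Definition extension (x : R) : R := lower (clamp x) + slope (clamp x) * (x - clamp x).

Lemma clamp_r x : `|clamp x - u0| < r.
Proof. by have r0' := r0; apply: le_lt_trans (clamp_near x) _; lra. Qed.

Lemma extension_C1 : C1_fun extension.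
Proof.
apply: (@C1_of_subgradient _ (fun x => slope (clamp x))); last first.
  move=> x; have r0' := r0.
  apply: (@continuous_comp _ _ _ clamp slope); first exact: clamp_continuous.
  by apply: slope_continuous; apply: le_lt_trans (clamp_near x) _; lra.
move=> x x'; rewrite /extension.
have [cx cx'] := (clamp_r x, clamp_r x').
have h1 := lower_slope cx cx'; have h2 := lower_slope cx' cx.
set z := clamp x in cx h1 h2 *; set z' := clamp x' in cx' h1 h2 *.
(* The product vanishes unless x' was clamped. Then z' is an end point, and monotonicity of [slope]
   gives both factors compatible signs. *)
suff : 0 <= (slope z' - slope z) * (x' - z') by lra.
have mono (p q : R) : `|p - u0| < r -> `|q - u0| < r -> p <= q -> slope p <= slope q.
  move=> pr qr; rewrite le_eqVlt => /predU1P[->//|pq].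
  have k1 := lower_slope pr qr; have k2 := lower_slope qr pr.
  by rewrite -subr_ge0 -(@pmulr_lge0 _ (q - p)) ?subr_gt0//; lra.
have [e|[h3 h4]|[h3 h4]] := clamp_sign x' (clamp_near x).
- by rewrite /z' -e subrr mulr0.
- by rewrite -mulrNN mulr_ge0// ?oppr_ge0 subr_le0; [exact: mono|exact: ltW].
- by rewrite mulr_ge0// subr_ge0; [exact: mono|exact: ltW].
Qed.

Lemma extensionE x y : `|x - u0| <= r / 4 -> y <= w1 -> A x y <-> extension x < y.
Proof.
move=> xr yw; have r0' := r0.
rewrite /extension (clamp_id xr) subrr mulr0 addr0; split; first exact: lower_lt.
by move=> ly; apply: lower_mem => //; apply: le_lt_trans xr _; lra.
Qed.

End Graph.

(** * From distinct slopes to a corner, and the boundary chart *)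

Section Conclusion.
Context {R : realType}.
Local Notation plane := (R * R)%type.
Implicit Types (Om : set plane).

(* Two distinct supporting slopes confine Om to a sector of opening < pi. *)
Lemma sector_bound (a1 a2 u w : R) : a1 < a2 -> a1 * u <= w -> a2 * u <= w ->
  `|u| + `|w| <= (1 + (1 + `|(a1 + a2) / 2|) / ((a2 - a1) / 2)) * (w - (a1 + a2) / 2 * u).
Proof.
move=> a12 h1 h2; set m := (a1 + a2) / 2; set dl := (a2 - a1) / 2.
have dl0 : 0 < dl by rewrite /dl; lra.
have hu : `|u| <= (w - m * u) / dl.
  rewrite ler_pdivlMr// /m /dl; have [u0|u0] := leP 0 u.
    by rewrite (ger0_norm u0); lra.
  by rewrite (ltr0_norm u0); lra.
set L := w - m * u in hu *.
have hw : `|w| <= L + `|m| * `|u|.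
  have L0 : 0 <= L.
    by have := le_trans (normr_ge0 u) hu; rewrite ler_pdivlMr// mul0r.
  have -> : w = L + m * u by rewrite /L; ring.
  by apply: le_trans (ler_normD _ _) _; rewrite normrM (ger0_norm L0).
have : (1 + `|m|) * `|u| <= (1 + `|m|) * (L / dl) by rewrite ler_wpM2l// addr_ge0.
have -> : (1 + (1 + `|m|) / dl) * L = L + (1 + `|m|) * (L / dl) by ring.
lra.
Qed.

(** The mean slope m leaves room on both sides: (a, b) is the unit normal to the line of slope m, in
    the original coordinates. In k, D comes from [sector_bound], n normalises the normal, and 2 pays
    for rotating the norm |u| + |w|. *)
Lemma unique_slope Om (c s : R) (x g a1 a2 : R) :
  convex_domain Om -> (forall Om', convex_domain Om' -> (G Om' <= G Om)%E) ->
  c ^+ 2 + s ^+ 2 = 1 -> closure Om (c * x - s * g, s * x + c * g) ->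
  (forall p, Om p -> g + a1 * (c * p.1 + s * p.2 - x) <= - s * p.1 + c * p.2) ->
  (forall p, Om p -> g + a2 * (c * p.1 + s * p.2 - x) <= - s * p.1 + c * p.2) ->
  ~ a1 < a2.
Proof.
move=> dO maxO cs cl H1 H2 a12.
set m := (a1 + a2) / 2.
set D := 1 + (1 + `|m|) / ((a2 - a1) / 2).
have dl0 : 0 < (a2 - a1) / 2 by lra.
have D0 : 0 < D by rewrite ltr_wpDr// divr_ge0 ?addr_ge0// ltW.
have n20 : 0 < 1 + m ^+ 2 by rewrite ltr_pwDl// sqr_ge0.
set n := Num.sqrt (1 + m ^+ 2).
have n0 : 0 < n by rewrite sqrtr_gt0.
have nn : n ^+ 2 = 1 + m ^+ 2 by rewrite sqr_sqrtr// ltW.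
pose a := (- s - m * c) / n; pose b := (c - m * s) / n.
have ab : a ^+ 2 + b ^+ 2 = 1.
  have -> : a ^+ 2 + b ^+ 2 = (c ^+ 2 + s ^+ 2) * (1 + m ^+ 2) / n ^+ 2.
    by rewrite /a /b; field; exact: lt0r_neq0.
  by rewrite cs mul1r -nn divff// expf_neq0// lt0r_neq0.
have k0 : 0 < (2 * D * n)^-1 by rewrite invr_gt0 !mulr_gt0.
apply: (no_corner dO maxO ab k0 cl) => p Op.
set x0 := c * x - s * g; set y0 := s * x + c * g.
set u := c * p.1 + s * p.2 - x; set w := - s * p.1 + c * p.2 - g.
have e1 : p.1 - x0 = c * u - s * w.
  transitivity ((c ^+ 2 + s ^+ 2) * p.1 - x0); first by rewrite cs mul1r.
  by rewrite /x0 /u /w; ring.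
have e2 : p.2 - y0 = s * u + c * w.
  transitivity ((c ^+ 2 + s ^+ 2) * p.2 - y0); first by rewrite cs mul1r.
  by rewrite /y0 /u /w; ring.
have h1 : a1 * u <= w by have := H1 p Op; rewrite -/u /w; lra.
have h2 : a2 * u <= w by have := H2 p Op; rewrite -/u /w; lra.
have S := sector_bound a12 h1 h2; rewrite -/m -/D in S.
have [c1 s1] : `|c| <= 1 /\ `|s| <= 1 by apply: sqr_sum_le1; rewrite cs.
have e3 : a * (p.1 - x0) + b * (p.2 - y0) = (w - m * u) / n.
  transitivity ((c ^+ 2 + s ^+ 2) * (w - m * u) / n); last by rewrite cs mul1r.
  by rewrite e1 e2 /a /b; field; exact: lt0r_neq0.
rewrite e3 mulrC ler_pdivrMr ?mulr_gt0//.
have -> : (w - m * u) / n * (2 * D * n) = 2 * (D * (w - m * u)).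
  by field; exact: lt0r_neq0.
rewrite e1 e2.
have t1 : `|c * u - s * w| <= `|u| + `|w|.
  by apply: le_trans (ler_normB _ _) _; rewrite !normrM lerD// ler_piMl.
have t2 : `|s * u + c * w| <= `|u| + `|w|.
  by apply: le_trans (ler_normD _ _) _; rewrite !normrM lerD// ler_piMl.
lra.
Qed.

End Conclusion.

Theorem proposition1p3 (R : realType) (Om : set (R * R)%type)
    (convex_Om : convex_domain Om)
    (max_Om : forall Om' : set (R * R)%type,
       convex_domain Om' -> (G Om' <= G Om)%E) :
  C1_domain Om.
Proof.
have /convex_domainE[ O0 bO cO] := convex_Om.
have [oO [M bM]] := bO.
move=> p [cp nip].
have nOp : ~ Om p by move: nip; rewrite (interior_id _).1.
have [q0 Oq0] := O0.
set dx := q0.1 - p.1; set dy := q0.2 - p.2.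
have N20 : 0 < dx ^+ 2 + dy ^+ 2.
  rewrite lt_neqAle addr_ge0 ?sqr_ge0// andbT; apply/eqP => E; apply: nOp.
  have := esym E; move/eqP; rewrite paddr_eq0 ?sqr_ge0// !sqrf_eq0 !subr_eq0.
  move=> /andP[/eqP h1 /eqP h2].
  by rewrite [p]surjective_pairing -h1 -h2 -surjective_pairing.
set N := Num.sqrt (dx ^+ 2 + dy ^+ 2).
have N0 : 0 < N by rewrite sqrtr_gt0.
have NN : N ^+ 2 = dx ^+ 2 + dy ^+ 2 by rewrite sqr_sqrtr// ltW.
(* The second axis (- s, c) points from p to the interior point q0, which thus lies straight above p
   in the new frame. *)
pose s := - dx / N; pose c := dy / N.
have cs : c ^+ 2 + s ^+ 2 = 1.
  have -> : c ^+ 2 + s ^+ 2 = (dx ^+ 2 + dy ^+ 2) / N ^+ 2.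
    by rewrite /c /s; field; exact: lt0r_neq0.
  by rewrite NN divff// lt0r_neq0.
have [c1 s1] : `|c| <= 1 /\ `|s| <= 1 by apply: sqr_sum_le1; rewrite cs.
pose U (q : R * R) := c * q.1 + s * q.2.
pose W (q : R * R) := - s * q.1 + c * q.2.
pose A (x y : R) := Om (c * x - s * y, s * x + c * y).
have AE q : A (U q) (W q) <-> Om q.
  have -> : A (U q) (W q) = Om q; last by [].
  rewrite /A /U /W; congr (Om _); rewrite [RHS]surjective_pairing; congr (_, _).
    transitivity ((c ^+ 2 + s ^+ 2) * q.1); first by ring.
    by rewrite cs mul1r.
  transitivity ((c ^+ 2 + s ^+ 2) * q.2); first by ring.
  by rewrite cs mul1r.
pose u0 := U p; pose w0 := W p; pose w1 := W q0.
have Uq0 : U q0 = u0.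
  apply/eqP; rewrite -subr_eq0; apply/eqP.
  transitivity (c * dx + s * dy); first by rewrite /u0 /U /dx /dy; ring.
  by rewrite /c /s; field; exact: lt0r_neq0.
have w01 : w0 < w1.
  rewrite -subr_gt0; suff -> : w1 - w0 = N by [].
  transitivity (- s * dx + c * dy); first by rewrite /w1 /w0 /W /dx /dy; ring.
  transitivity ((dx ^+ 2 + dy ^+ 2) / N).
    by rewrite /c /s; field; exact: lt0r_neq0.
  by rewrite -NN expr2 mulfK// lt0r_neq0.
have cA (x1 y1 x2 y2 t : R) : A x1 y1 -> A x2 y2 -> 0 <= t <= 1 ->
    A (t * x1 + (1 - t) * x2) (t * y1 + (1 - t) * y2).
  move=> A1 A2 t01; have := cO _ _ _ A1 A2 t01; rewrite /A /=.
  by congr (Om (_, _)); ring.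
(* A rotation can double the coordinatewise distance at most, hence e / 2. *)
have rot (x y x' y' e : R) : 0 < e -> `|x' - x| < e / 2 -> `|y' - y| < e / 2 ->
    `|(c * x' - s * y') - (c * x - s * y)| < e /\
    `|(s * x' + c * y') - (s * x + c * y)| < e.
  move=> e0 h1 h2.
  have b (z t : R) : `|z| <= 1 -> `|z * t| <= `|t| by move=> z1; rewrite normrM ler_piMl.
  split.
    have -> : (c * x' - s * y') - (c * x - s * y) = c * (x' - x) - s * (y' - y) by ring.
    apply: le_lt_trans (ler_normB _ _) _.
    by have := b c (x' - x) c1; have := b s (y' - y) s1; lra.
  have -> : (s * x' + c * y') - (s * x + c * y) = s * (x' - x) + c * (y' - y) by ring.
  apply: le_lt_trans (ler_normD _ _) _.
  by have := b s (x' - x) s1; have := b c (y' - y) c1; lra.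
have oA (x y : R) : A x y -> exists2 e, 0 < e &
    forall x' y', `|x' - x| < e -> `|y' - y| < e -> A x' y'.
  move=> Axy; have [e e0 He] := open_cbox oO Axy.
  exists (e / 2); first by rewrite divr_gt0.
  move=> x' y' h1 h2; apply: He; have [] := rot _ _ _ _ _ e0 h1 h2.
  by rewrite /= !ltr_norml => k1 k2; split; rewrite /= in_itv /=; lra.
have bA (x y : R) : A x y -> - (`|M| + `|M|) <= y.
  have E : y = - s * (c * x - s * y) + c * (s * x + c * y).
    transitivity ((c ^+ 2 + s ^+ 2) * y); first by rewrite cs mul1r.
    by ring.
  move=> /bM[/= b1 b2]; rewrite E.
  have k1 : `|- s * (c * x - s * y)| <= `|M|.
    by rewrite normrM normrN; apply: le_trans (ler_wpM2r _ s1) _; rewrite // mul1r (le_trans b1)// ler_norm.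
  have k2 : `|c * (s * x + c * y)| <= `|M|.
    by rewrite normrM; apply: le_trans (ler_wpM2r _ c1) _; rewrite // mul1r (le_trans b2)// ler_norm.
  by move: k1 k2; rewrite !ler_norml; lra.
have Auw : A u0 w1 by rewrite -Uq0; apply/AE.
have [r r0 Hr] := oA u0 w1 Auw.
have boxA x : `|x - u0| < r -> A x w1 by move=> xr; apply: Hr; rewrite ?subrr ?normr0.
(* The graph point is approached from above along its own fibre; it is the candidate corner in
   [unique_slope]. *)
have clA x : `|x - u0| < r ->
    closure Om (c * x - s * lower A x, s * x + c * lower A x).
  move=> xr; set g := lower A x.
  have gw : g < w1 by exact: (lower_lt oA bA (boxA x xr)).
  move=> V /nbhs_ballP[e /= e0 He].
  pose h := Num.min (e / 4) (w1 - g).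
  have h0 : 0 < h by rewrite lt_min divr_gt0// subr_gt0.
  have [h1 h2] : h <= e / 4 /\ h <= w1 - g by rewrite !ge_min !lexx orbT.
  have Ah : A x (g + h).
    by apply: (lower_mem cA bA boxA) => //; rewrite -/g; lra.
  exists (c * x - s * (g + h), s * x + c * (g + h)); split=> //; apply: He.
  have [] := rot x g x (g + h) e e0.
  - by rewrite subrr normr0 divr_gt0.
  - by rewrite addrAC subrr add0r gtr0_norm//; lra.
  by move=> k1 k2; split; rewrite /ball /= distrC.
have slopes x a b : `|x - u0| < r -> subslope A x a -> subslope A x b -> ~ a < b.
  move=> xr sa sb; apply: (unique_slope convex_Om max_Om cs (clA x xr)).
    by move=> q /AE; exact: sa.
  by move=> q /AE; exact: sb.
have uniqA x a b : `|x - u0| < r -> subslope A x a -> subslope A x b -> a = b.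
  by move=> xr sa sb; have [/(slopes x _ _ xr sa sb)|/(slopes x _ _ xr sb sa)|] := ltgtP a b.
exists c, s, (extension A u0 r); split=> //.
  exact: (extension_C1 cA oA bA r0 boxA uniqA).
have UE q : U q = aff c s 0 q by rewrite /U /aff addr0.
have WE q : W q = aff (- s) c 0 q by rewrite /W /aff addr0.
have cU : U @ p --> u0.
  have -> : u0 = aff c s 0 p by exact: UE.
  have -> : U = aff c s 0 by apply/funext => q; exact: UE.
  exact: aff_cont.
have cW : W @ p --> w0.
  have -> : w0 = aff (- s) c 0 p by exact: WE.
  have -> : W = aff (- s) c 0 by apply/funext => q; exact: WE.
  exact: aff_cont.
(* Near p, a point stays over the interval of radius r / 4 and below the height w1 of q0, the range
   in which [extensionE] describes [Om]. *)
near=> q.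
have hU : `|U q - u0| <= r / 4.
  rewrite distrC; near: q; move/cvgrPdist_le : cU; apply.
  by rewrite divr_gt0.
have hW : W q <= w1.
  by near: q; exact: (cvgr_le _ cW).
rewrite -AE; exact: (extensionE cA oA bA r0 boxA hU hW).
Unshelve. all: by end_near.
Qed.
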